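(* Suppose $f,g\in L^2(D)$ with $g\neq0$, that $h\in L^\infty(0,T)$ is positive and satisfies $h\ge c_h$ for some constant $c_h>0$, and in addition that $g\in H^2(D)$. Let $u$ be the mild solution of the stochastic fractional diffusion equation with these source terms. Then there exists a constant $C>0$, independent of $f$ and $g$, such that $$\|f\|_{L^2(D)}^2+\|g\|_{L^2(D)}^2\le C\,\mathbb{E}\|u(\cdot,T)\|_{H^2(D)}^2.$$
   Context: Let $\alpha\in(1/2,1)$, $T>0$, and let $D\subset\mathbb{R}^n$ be open and bounded. Let $$\mathcal{A}u=-\sum_{i,j=1}^n a^{ij}(x)u_{x_ix_j}+\sum_{i=1}^n b^i(x)u_{x_i}+c(x)u,\qquad a^{ij},b^i,c\in C^\infty(\mathbb{R}^n),$$ be symmetric, elliptic and positive definite, considered with zero Dirichlet boundary condition on $\partial D$. Its eigensystem is $\{(\lambda_n,\phi_n):n\in\mathbb{N}^+\}$, where $0<\lambda_1\le\lambda_2\le\cdots$ and $\{\phi_n\}\subset H^2(D)\cap H^1_0(D)$ is an orthonormal basis of $L^2(D)$. The Mittag--Leffler function is $E_{\alpha,\beta}(z)=\sum_{k=0}^\infty \frac{z^k}{\Gamma(k\alpha+\beta)}$. Let $\mathbb{W}$ be a standard (one-dimensional) Wiener process on a probability space $(\Omega,\mathcal{F},\mathbb{P})$ with expectation $\mathbb{E}$. The equation is $\partial_t^\alpha u+\mathcal{A}u=f(x)h(t)+g(x)\dot{\mathbb{W}}(t)$ in $D\times(0,T]$, with $u=0$ on $\partial D\times(0,T]$ and $u(\cdot,0)=0$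 in $D$, where $\partial_t^\alpha$ is the Djrbashyan--Caputo fractional derivative. Its mild solution is by definition the stochastic process $$u(\cdot,t)=\sum_{n=1}^\infty\big(I_{n,1}(t)+I_{n,2}(t)\big)\phi_n(\cdot),\quad t\in[0,T],$$ $$I_{n,1}(t)=f_n\int_0^t(t-\tau)^{\alpha-1}E_{\alpha,\alpha}(-\lambda_n(t-\tau)^\alpha)h(\tau)\,d\tau,\quad I_{n,2}(t)=g_n\int_0^t(t-\tau)^{\alpha-1}E_{\alpha,\alpha}(-\lambda_n(t-\tau)^\alpha)\,d\mathbb{W}(\tau),$$ with $f_n=\langle f,\phi_n\rangle_{L^2(D)}$ and $g_n=\langle g,\phi_n\rangle_{L^2(D)}$. *)

(* Defs.v *)
From HB Require Import structures.
From mathcomp Require Import all_boot all_order all_algebra.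
From mathcomp Require Import all_classical all_reals all_analysis.
Import Order.TTheory GRing.Theory Num.Theory.
Import numFieldNormedType.Exports.

Set Implicit Arguments.
Unset Strict Implicit.
Unset Printing Implicit Defensive.

Local Open Scope classical_set_scope.
Local Open Scope ring_scope.

(* Lebesgue measure on n-tuples, by recursion on n: the push-forward of the
   product measure (Lebesgue on R) x (Lebesgue on n-tuples) under cons. *)
Section lebesgue_tuple.
Variables (R : realType) (n : nat).
Variable mu : {sigma_finite_measure set (n.-tuple R) -> \bar R}.

Definition tuple_cons (p : measurableTypeR R * n.-tuple R) : n.+1.-tuple R :=
  [the n.+1.-tuple R of p.1 :: p.2].

Lemma measurable_tuple_cons : measurable_fun setT tuple_cons.
Proof. exact: measurable_cons. Qed.

HB.instance Definition _ := isMeasurableFun.Build _ _ _ _ tuple_cons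
  measurable_tuple_cons.

Definition lebesgue_cons : set (n.+1.-tuple R) -> \bar R :=
  pushforward (lebesgue_measure \x mu)%E tuple_cons.

Let lebesgue_cons0 : lebesgue_cons set0 = 0%E.
Proof. exact: measure0. Qed.

Let lebesgue_cons_ge0 A : (0 <= lebesgue_cons A)%E.
Proof. exact: measure_ge0. Qed.

Let lebesgue_cons_sigma_additive : semi_sigma_additive lebesgue_cons.
Proof. exact: measure_semi_sigma_additive. Qed.

HB.instance Definition _ := isMeasure.Build _ _ _ lebesgue_cons
  lebesgue_cons0 lebesgue_cons_ge0 lebesgue_cons_sigma_additive.

Lemma sigma_finite_lebesgue_cons : sigma_finite setT lebesgue_cons.
Proof.
have /sigma_finiteP[F [TF ndF Foo]] := sigma_finiteT (@lebesgue_measure R).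
have /sigma_finiteP[G [TG ndG Goo]] := sigma_finiteT mu.
have mhead : measurable_fun setT (@thead n R) by exact: measurable_tnth.
have mtail := @measurable_behead _ R n.
exists (fun k => (@thead n R) @^-1` F k `&`
                 (fun t : n.+1.-tuple R => [tuple of behead t]) @^-1` G k).
  apply/esym; rewrite -subTset => t _.
  have [j _ Fj] : (\bigcup_k F k) (thead t) by rewrite -TF.
  have [k _ Gk] : (\bigcup_k G k) [tuple of behead t] by rewrite -TG.
  exists (maxn j k) => //; split.
    by have /subsetPset := ndF _ _ (leq_maxl j k); exact.
  by have /subsetPset := ndG _ _ (leq_maxr j k); exact.
move=> k; have [mF Fk] := Foo k; have [mG Gk] := Goo k; split.
  by apply: measurableI; rewrite -[X in measurable X]setTI;
    [exact: mhead|exact: mtail].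
rewrite /lebesgue_cons /pushforward (_ : _ @^-1` _ = F k `*` G k).
  by rewrite product_measure1E// lte_mul_pinfty// ge0_fin_numE.
apply/seteqP; split=> -[x t] /=.
  move=> [Fx]; rewrite (_ : [tuple of _] = t)//; exact/val_inj.
move=> [Fx Gt]; split=> //.
by rewrite (_ : [tuple of _] = t)//; exact/val_inj.
Qed.

HB.instance Definition _ := Measure_isSigmaFinite.Build _ _ _ lebesgue_cons
  sigma_finite_lebesgue_cons.

End lebesgue_tuple.

Fixpoint lebesgue_tuple (R : realType) (n : nat) :
    {sigma_finite_measure set (n.-tuple R) -> \bar R} :=
  if n is m.+1 then [the {sigma_finite_measure set (m.+1.-tuple R) -> \bar R} of
                     lebesgue_cons (lebesgue_tuple R m)]
  else [the {sigma_finite_measure set (0.-tuple R) -> \bar R} of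
        \d_([tuple])].

(* R^n is 'rV[R]_n, measurable for the sigma-algebra generated by the
   coordinates, i.e. for its Borel sets. *)
Section lebesgue_rV.
Variables (R : realType) (n : nat).

Let coord : 'I_n -> 'rV[R]_n -> R := fun i x => x ord0 i.

Let rV_set0 : g_sigma_preimage coord set0.
Proof. exact: sigma_algebra0. Qed.

Let rV_setC A : g_sigma_preimage coord A -> g_sigma_preimage coord (~` A).
Proof. exact: sigma_algebraC. Qed.

Let rV_bigcup (F : (set 'rV[R]_n)^nat) :
  (forall i, g_sigma_preimage coord (F i)) ->
  g_sigma_preimage coord (\bigcup_i F i).
Proof. exact: sigma_algebra_bigcup. Qed.

HB.instance Definition _ :=
  @isMeasurable.Build (measure_tuple_display default_measure_display)
    'rV[R]_n (g_sigma_preimage coord) rV_set0 rV_setC rV_bigcup.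

Definition rV_of_tuple (t : n.-tuple R) : 'rV[R]_n := \row_i tnth t i.

Lemma measurable_rV_of_tuple : measurable_fun setT rV_of_tuple.
Proof.
move=> _ A mA; rewrite setTI.
have : preimage_set_system setT rV_of_tuple (g_sigma_preimage coord)
    (rV_of_tuple @^-1` A).
  by exists A => //; rewrite setTI.
rewrite -g_sigma_preimage_comp.
rewrite (_ : (fun i => _) = fun (i : 'I_n) (t : n.-tuple R) => tnth t i)//.
by apply/funext => i; apply/funext => t; rewrite /coord /= mxE.
Qed.

HB.instance Definition _ := isMeasurableFun.Build _ _ _ _ rV_of_tuple
  measurable_rV_of_tuple.

Definition lebesgue_rV : set 'rV[R]_n -> \bar R :=
  pushforward (lebesgue_tuple R n) rV_of_tuple.

Let lebesgue_rV0 : lebesgue_rV set0 = 0%E.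
Proof. exact: measure0. Qed.

Let lebesgue_rV_ge0 A : (0 <= lebesgue_rV A)%E.
Proof. exact: measure_ge0. Qed.

Let lebesgue_rV_sigma_additive : semi_sigma_additive lebesgue_rV.
Proof. exact: measure_semi_sigma_additive. Qed.

HB.instance Definition _ := isMeasure.Build _ _ _ lebesgue_rV
  lebesgue_rV0 lebesgue_rV_ge0 lebesgue_rV_sigma_additive.

End lebesgue_rV.
Arguments lebesgue_rV : clear implicits.

Section function_spaces.
Variables (R : realType) (n : nat).
Implicit Types (D : set 'rV[R]_n) (u v f g : 'rV[R]_n -> R) (b : 'I_n -> nat).

Local Notation mu := (lebesgue_rV R n).

(* Elements of L^2(D) are represented by functions on R^n of which only the
   values on D matter. *)
Definition L2 D : set ('rV[R]_n -> R) :=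
  [set f | f \_ D \in Lfun mu 2%:E].

Definition L2norm D f : \bar R := 'N[mu]_2%:E[EFin \o (f \_ D)].

Definition L2dot D f g : R := \int[mu]_(x in D) (f x * g x).

Definition partial (i : 'I_n) f : 'rV[R]_n -> R :=
  fun x => 'D_(delta_mx ord0 i) f x.

Definition smooth f : Prop := forall s : seq 'I_n,
  let g := foldr partial f s in
  continuous g /\ forall i x, derivable g x (delta_mx ord0 i).

Definition test_function D f : Prop :=
  smooth f /\
  exists K, [/\ compact K, K `<=` D & forall x, ~ K x -> f x = 0].

Definition morder b : nat := (\sum_i b i)%N.

Definition mderive b f : 'rV[R]_n -> R :=
  foldr (fun i g => iter (b i) (partial i) g) f (enum 'I_n).

Definition is_weak_derive D b u v : Prop :=
  L2 D v /\ forall f, test_function D f ->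
    L2dot D u (mderive b f) = (-1) ^+ morder b * L2dot D v f.

Definition weak_derive D b u : 'rV[R]_n -> R :=
  xget (cst 0) [set v | is_weak_derive D b u v].

(* H^k(D) *)
Definition sobolev (k : nat) D : set ('rV[R]_n -> R) :=
  [set u | L2 D u /\
     forall b, (morder b <= k)%N -> exists v, is_weak_derive D b u v].

(* The squared norm of H^k(D), equal to +oo outside of H^k(D). *)
Definition sobolev_norm2 (k : nat) D u : \bar R :=
  if `[< sobolev k D u >] then
    (\sum_(b : {ffun 'I_n -> 'I_k.+1} | (morder (fun i => b i) <= k)%N)
       L2norm D (weak_derive D (fun i => b i) u) ^+ 2)%E
  else +oo%E.

(* H^1_0(D): the closure of the test functions in H^1(D). *)
Definition sobolev10 D : set ('rV[R]_n -> R) :=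
  [set u | sobolev 1 D u /\ exists f : nat -> 'rV[R]_n -> R,
     (forall m, test_function D (f m)) /\
     (fun m => sobolev_norm2 1 D (fun x => u x - f m x)) @ \oo --> 0%E].

End function_spaces.

Section elliptic_operator.
Variables (R : realType) (n : nat) (D : set 'rV[R]_n).
Variables (a : 'I_n -> 'I_n -> 'rV[R]_n -> R) (b : 'I_n -> 'rV[R]_n -> R)
  (c : 'rV[R]_n -> R).

Definition elliptic_op (u : 'rV[R]_n -> R) : 'rV[R]_n -> R := fun x =>
  - (\sum_i \sum_j
      a i j x * weak_derive D (fun l => (l == i) + (l == j))%N u x)
  + \sum_i b i x * weak_derive D (fun l => (l == i) : nat) u x
  + c x * u x.

(* H^2(D) and zero trace *)
Definition dirichlet_domain : set ('rV[R]_n -> R) :=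
  sobolev 2 D `&` sobolev10 D.

Definition uniformly_elliptic : Prop :=
  exists2 theta : R, 0 < theta & forall x, D x -> forall xi : 'rV[R]_n,
    theta * (\sum_i xi ord0 i ^+ 2) <=
    \sum_i \sum_j a i j x * xi ord0 i * xi ord0 j.

Definition symmetric_op : Prop := forall u v,
  dirichlet_domain u -> dirichlet_domain v ->
  L2dot D (elliptic_op u) v = L2dot D u (elliptic_op v).

Definition positive_definite_op : Prop := forall u,
  dirichlet_domain u -> L2norm D u != 0%E -> 0 < L2dot D (elliptic_op u) u.

(* Eigenpairs are numbered from 0. *)
Definition dirichlet_eigensystem (lambda : nat -> R)
    (phi : nat -> 'rV[R]_n -> R) : Prop :=
  [/\ 0 < lambda 0%N,
      {homo lambda : j k / (j <= k)%N >-> j <= k},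
      forall k, dirichlet_domain (phi k) /\
        {ae lebesgue_rV R n, forall x, D x ->
          elliptic_op (phi k) x = lambda k * phi k x},
      forall j k, L2dot D (phi j) (phi k) = (j == k)%:R &
      forall v, L2 D v ->
        (fun N => L2norm D (fun x =>
           v x - \sum_(k < N) L2dot D v (phi k) * phi k x)) @ \oo --> 0%E].

End elliptic_operator.

Section mittag_leffler.
Variable R : realType.

Definition Gamma (s : R) : R :=
  \int[lebesgue_measure]_(x in `]0, +oo[) (x `^ (s - 1) * expR (- x)).

Definition mittag_leffler (alpha beta z : R) : R :=
  limn (series (fun k => z ^+ k / Gamma (k%:R * alpha + beta))).

End mittag_leffler.

Section wiener.
Variables (R : realType) (d : measure_display) (Omega : measurableType d).
Variable P : probability Omega R.

Definition mutually_independent (m : nat) (X : 'I_m -> Omega -> R) : Prop :=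
  forall B : 'I_m -> set R, (forall i, measurable (B i)) ->
    P (\bigcap_i (X i @^-1` B i)) = (\prod_i P (X i @^-1` B i))%E.

(* Only the values W t with t >= 0 are constrained. *)
Definition wiener_process (W : R -> {RV P >-> R}) : Prop :=
  [/\ {ae P, forall w, W 0 w = 0},
      forall (m : nat) (t : nat -> R), 0 <= t 0%N ->
        {homo t : j k / (j <= k)%N >-> j <= k} ->
        mutually_independent
          (fun (i : 'I_m) w => W (t i.+1) w - W (t i) w),
      forall (s t : R), 0 <= s -> s < t ->
        forall B : set R, measurable B ->
          P ((fun w => W t w - W s w) @^-1` B) =
          normal_prob 0 (Num.sqrt (t - s)) B &
      {ae P, forall w, {within `[0, +oo[, continuous (fun t => W t w)}}].

Definition step_fun (m : nat) (t a : nat -> R) (x : R) : R :=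
  \sum_(i < m) a i * \1_(`]t i, t i.+1]) x.

Definition step_integral (W : R -> Omega -> R) (m : nat) (t a : nat -> R)
    (w : Omega) : R :=
  \sum_(i < m) a i * (W (t i.+1) w - W (t i) w).

(* X is (a version of) the Wiener integral over [0, T] of the deterministic
   function k: the L^2(Omega) limit of the integrals of step functions that
   converge to k in L^2(0, T). *)
Definition is_wiener_integral (W : R -> Omega -> R) (T : R) (k : R -> R)
    (X : {RV P >-> R}) : Prop :=
  exists (m : nat -> nat) (t a : nat -> nat -> R),
    [/\ forall j, {homo t j : p q / (p <= q)%N >-> p <= q},
        forall j p, 0 <= t j p <= T,
        (fun j => \int[lebesgue_measure]_(x in `[0%R, T])
           ((k x - step_fun (m j) (t j) (a j) x) ^+ 2)%:E)%E @ \oo --> 0%E &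
        (fun j => \int[P]_w
           ((X w - step_integral W (m j) (t j) (a j) w) ^+ 2)%:E)%E
          @ \oo --> 0%E].

End wiener.

Section mild_solution.
Variables (R : realType) (n : nat) (D : set 'rV[R]_n).
Variables (lambda : nat -> R) (phi : nat -> 'rV[R]_n -> R).
Variables (d : measure_display) (Omega : measurableType d).
Variables (P : probability Omega R) (W : R -> {RV P >-> R}).
Variables (alpha T : R) (h : R -> R) (f g : 'rV[R]_n -> R).

Definition relaxation_kernel (l t tau : R) : R :=
  (t - tau) `^ (alpha - 1) *
  mittag_leffler alpha alpha (- l * (t - tau) `^ alpha).

Definition mild_drift (k : nat) (t : R) : R :=
  L2dot D f (phi k) *
  \int[lebesgue_measure]_(tau in `[0, t])
    (relaxation_kernel (lambda k) t tau * h tau).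

(* The series converges in L^2(Omega; L^2(D)). *)
Definition mild_solution (u : R -> Omega -> 'rV[R]_n -> R) : Prop :=
  forall t, 0 <= t <= T ->
    measurable_fun (setT `*` D) (fun p : Omega * 'rV[R]_n => u t p.1 p.2) /\
    exists J : nat -> {RV P >-> R},
      (forall k, is_wiener_integral W t (relaxation_kernel (lambda k) t) (J k))
      /\
      (fun N => \int[P]_w (L2norm D (fun x => u t w x -
         \sum_(k < N)
           (mild_drift k t + L2dot D g (phi k) * J k w) * phi k x)%R ^+ 2))%E
        @ \oo --> 0%E.

End mild_solution.

(* Main.v *)
From HB Require Import structures.
Require Import Defs.
From mathcomp Require Import all_boot all_order all_algebra.
From mathcomp Require Import all_classical all_reals all_analysis.
From mathcomp Require Import measurable_realfun.
From mathcomp Require Import ring lra.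
Import Order.TTheory GRing.Theory Num.Theory.
Import numFieldNormedType.Exports.
Set Implicit Arguments.
Unset Strict Implicit.
Unset Printing Implicit Defensive.
Local Open Scope classical_set_scope.
Local Open Scope ring_scope.

(** Why the estimate holds.  The [k]-th coefficient of the solution at time [T]
    is [I_k = d_k + g_k J_k], with [d_k] deterministic and [J_k] the Wiener
    integral of the relaxation kernel of [lambda k].  Let [q_k] be the integral
    of that kernel over [0, T] and [Z = W T - W 0].  As [E J_k = 0] and
    [E (J_k Z) = q_k], both sources are seen by first moments of the solution:
    [E I_k = d_k] and [E (I_k Z) = q_k g_k].  These moments lose exactly a
    factor [lambda k]: the numbers [lambda k * q_k] lie between a positive
    constant and 1 (ml_mass_ge, ml_mass_le), and [d_k] lies between two positive
    multiples of [q_k f_k] (drift_bounds).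

    The bounds on [q_k] come from the Volterra equation
    [G + lambda (p * G) = p], where [p] is the power kernel of order [alpha]
    divided by Gamma alpha (ml_volterra), once [G] is known to be nonnegative
    (ml_kernel_ge0).  Nonnegativity follows from a first-zero argument: at a
    first zero [t] the memory term must equal the forcing term, but by the
    logarithmic convexity of the power kernel the memory of the times before [s]
    decays between [s] and [t] at least as fast as the forcing term, so that the
    short interval [s, t] alone would have to supply a fixed part of the value
    at [s].

    The factor [lambda k] is paid for by the H^2 norm.  For a test function
    [psi] there is a test function [eta] with [<u, eta> = <A u, psi>] for all
    [u] in H^2, hence [<u, eta>^2 <= C |psi|^2 |u|^2] with the H^2 norm of [u]
    (elliptic_adjoint_bound).  The pairing [Y] of the solution with [eta] is
    measurable on the probability space by Fubini, whereas neither [A u] nor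
    the H^2 norm, defined through chosen weak derivatives, is known to be.  For
    [X] equal to 1 or [Z], the functional [psi |-> E (X Y)] is therefore bounded
    for the L^2 norm by the expectation of the squared H^2 norm, and it equals
    [psi |-> sum_k lambda k E (I_k X) <phi k, psi>].  Its norm is the l^2 norm
    of [lambda k E (I_k X)] as soon as the test functions are dense in the span
    of the [phi k] (functional_bound, moment_bound), and the theorem follows by
    Parseval.

    The density is not immediate from [phi k] being in the closure of the test
    functions for the H^1 norm, because the term of order zero of that norm is
    itself a weak derivative, and so determines a function only through its
    pairings with test functions.  That these pairings suffice is the
    fundamental lemma of the calculus of variations (fundamental_lemma), proved
    with explicit bump functions built from [t ^- m * exp (- 1 / t)]. *)

(** * Affine change of variables on the line *)

Section affine.
Variable R : realType.
Local Notation mu := (@lebesgue_measure R).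

Definition affine (c d : R) (x : measurableTypeR R) : measurableTypeR R :=
  c * x + d.

Lemma measurable_affine c d : measurable_fun setT (affine c d).
Proof. by apply: measurable_funD => //; exact: measurable_funM. Qed.

HB.instance Definition _ c d := isMeasurableFun.Build _ _ _ _ (affine c d)
  (measurable_affine c d).

Lemma lebesgue_measure_affine c d (A : set R) : c != 0 -> measurable A ->
  mu A = (`|c|%:E * mu (affine c d @^-1` A))%E.
Proof.
move=> c0 mA.
pose nu0 : {measure set (measurableTypeR R) -> \bar R} := mscale (NngNum (normr_ge0 c)) (pushforward mu (affine c d)).
pose nu := nu0 (measurable_affine c d).
have := @lebesgue_measure_unique R nu.
apply => // {mA A}.
move=> _ [[a b] /= _ <-].
rewrite /nu /nu0 /mscale/= /pushforward/=.
have [cp|cn|/eqP] := ltgtP 0 c; last by rewrite eq_sym (negbTE c0).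
- rewrite (_ : affine c d @^-1` _ = `]((a - d) / c), ((b - d) / c)]%classic); last first.
    apply/seteqP; split=> x /=; rewrite !in_itv/= /affine;
    by rewrite ltr_pdivrMr// ler_pdivlMr// ltrBlDr lerBrDr (mulrC x).
  rewrite !lebesgue_measure_itv/= !lte_fin ltr_pM2r ?invr_gt0// ltrD2r.
  case: ifPn => ab; last by rewrite mule0.
  by rewrite gtr0_norm// -!EFinB -EFinM; congr (_%:E); field.
- rewrite (_ : affine c d @^-1` _ = `[((b - d) / c), ((a - d) / c)[%classic); last first.
    apply/seteqP; split=> x /=; rewrite !in_itv/= /affine;
    by rewrite ler_ndivrMr// ltr_ndivlMr// ltrBlDr lerBrDr (mulrC x) andbC.
  rewrite !lebesgue_measure_itv/= !lte_fin ltr_nM2r ?invr_lt0// ltrD2r.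
  case: ifPn => ab; last by rewrite mule0.
  by rewrite ltr0_norm// -!EFinB -EFinM; congr (_%:E); field; rewrite lt_eqF.
Qed.

Lemma ge0_integral_affine (c d : R) (f : R -> \bar R) : c != 0 ->
  measurable_fun setT f -> (forall x, 0 <= f x)%E ->
  (\int[mu]_x f x = `|c|%:E * \int[mu]_x f (c * x + d)%R)%E.
Proof.
move=> c0 mf f0.
pose nu0 : {measure set (measurableTypeR R) -> \bar R} := mscale (NngNum (normr_ge0 c)) (pushforward mu (affine c d)).
pose nu := nu0 (measurable_affine c d).
transitivity (\int[nu]_x f x)%E.
  apply: eq_measure_integral => A mA _.
  by rewrite /nu /nu0 /mscale/= /pushforward/=; exact: lebesgue_measure_affine.
rewrite /nu /nu0 ge0_integral_mscale//=.
by rewrite (ge0_integral_pushforward (measurable_affine c d)).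
Qed.
End affine.

(** * Powers, Gamma integrals and the Beta integral *)

Section gamma.
Variable R : realType.
Local Notation mu := (@lebesgue_measure R).

(** The one-sided power extended by zero to the line. *)
Definition ppow (b x : R) : R := if 0 < x then x `^ (b - 1) else 0.

Lemma ppow_ge0 b x : 0 <= ppow b x.
Proof. by rewrite /ppow; case: ifP => // _; exact: powR_ge0. Qed.

Lemma ppowE b x : 0 < x -> ppow b x = x `^ (b - 1).
Proof. by rewrite /ppow => ->. Qed.

Lemma ppow0 b x : x <= 0 -> ppow b x = 0.
Proof. by rewrite /ppow ltNge => ->. Qed.

Lemma measurable_ppow b : measurable_fun setT (ppow b).
Proof. by apply: measurable_fun_ifT => //; exact: measurable_fun_ltr. Qed.

Lemma ppowM b t x : 0 < t -> ppow b (t * x) = t `^ (b - 1) * ppow b x.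
Proof.
move=> t0; rewrite /ppow pmulr_rgt0//; case: ifPn => [x0|_]; last by rewrite mulr0.
by rewrite powRM// ltW.
Qed.

Lemma powR_continuous (b x : R) : 0 < x -> {for x, continuous (fun y => y `^ b)}.
Proof.
move=> x0; apply: differentiable_continuous; apply/derivable1_diffP.
by have [] := is_derive1_powR b x0.
Qed.

Lemma integral_cst_itv (c d k : R) : c <= d ->
  (\int[mu]_(x in `[c, d]) (cst k%:E x) = (k * (d - c))%:E)%E.
Proof.
move=> cd; rewrite integral_cst; last exact: measurable_itv.
rewrite EFinM /=; congr (_ * _)%E.
rewrite lebesgue_measure_itv/= lte_fin; case: ltP => [//|dc].
by have -> : d = c; [apply/le_anti; rewrite cd dc|rewrite subrr].
Qed.

Lemma integral_powR_itv (b c d : R) : 0 < b -> 0 < c -> c < d ->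
  (\int[mu]_(x in `[c, d]) (x `^ (b - 1))%:E = (b^-1 * (d `^ b - c `^ b))%:E)%E.
Proof.
move=> b0 c0 cd.
have dF (x : R) : 0 < x -> is_derive x 1 (fun x => b^-1 * x `^ b) (x `^ (b - 1)).
  move=> x0; have H := is_derive1_powR b x0.
  apply: is_derive_eq; by rewrite /GRing.scale/= mulrA mulVf ?mul1r// gt_eqF.
rewrite (@continuous_FTC2 _ _ (fun x => b^-1 * x `^ b))//.
- by rewrite -EFinB mulrBr.
- apply: continuous_in_subspaceT => x; rewrite inE/= in_itv/= => /andP[cx _].
  by apply: powR_continuous; exact: lt_le_trans cx.
- have ct x : 0 < x -> {for x, continuous (fun x => b^-1 * x `^ b)}.
    move=> x0; apply: differentiable_continuous; apply/derivable1_diffP.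
    by have [] := dF _ x0.
  split.
  + move=> x; rewrite in_itv/= => /andP[cx _].
    by have [] := dF _ (lt_trans c0 cx).
  + by apply: cvg_at_right_filter; exact: ct.
  + by apply: cvg_at_left_filter; apply: ct; exact: lt_trans cd.
- move=> x; rewrite in_itv/= => /andP[cx _].
  by rewrite derive1E; have [_ ->] := dF _ (lt_trans c0 cx).
Qed.

(** The power is unbounded at 0 when [b < 1]: the integral is the limit of the
    integrals over the intervals from [1 / n] to 1. *)
Lemma integral_ppow01 b : 0 < b ->
  (\int[mu]_(x in `]0%R, 1%R]) (ppow b x)%:E <= b^-1%:E)%E.
Proof.
move=> b0.
pose F (n : nat) : set R := `](n.+1%:R^-1), 1]%classic.
have FE : `]0%R, 1%R]%classic = \bigcup_n F n.
  apply/seteqP; split => [x/=|x [n _]]/=; rewrite !in_itv/=.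
    move=> /andP[x0 x1]; exists (Num.truncn (x^-1)) => //; rewrite /F/= in_itv/= x1 andbT.
    rewrite invf_plt ?posrE//; exact: truncnS_gt.
  by rewrite /F/= in_itv/= => /andP[nx ->]; rewrite andbT (lt_trans _ nx)// invr_gt0.
have mF n : measurable (F n) by exact: measurable_itv.
have mp (n : nat) : measurable_fun (F n) (fun x => (ppow b x)%:E).
  apply/measurable_EFinP; apply: measurable_funTS; exact: measurable_ppow.
have ndF : {homo F : n m / (n <= m)%N >-> (n <= m)%O}.
  move=> n m nm; apply/subsetPset => x; rewrite /F/= !in_itv/= => /andP[nx ->].
  by rewrite andbT (le_lt_trans _ nx)// lef_pV2 ?posrE// ler_nat.
rewrite FE.
have cv : (\int[mu]_(x in F n) (ppow b x)%:E)%E @[n --> \oo] -->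
    (\int[mu]_(x in \bigcup_n F n) (ppow b x)%:E)%E.
  apply: ge0_nondecreasing_set_cvg_integral => // i x _.
  by rewrite lee_fin ppow_ge0.
rewrite -(cvg_lim _ cv)//.
apply: lime_le.
  apply: ereal_nondecreasing_is_cvgn.
  apply: ge0_nondecreasing_set_nondecreasing_integral => // i x _.
  by rewrite lee_fin ppow_ge0.
near=> n.
have n1 : (n.+1%:R : R)^-1 < 1.
  by rewrite invf_lt1// ltr1n ltnS; near: n; exists 1%N.
have n0 : 0 < (n.+1%:R : R)^-1 by rewrite invr_gt0.
apply: (@le_trans _ _ (\int[mu]_(x in `[(n.+1%:R^-1)%R, 1%R]) (x `^ (b - 1))%:E)%E); last first.
  rewrite integral_powR_itv// lee_fin powR1 ler_piMr// ?invr_ge0 ?ltW//.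
rewrite (@eq_integral _ _ _ mu _ (fun x => (x `^ (b - 1))%:E)).
  apply: ge0_subset_integral => //.
  - exact: mF.
  - apply/measurable_EFinP; apply: measurable_funTS; exact: measurable_powR.
  - by move=> x _; rewrite lee_fin powR_ge0.
  - exact: subset_itv_oc_cc.
move=> x; rewrite inE /F/= in_itv/= => /andP[nx _].
by rewrite ppowE// (lt_trans n0).
Unshelve. all: by end_near. Qed.

Definition gammaf (b x : R) : R := ppow b x * expR (- x).

Lemma gammaf_ge0 b x : 0 <= gammaf b x.
Proof. by rewrite mulr_ge0 ?ppow_ge0 ?expR_ge0. Qed.

Lemma measurable_gammaf b : measurable_fun setT (gammaf b).
Proof.
apply: measurable_funM; first exact: measurable_ppow.
by apply: measurableT_comp => //; exact: measurableT_comp.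
Qed.

Lemma powR_le_expR (b : R) : exists2 C : R, 0 < C &
  forall x, 1 <= x -> x `^ (b - 1) <= C * expR (x / 2).
Proof.
pose n := Num.truncn b.
exists (2 ^+ n.+1 * n.+1`!%:R); first by rewrite mulr_gt0 ?exprn_gt0 ?ltr0n ?fact_gt0.
move=> x x1; have x0 : 0 <= x by exact: le_trans x1.
apply: (@le_trans _ _ (x ^+ n.+1)).
  rewrite -powR_mulrn//; apply: ler_powR => //.
  rewrite lerBlDr; apply: ltW; apply: (lt_le_trans (truncnS_gt b)).
  by rewrite lerDl.
have x20 : 0 <= x / 2 by rewrite divr_ge0.
have := expR_ge1Dxn n x20; rewrite exprMn exprVn => H.
rewrite -ler_pdivrMl ?mulr_gt0 ?exprn_gt0 ?ltr0n ?fact_gt0//.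
apply: le_trans H; rewrite invfM -[leLHS]add0r lerD//.
by rewrite mulrC mulrA.
Qed.

(** Near 0 the exponential is at most 1, and at infinity half of it absorbs the
    power. *)
Lemma gammaf_fin b : 0 < b -> (\int[mu]_x (gammaf b x)%:E < +oo)%E.
Proof.
move=> b0; have [C C0 HC] := powR_le_expR b.
pose g x := (((fun x => (ppow b x)%:E) \_ `]0%R, 1%R]) x + ((C * 2) * exponential_pdf (2^-1) x)%:E)%E.
have mg1 : measurable_fun setT ((fun x => (ppow b x)%:E) \_ `]0%R, 1%R]).
  apply/(measurable_restrictT _ _).1 => //.
  by apply/measurable_EFinP; apply: measurable_funTS; exact: measurable_ppow.
have mg2 : measurable_fun setT (fun x : R => (C * 2 * exponential_pdf 2^-1 x)%:E).
  by apply/measurable_EFinP; apply: measurable_funM => //; exact: measurable_exponential_pdf.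
have p0 x : 0 <= exponential_pdf (2^-1) x :> R by exact: exponential_pdf_ge0.
have g0 x : (0 <= ((fun x => (ppow b x)%:E) \_ `]0%R, 1%R]) x)%E.
  by rewrite patchE; case: ifP => // _; rewrite lee_fin ppow_ge0.
apply: (@le_lt_trans _ _ (\int[mu]_x g x)%E).
  apply: ge0_le_integral => //.
  - by move=> x _; rewrite lee_fin gammaf_ge0.
  - by apply/measurable_EFinP; exact: measurable_gammaf.
  - exact: emeasurable_funD.
  - move=> x _; rewrite /g /gammaf.
    have [x0|x0] := ltP 0 x; last first.
      rewrite ppow0// !mul0r adde_ge0//.
      by rewrite lee_fin mulr_ge0// mulr_ge0// ltW.
    have [x1|x1] := leP x 1.
      rewrite patchE mem_set /=; last by rewrite in_itv/= x0.
      rewrite -EFinD lee_fin -[leLHS]addr0 lerD//; last by rewrite mulr_ge0// mulr_ge0// ltW.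
      by rewrite ler_piMr// ?ppow_ge0// -expR0 ler_expR oppr_le0 ltW.
    rewrite patchE memNset/= ?add0e; last by rewrite in_itv/= leNgt x1 andbF.
    rewrite lee_fin ppowE// exponential_pdfE; last exact: ltW.
    have -> : C * 2 * (2^-1 * expR (- 2^-1 * x)) = C * expR (x / 2) * expR (- x).
      rewrite -mulrA mulVKf// -[in RHS]mulrA -expRD; congr (C * expR _).
      by field.
    by rewrite ler_pM2r ?expR_gt0// HC// ltW.
rewrite ge0_integralD//; last first.
  by move=> x _; rewrite lee_fin mulr_ge0// mulr_ge0// ltW.
rewrite lte_add_pinfty//.
  by rewrite -integral_mkcond (le_lt_trans (integral_ppow01 b0))// ltry.
under eq_integral do rewrite EFinM.
rewrite ge0_integralZl//=.
- by rewrite integral_exponential_pdf// mule1 ltry.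
- by apply/measurable_EFinP; exact: measurable_exponential_pdf.
- by move=> x _; rewrite lee_fin.
- by rewrite lee_fin mulr_ge0// ltW.
Qed.

Lemma Gamma_gammaf (b : R) : 0 < b -> (\int[mu]_x (gammaf b x)%:E = (Gamma b)%:E)%E.
Proof.
move=> b0; rewrite /Gamma /Rintegral.
rewrite integral_mkcond (_ : _ \_ _ = EFin \o gammaf b).
  rewrite fineK// ge0_fin_numE ?gammaf_fin//.
  by apply: integral_ge0 => x _; rewrite lee_fin gammaf_ge0.
apply/funext => x; rewrite patchE /= /gammaf /ppow.
case: ifPn; first by rewrite inE/= in_itv/= andbT => ->.
by rewrite notin_setE/= in_itv/= andbT => /negP/negbTE ->; rewrite mul0r.
Qed.

(** On the interval from [M] to [M + 1] the integrand of Gamma is bounded below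
    by the right-hand side; as [M] is arbitrary, Gamma outgrows every geometric
    sequence. *)
Lemma Gamma_ge (b M : R) : 0 < b -> 1 <= M ->
  M `^ (b - 1) / 2 * expR (- M - 1) <= Gamma b.
Proof.
move=> b0 M1; have M0 : 0 < M by exact: lt_le_trans M1.
rewrite -lee_fin -Gamma_gammaf//.
apply: (@le_trans _ _ (\int[mu]_(x in `[M, (M + 1)%R]) (gammaf b x)%:E)%E); last first.
  apply: ge0_subset_integral => //.
  - by apply/measurable_EFinP; exact: measurable_gammaf.
  - by move=> x _; rewrite lee_fin gammaf_ge0.
apply: (@le_trans _ _ (\int[mu]_(x in `[M, (M + 1)%R])
    (cst (M `^ (b - 1) / 2 * expR (- M - 1))%:E x))%E).
  by rewrite integral_cst_itv ?lerDl// [(M + 1)%R]addrC addrK mulr1.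
apply: ge0_le_integral => //.
- by move=> x _; rewrite lee_fin mulr_ge0 ?mulr_ge0 ?powR_ge0 ?expR_ge0.
- apply/measurable_EFinP; apply: measurable_funTS; exact: measurable_gammaf.
- move=> x /=; rewrite in_itv/= => /andP[Mx xM]; rewrite lee_fin /gammaf.
  have x0 : 0 < x by exact: lt_le_trans Mx.
  rewrite ppowE// ler_pM ?mulr_ge0 ?powR_ge0 ?expR_ge0//; last first.
    by rewrite ler_expR lerNr opprB opprK addrC.
  rewrite !powRB ?(gt_eqF x0) ?(gt_eqF M0) ?implybT// !powRr1 ?(ltW M0) ?(ltW x0)//.
  rewrite -mulrA -invfM; apply: ler_pM; rewrite ?powR_ge0 ?invr_ge0 ?mulr_ge0//.
  - exact: ltW.
  - by rewrite ge0_ler_powR// ?nnegrE ltW.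
  - by rewrite lef_pV2 ?posrE ?mulr_gt0//; lra.
Qed.

Lemma Gamma_gt0 (b : R) : 0 < b -> 0 < Gamma b.
Proof.
move=> b0; apply: lt_le_trans (Gamma_ge b0 (lexx 1)).
by rewrite powR1 mulr_gt0 ?expR_gt0 ?divr_gt0.
Qed.

Definition ppow_conv (b g t : R) : \bar R :=
  (\int[mu]_x (ppow b (t - x) * ppow g x)%:E)%E.

Lemma measurable_ppow_conv b g t :
  measurable_fun setT (fun x : R => ppow b (t - x) * ppow g x).
Proof.
apply: measurable_funM; last exact: measurable_ppow.
apply: measurableT_comp; first exact: measurable_ppow.
exact: measurable_funB.
Qed.

Lemma ppow_conv_ge0 b g t : (0 <= ppow_conv b g t)%E.
Proof. by apply: integral_ge0 => x _; rewrite lee_fin mulr_ge0// ppow_ge0. Qed.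

Lemma ppow_conv0 b g t : t <= 0 -> ppow_conv b g t = 0%E.
Proof.
move=> t0; rewrite /ppow_conv integral0_eq// => x _.
have [x0|x0] := ltP 0 x; last by rewrite [ppow g x]ppow0 ?mulr0.
by rewrite ppow0 ?mul0r// subr_le0 (le_trans t0)// ltW.
Qed.

(** The affine change of variables [x |-> t * x] pulls the time out of the
    convolution of two powers, which leaves one constant to be computed. *)
Lemma ppow_conv_scale b g t : 0 < t ->
  ppow_conv b g t = ((t `^ (b + g - 1))%:E * ppow_conv b g 1)%E.
Proof.
move=> t0; rewrite /ppow_conv.
have tN0 : t != 0 by rewrite gt_eqF.
have mf : measurable_fun setT (fun x : R => (ppow b (t - x) * ppow g x)%:E).
  by apply/measurable_EFinP; exact: measurable_ppow_conv.
have f0 x : (0 <= (ppow b (t - x) * ppow g x)%:E)%E.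
  by rewrite lee_fin mulr_ge0// ppow_ge0.
rewrite (ge0_integral_affine 0 tN0 mf f0).
under eq_integral => x _.
  rewrite addr0 (_ : t - t * x = t * (1 - x)); last by rewrite mulrBr mulr1.
  rewrite !ppowM// mulrACA EFinM; over.
rewrite ge0_integralZl//; first last.
- by rewrite lee_fin mulr_ge0// powR_ge0.
- by move=> x _; rewrite lee_fin mulr_ge0// ppow_ge0.
- by apply/measurable_EFinP; exact: measurable_ppow_conv.
rewrite muleA -EFinM gtr0_norm//; congr (_%:E * _)%E.
rewrite -powRD; last by rewrite tN0 implybT.
rewrite -[X in X * _ = _]powRr1 ?ltW// -powRD; last by rewrite tN0 implybT.
by congr (_ `^ _); ring.
Qed.

Lemma gammaf_conv_mul b g x u :
  gammaf g x * gammaf b (u - x) = expR (- u) * (ppow b (u - x) * ppow g x).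
Proof.
rewrite /gammaf; have -> : expR (- u) = expR (- x) * expR (- (u - x)).
  by rewrite -expRD; congr expR; ring.
by ring.
Qed.

(** The Euler Beta integral: the product of two Gamma integrals is computed as
    the integral over the line of the convolution of their integrands. *)
Lemma ppow_convE b g t : 0 < b -> 0 < g -> 0 < t ->
  ppow_conv b g t = (Gamma b * Gamma g / Gamma (b + g) * ppow (b + g) t)%:E.
Proof.
move=> b0 g0 t0.
suff H1 : ppow_conv b g 1 = (Gamma b * Gamma g / Gamma (b + g))%:E.
  by rewrite ppow_conv_scale// H1 -EFinM ppowE// mulrC.
have bg0 : 0 < b + g by exact: addr_gt0.
have mg2 : measurable_fun setT
    (fun p : R * R => (gammaf g p.1 * gammaf b (p.2 - p.1))%:E).
  apply/measurable_EFinP; apply: measurable_funM.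
    by apply: measurableT_comp => //; exact: measurable_gammaf.
  apply: measurableT_comp; first exact: measurable_gammaf.
  exact: measurable_funB.
have mgb : measurable_fun setT (fun x : R => (gammaf b x)%:E).
  by apply/measurable_EFinP; exact: measurable_gammaf.
have gb0 x : (0 <= (gammaf b x)%:E)%E by rewrite lee_fin gammaf_ge0.
have E1 : (\int[mu]_x \int[mu]_u (gammaf g x * gammaf b (u - x))%:E =
    (Gamma b * Gamma g)%:E)%E.
  under eq_integral => x _.
    under eq_integral do rewrite EFinM.
    rewrite ge0_integralZl//=; last first.
    - by rewrite lee_fin gammaf_ge0.
    - apply/measurable_EFinP; apply: measurableT_comp; first exact: measurable_gammaf.
      exact: measurable_funB.
    rewrite (_ : (\int[mu]_u _)%E = (Gamma b)%:E); last first.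
      rewrite -Gamma_gammaf// (ge0_integral_affine (- x) (oner_neq0 _) mgb gb0).
      by rewrite normr1 mul1e; apply: eq_integral => u _; rewrite mul1r.
    over.
  rewrite ge0_integralZr//; first last.
  - by rewrite lee_fin ltW// Gamma_gt0.
  - by move=> x _; rewrite lee_fin gammaf_ge0.
  - by apply/measurable_EFinP; exact: measurable_gammaf.
  rewrite (Gamma_gammaf g0) -EFinM; congr (_%:E); exact: mulrC.
have E2 : (\int[mu]_u \int[mu]_x (gammaf g x * gammaf b (u - x))%:E =
    ppow_conv b g 1 * (Gamma (b + g))%:E)%E.
  rewrite -Gamma_gammaf// -ge0_integralZl//; first last.
  - exact: ppow_conv_ge0.
  - by move=> x _; rewrite lee_fin gammaf_ge0.
  - by apply/measurable_EFinP; exact: measurable_gammaf.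
  apply: eq_integral => u _.
  under eq_integral do rewrite gammaf_conv_mul EFinM.
  rewrite ge0_integralZl//; first last.
  - by move=> x _; rewrite lee_fin mulr_ge0// ppow_ge0.
  - by apply/measurable_EFinP; exact: measurable_ppow_conv.
  rewrite -/(ppow_conv b g u) /gammaf.
  have [u0|u0] := leP u 0; first by rewrite ppow_conv0// ppow0// mul0r !mule0.
  by rewrite ppow_conv_scale// ppowE// EFinM muleA muleC; congr (_ * _)%E; rewrite muleC.
have : (ppow_conv b g 1 * (Gamma (b + g))%:E = (Gamma b * Gamma g)%:E)%E.
  by rewrite -E1 -E2 -(@fubini_tonelli _ _ _ _ _ mu mu _ mg2)// => p; rewrite lee_fin mulr_ge0// gammaf_ge0.
have := ppow_conv_ge0 b g 1; case: (ppow_conv b g 1) => [r _|_|//].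
  by rewrite -EFinM => -[<-]; rewrite mulfK// gt_eqF// Gamma_gt0.
by rewrite gt0_mulye// lte_fin Gamma_gt0.
Qed.
End gamma.

(** * Power series of infinite radius *)

Section entire_pseries.
Variable R : realType.
Implicit Types (c : nat -> R) (z : R).

(** Infinite radius of convergence, stated as a geometric bound of the terms at
    every radius: this form passes to the derived series and gives bounds that
    are uniform over partial sums. *)
Definition entire c := forall K, 1 <= K -> exists A, forall k, `|c k| * K ^+ k <= A.

Lemma entire_diffs c : entire c -> entire (pseries_diffs c).
Proof.
move=> ec K K1; have K0 : 0 < K by exact: lt_le_trans K1.
have [|A HA] := ec (2 * K); first by lra.
exists A => k; rewrite /pseries_diffs normrM normr_nat.
apply: le_trans (HA k.+1); rewrite mulrAC mulrC ler_wpM2l//.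
rewrite exprMn; apply: ler_pM => //; first by rewrite exprn_ge0// ltW.
  by rewrite -natrX ler_nat ltnW// ltn_expl.
by rewrite exprS ler_peMl// exprn_ge0// ltW.
Qed.

Lemma entire_normed_cvg c z : entire c -> cvgn [normed pseries c z].
Proof.
move=> ec; pose K : R := 2 * (`|z| + 1).
have K1 : 1 <= K by rewrite /K; have := normr_ge0 z; lra.
have K0 : 0 < K by exact: lt_le_trans K1.
have [A HA] := ec _ K1.
have A0 : 0 <= A by apply: le_trans (HA 0%N); rewrite mulr_ge0// exprn_ge0// ltW.
apply: (@series_le_cvg _ _ (geometric A 2^-1)).
- by move=> n; rewrite normr_ge0.
- by move=> n; rewrite /= mulr_ge0// exprn_ge0// invr_ge0.
- move=> n /=; rewrite normrM normrX.
  have zK : `|z| <= K / 2 by rewrite /K; lra.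
  apply: (@le_trans _ _ (`|c n| * (K / 2) ^+ n)).
    by rewrite ler_wpM2l// lerXn2r// nnegrE ?divr_ge0// ltW.
  by rewrite exprMn mulrA ler_wpM2r// exprn_ge0// invr_ge0.
- by apply: is_cvg_geometric_series; rewrite ger0_norm ?invr_ge0//; lra.
Qed.

Lemma entire_cvg c z : entire c -> cvgn (pseries c z).
Proof. by move=> ec; apply: normed_cvg; exact: entire_normed_cvg. Qed.

Lemma entire_continuous c : entire c -> continuous (fun z => limn (pseries c z)).
Proof.
move=> ec z; apply: differentiable_continuous; apply/derivable1_diffP.
have := @pseries_snd_diffs R c (`|z| + 1) z.
move=> /(_ (@entire_cvg c _ ec) (@entire_cvg _ _ (entire_diffs ec))
  (@entire_cvg _ _ (entire_diffs (entire_diffs ec)))).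
have -> : `|z| < `| `|z| + 1 | by have := normr_ge0 z => z0; rewrite [ltRHS]ger0_norm; lra.
by move=> /(_ isT)[].
Qed.

Lemma entire_bounded c (Z : R) : entire c -> 0 <= Z ->
  exists2 B, 0 <= B & forall z N, `|z| <= Z -> `|pseries c z N| <= B.
Proof.
move=> ec Z0; exists (limn [normed pseries c Z]).
  apply: limr_ge; first exact: entire_normed_cvg.
  by apply: nearW => n; rewrite /series/= sumr_ge0.
move=> z N zZ.
apply: (@le_trans _ _ ([normed pseries c Z] N)); last first.
  apply: nondecreasing_cvgn_le; last exact: entire_normed_cvg.
  by apply/nondecreasing_seqP => n; rewrite -subr_ge0 seriesSB normr_ge0.
rewrite /pseries /series/=; apply: le_trans (ler_norm_sum _ _ _) _.
apply: ler_sum => i _; rewrite !normrM ler_wpM2l// !normrX lerXn2r ?nnegrE//.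
by rewrite (ger0_norm Z0).
Qed.

End entire_pseries.

(** * The Mittag-Leffler kernel and its fractional integrals *)

Section mittag_leffler_kernel.
Variables (R : realType) (alpha : R).
Hypothesis a01 : 0 < alpha < 1.
Local Notation mu := (@lebesgue_measure R).

Let a0 : 0 < alpha. Proof. by case/andP: a01. Qed.

(** Coefficients of the Mittag-Leffler function E_(alpha, g + alpha). *)
Definition ml_coef (g : R) (k : nat) : R := (Gamma (g + (k%:R * alpha + alpha)))^-1.

Lemma ml_arg_gt0 g k : 0 <= g -> 0 < g + (k%:R * alpha + alpha).
Proof. by move=> g0; rewrite ltr_wpDl// ltr_wpDl// mulr_ge0// ltW. Qed.

Lemma ml_coef_gt0 g k : 0 <= g -> 0 < ml_coef g k.
Proof. by move=> g0; rewrite invr_gt0 Gamma_gt0// ml_arg_gt0. Qed.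

(** Gamma_ge at a suitable fixed [M] bounds Gamma from below by a geometric
    sequence of arbitrary ratio. *)
Lemma ml_coef_entire g : 0 <= g -> entire (ml_coef g).
Proof.
move=> g0 K K1; have K0 : 0 < K by exact: lt_le_trans K1.
(* with this M, the k-th power of K is M to the power k alpha *)
pose M := K `^ alpha^-1.
have M1 : 1 <= M by rewrite /M -[leLHS](powRr0 K) ler_powR// invr_ge0 ltW.
have M0 : 0 < M by exact: lt_le_trans M1.
have KM k : K ^+ k = M `^ (k%:R * alpha).
  rewrite /M -powRrM mulrC -powR_mulrn ?ltW//; congr (_ `^ _).
  by rewrite mulrK// unitfE gt_eqF.
exists (2 * expR (M + 1) * M `^ (1 - (g + alpha))) => k.
rewrite gtr0_norm ?ml_coef_gt0// mulrC ler_pdivrMr ?Gamma_gt0 ?ml_arg_gt0//.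
have := Gamma_ge (ml_arg_gt0 k g0) M1.
move=> /(ler_wpM2l (_ : 0 <= 2 * expR (M + 1) * M `^ (1 - (g + alpha)))).
move=> /(_ _) H; apply: le_trans (H _); last by rewrite !mulr_ge0 ?expR_ge0 ?powR_ge0.
rewrite KM.
have -> : M `^ (k%:R * alpha) = M `^ (1 - (g + alpha)) *
    M `^ (g + (k%:R * alpha + alpha) - 1).
  rewrite -powRD; last by rewrite (gt_eqF M0) implybT.
  by congr (_ `^ _); ring.
have -> : - M - 1 = - (M + 1) by ring.
rewrite expRN le_eqVlt; apply/orP; left; apply/eqP; field.
by rewrite gt_eqF// expR_gt0.
Qed.

(** [ml_kernel 0] is the relaxation kernel as a function of the elapsed time, and
    [ml_kernel g] its fractional integral of order [g]. *)
Definition ml_kernel (g l t : R) : R :=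
  ppow (g + alpha) t * limn (pseries (ml_coef g) (- l * t `^ alpha)).

Lemma ml_kernel0 g l t : t <= 0 -> ml_kernel g l t = 0.
Proof. by move=> t0; rewrite /ml_kernel ppow0// mul0r. Qed.

Lemma relaxation_kernelE l t tau : tau < t ->
  relaxation_kernel alpha l t tau = ml_kernel 0 l (t - tau).
Proof.
move=> tt; rewrite /relaxation_kernel /ml_kernel add0r ppowE ?subr_gt0//.
congr (_ * _); rewrite /mittag_leffler /pseries; congr (limn (series _)).
by apply/funext => k /=; rewrite /ml_coef add0r mulrC.
Qed.

Lemma continuous_ml_kernel g l t : 0 <= g -> 0 < t ->
  {for t, continuous (ml_kernel g l)}.
Proof.
move=> g0 t0.
have H : {for t, continuous (fun t => t `^ (g + alpha - 1) *
   limn (pseries (ml_coef g) (- l * t `^ alpha)))}.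
  apply: continuousM; first exact: powR_continuous.
  apply: (@continuous_comp _ _ _ (fun t => - l * t `^ alpha)
    (fun z => limn (pseries (ml_coef g) z))).
    by apply: continuousM; [exact: cst_continuous|exact: powR_continuous].
  exact: entire_continuous (ml_coef_entire g0) _.
rewrite /prop_for /continuous_at in H *.
rewrite {2}/ml_kernel ppowE//.
apply: cvg_trans H; apply: near_eq_cvg.
near=> s; rewrite /ml_kernel ppowE//.
near: s; exact: lt_nbhsr.
Unshelve. all: by end_near. Qed.

Lemma measurable_ml_kernel g l : 0 <= g -> measurable_fun setT (ml_kernel g l).
Proof.
move=> g0; apply: measurable_funM; first exact: measurable_ppow.
apply: (@measurableT_comp _ _ _ _ _ _ (fun z => limn (pseries (ml_coef g) z))).
  by apply: continuous_measurable_fun; exact: entire_continuous (ml_coef_entire g0).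
apply: measurable_funM => //; exact: measurable_powR.
Qed.

(** Written with the factor [ppow (g + alpha) t] of ml_kernel distributed over
    the terms, which are then powers to which the Beta integral applies. *)
Definition ml_sum g l (N : nat) (t : R) : R :=
  \sum_(0 <= k < N) (- l) ^+ k * ml_coef g k * ppow (g + (k%:R * alpha + alpha)) t.

Lemma ml_sumE g l N t : ml_sum g l N t =
  ppow (g + alpha) t * pseries (ml_coef g) (- l * t `^ alpha) N.
Proof.
rewrite /ml_sum /pseries /series/= big_distrr/=; apply: eq_bigr => k _.
have [t0|t0] := leP t 0; first by rewrite !ppow0// mulr0 mul0r.
rewrite !ppowE// exprMn -[(t `^ alpha) ^+ k]powR_mulrn ?powR_ge0// -powRrM.
rewrite (_ : g + _ - 1 = (g + alpha - 1) + alpha * k%:R); last by ring.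
by rewrite powRD ?(gt_eqF t0) ?implybT//; ring.
Qed.

Lemma ml_sum_cvg g l t : 0 <= g -> (ml_sum g l) ^~ t @ \oo --> ml_kernel g l t.
Proof.
move=> g0; under eq_cvg do rewrite ml_sumE.
by apply: cvgMr; exact: entire_cvg (ml_coef_entire g0).
Qed.

Lemma ml_sum_bounded g l (t : R) : 0 <= g -> exists2 B, 0 <= B &
  forall x N, x <= t -> `|ml_sum g l N x| <= B * ppow (g + alpha) x.
Proof.
move=> g0.
have [|B B0 HB] := @entire_bounded _ _ (`|l| * t `^ alpha) (ml_coef_entire g0).
  by rewrite mulr_ge0// powR_ge0.
exists B => // x N xt; rewrite ml_sumE normrM (ger0_norm (ppow_ge0 _ _)) mulrC.
have [x0|x0] := leP x 0; first by rewrite !ppow0// !mulr0.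
rewrite ler_wpM2r ?ppow_ge0// HB// normrM normrN ler_wpM2l//.
rewrite ger0_norm ?powR_ge0// ge0_ler_powR// ?nnegrE ltW//.
exact: lt_le_trans xt.
Qed.

(** The recursion obtained by splitting off the first term of the series. *)
Lemma ml_kernel_rec g l t : 0 <= g ->
  ml_kernel g l t + l * ml_kernel (g + alpha) l t = ppow (g + alpha) t / Gamma (g + alpha).
Proof.
move=> g0; have ga0 : 0 <= g + alpha by rewrite addr_ge0// ltW.
have E N : ml_sum g l N.+1 t + l * ml_sum (g + alpha) l N t =
    ppow (g + alpha) t / Gamma (g + alpha).
  rewrite /ml_sum big_nat_recl// expr0 mul1r {1}/ml_coef mul0r add0r.
  rewrite -[RHS]addr0 -addrA mulrC; congr (_ + _).
  rewrite big_distrr/= -big_split/= big1// => k _.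
  rewrite /ml_coef (_ : g + (k.+1%:R * alpha + alpha) =
    g + alpha + (k%:R * alpha + alpha)); last by rewrite -natr1; ring.
  by rewrite exprS; ring.
have c1 : (fun N => ml_sum g l N.+1 t + l * ml_sum (g + alpha) l N t) @ \oo -->
    ml_kernel g l t + l * ml_kernel (g + alpha) l t.
  apply: cvgD; last by apply: cvgMr; exact: ml_sum_cvg.
  have := @ml_sum_cvg g l t g0; by rewrite -cvg_shiftS.
move: c1; under eq_cvg do rewrite E.
by move=> /cvg_lim <-//; rewrite lim_cst.
Qed.

End mittag_leffler_kernel.

Section mittag_leffler_volterra.
Variables (R : realType) (alpha : R).
Hypothesis a01 : 0 < alpha < 1.
Local Notation mu := (@lebesgue_measure R).
Local Notation ml_kernel := (ml_kernel alpha).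
Local Notation ml_sum := (ml_sum alpha).
Local Notation ml_coef := (ml_coef alpha).

Let a0 : 0 < alpha. Proof. by case/andP: a01. Qed.

Lemma integrable_ppow_conv b g t : 0 < b -> 0 < g ->
  mu.-integrable setT (fun x : R => (ppow b (t - x) * ppow g x)%:E).
Proof.
move=> b0 g0; apply/integrableP; split.
  by apply/measurable_EFinP; exact: measurable_ppow_conv.
under eq_integral do rewrite gee0_abs ?lee_fin ?mulr_ge0 ?ppow_ge0//.
rewrite -/(ppow_conv b g t).
have [t0|t0] := leP t 0; first by rewrite ppow_conv0.
by rewrite ppow_convE// ltry.
Qed.

(** Fractional integration of the kernel, term by term: each term is a Beta
    integral, and the partial sums are dominated by a single power. *)
Lemma ml_kernel_conv b g l t : 0 < b -> 0 <= g ->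
  mu.-integrable setT (fun x : R => (ppow b (t - x) * ml_kernel g l x)%:E) /\
  (\int[mu]_x (ppow b (t - x) * ml_kernel g l x)%:E =
   (Gamma b * ml_kernel (b + g) l t)%:E)%E.
Proof.
move=> b0 g0.
have ga0 : 0 < g + alpha by exact: ltr_wpDl.
have bg0 : 0 <= b + g by rewrite addr_ge0// ltW.
have [B B0 HB] := ml_sum_bounded a01 l t g0.
pose f N (x : R) : \bar R := (ppow b (t - x) * ml_sum g l N x)%:E.
have mterm (k : nat) : measurable_fun setT (ppow (R:=R) (g + (k%:R * alpha + alpha))).
  exact: measurable_ppow.
have mf N : measurable_fun setT (f N).
  apply/measurable_EFinP; apply: measurable_funM.
    apply: measurableT_comp; first exact: measurable_ppow.
    exact: measurable_funB.
  by apply: measurable_sum => k; exact: measurable_funM.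
have mF : measurable_fun setT (fun x : R => (ppow b (t - x) * ml_kernel g l x)%:E).
  apply/measurable_EFinP; apply: measurable_funM; last exact: measurable_ml_kernel.
  apply: measurableT_comp; first exact: measurable_ppow.
  exact: measurable_funB.
have cf : {ae mu, forall x : R, setT x -> f ^~ x @ \oo --> (ppow b (t - x) * ml_kernel g l x)%:E}.
  apply: aeW => x _; apply: cvg_EFin; first by near=> n.
  by apply: cvgMr; exact: ml_sum_cvg.
have bound : {ae mu, forall x : R, forall N, setT x ->
    (`|f N x| <= (B * (ppow b (t - x) * ppow (g + alpha) x))%:E)%E}.
  apply: aeW => x N _; rewrite lee_fin normrM (ger0_norm (ppow_ge0 _ _)).
  have [xt|xt] := ltP x t; last by rewrite ppow0 ?subr_le0// !mul0r mulr0.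
  by rewrite mulrCA ler_wpM2l ?ppow_ge0// HB// ltW.
have iB : mu.-integrable setT (fun x : R => (B * (ppow b (t - x) * ppow (g + alpha) x))%:E).
  under eq_fun do rewrite EFinM.
  by apply: integrableZl => //; exact: integrable_ppow_conv.
have [iF _ cI] := @dominated_convergence _ (measurableTypeR R) R mu setT
  measurableT _ _ _ mf mF cf iB bound.
split => //.
have alg (p G1 G2 G3 q : R) : G2 != 0 ->
    p * G2^-1 * (G1 * G2 / G3 * q) = G1 * (p / G3 * q).
  by move=> ?; rewrite [G1 * G2]mulrC -!mulrA mulKf// mulrCA.
have IE N : (\int[mu]_x f N x = (Gamma b * ml_sum (b + g) l N t)%:E)%E.
  transitivity (\int[mu]_x \sum_(0 <= k < N) (((- l) ^+ k * ml_coef g k)%:E *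
     (ppow b (t - x) * ppow (g + (k%:R * alpha + alpha)) x)%:E))%E.
    apply: eq_integral => x _; rewrite /f /ml_sum mulr_sumr -sumEFin.
    by apply: eq_bigr => k _; rewrite -EFinM; congr (_%:E); ring.
  rewrite integral_sum//; last first.
    move=> k; apply: integrableZl => //; apply: integrable_ppow_conv => //.
    exact: ml_arg_gt0.
  rewrite /ml_sum mulr_sumr -sumEFin; apply: eq_bigr => k _.
  rewrite integralZl//; last by apply: integrable_ppow_conv => //; exact: ml_arg_gt0.
  rewrite -/(ppow_conv _ _ _).
  have [t0|t0] := leP t 0; first by rewrite ppow_conv0// ppow0// !mulr0 mule0.
  rewrite ppow_convE//; last exact: ml_arg_gt0.
  rewrite -EFinM /ml_coef !addrA; congr (_%:E).
  rewrite (_ : b + g + _ + _ = b + (g + (k%:R * alpha + alpha))); last by ring.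
  rewrite -!addrA alg//; apply: lt0r_neq0; exact: Gamma_gt0 (ml_arg_gt0 a01 k g0).
have cI2 : (\int[mu]_x f N x)%E @[N --> \oo] --> (Gamma b * ml_kernel (b + g) l t)%:E.
  under eq_cvg do rewrite IE.
  apply: cvg_EFin; first by near=> n.
  by apply: cvgMr; exact: ml_sum_cvg.
by apply: cvg_unique cI cI2.
Unshelve. all: by end_near. Qed.

End mittag_leffler_volterra.

(** * Nonnegativity of the Mittag-Leffler kernel *)

Lemma ae_neq (R : realType) (c : R) :
  {ae @lebesgue_measure R, forall x, x != c}.
Proof.
exists [set c]; split; [exact: measurable_set1|exact: lebesgue_measure_set1|].
by move=> x /= /negP; rewrite negbK => /eqP.
Qed.

(** The Volterra equations of ml_kernel_jump, with [g] the nonpositive value of the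
    kernel and [x] the rescaled memory of the earlier time; stated abstractly to keep
    integrals out of linear arithmetic. *)
Lemma balance_le (R : realFieldType) (w x g y k : R) :
  w + x = g + y -> g <= 0 -> y <= x + k -> w <= k.
Proof. by move=> *; lra. Qed.

Section mittag_leffler_positivity.
Variables (R : realType) (alpha : R).
Hypothesis a01 : 0 < alpha < 1.
Local Notation mu := (@lebesgue_measure R).
Local Notation ml_kernel := (ml_kernel alpha).

Let a0 : 0 < alpha. Proof. by case/andP: a01. Qed.
Let a1 : alpha < 1. Proof. by case/andP: a01. Qed.

Definition ml_conv (b l t : R) : R := \int[mu]_x (ppow b (t - x) * ml_kernel 0 l x).

Lemma ml_convE b l t : 0 < b -> ml_conv b l t = Gamma b * ml_kernel b l t.
Proof.
move=> b0; rewrite /ml_conv /Rintegral.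
by have [_ ->] := ml_kernel_conv a01 l t b0 (lexx 0); rewrite addr0.
Qed.

Lemma EFin_ml_conv b l t : 0 < b ->
  (\int[mu]_x (ppow b (t - x) * ml_kernel 0 l x)%:E = (ml_conv b l t)%:E)%E.
Proof.
move=> b0; rewrite ml_convE//.
by have [_ ->] := ml_kernel_conv a01 l t b0 (lexx 0); rewrite addr0.
Qed.

(** ml_kernel_rec, with the kernel of order [alpha] recognized as a convolution
    of the kernel itself. *)
Lemma ml_volterra l t :
  ml_kernel 0 l t + l * (Gamma alpha)^-1 * ml_conv alpha l t =
  ppow alpha t / Gamma alpha.
Proof.
rewrite ml_convE//.
have := ml_kernel_rec a01 l t (lexx 0); rewrite !add0r => <-; congr (_ + _).
by rewrite -mulrA mulKf// gt_eqF// Gamma_gt0.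
Qed.

Lemma ppow_anti (b x y : R) : b <= 1 -> 0 < x -> x <= y -> ppow b y <= ppow b x.
Proof.
move=> b1 x0 xy; have y0 := lt_le_trans x0 xy.
rewrite !ppowE// -[b - 1]opprK !(powRN _ (- (b - 1))) lef_pV2 ?posrE ?powR_gt0//.
by rewrite ge0_ler_powR ?nnegrE ?(ltW x0) ?(ltW y0)// oppr_ge0 subr_le0.
Qed.

(** Logarithmic convexity of the power kernel: the ratio of the value at the
    later time to that at the earlier one increases as both move forward. *)
Lemma ppow_delay b (s t x : R) : b <= 1 -> 0 < x -> x < s -> s <= t ->
  ppow b (t - x) <= ppow b t / ppow b s * ppow b (s - x).
Proof.
move=> b1 x0 xs st; have s0 := lt_trans x0 xs; have t0 := lt_le_trans s0 st.
have sx : 0 < s - x by rewrite subr_gt0.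
have tx : 0 < t - x by rewrite subr_gt0 (lt_le_trans xs).
have -> : ppow b t / ppow b s * ppow b (s - x) = ppow b (t / s * (s - x)).
  rewrite ppowM ?divr_gt0//; congr (_ * _); rewrite !ppowE// powRM ?invr_ge0 ?ltW//.
  congr (_ * _).
  by rewrite -(powR_inv1 (ltW s0)) -powRrM mulN1r powRN.
apply: ppow_anti => //; first by rewrite mulr_gt0// divr_gt0.
rewrite mulrBr divfK ?gt_eqF// lerB// ler_peMl ?(ltW x0)//.
by rewrite ler_pdivlMr// mul1r.
Qed.

(** Near 0 the series is close to its first coefficient. *)
Lemma ml_kernel_gt0_near0 l : 0 < l -> exists2 t : R, 0 < t &
  forall s, 0 < s -> s <= t -> 0 < ml_kernel 0 l s.
Proof.
move=> l0; pose p z := limn (pseries (ml_coef alpha 0) z).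
have p0 : 0 < p 0.
  have -> : p 0 = ml_coef alpha 0 0; last exact: ml_coef_gt0.
  apply: cvg_lim => //; rewrite -cvg_shiftS.
  apply: cvg_near_cst; near=> N.
  rewrite /pseries /series/= big_nat_recl// expr0 mulr1 big1 ?addr0// => i _.
  by rewrite expr0n mulr0.
have pc : {for 0, continuous p} by exact: entire_continuous (ml_coef_entire a01 (lexx 0)) _.
have := pc [set y | 0 < y] (lt_nbhsr p0).
move=> /nbhs_ballP[e /= e0 He].
pose u := (e / (2 * l)) `^ alpha^-1.
have u0 : 0 < u by rewrite powR_gt0// divr_gt0// mulr_gt0.
exists u => // s s0 su; rewrite /ml_kernel add0r mulr_gt0 ?ppowE ?powR_gt0//.
apply: He; rewrite /ball/= sub0r normrN normrM normrN (gtr0_norm l0) (ger0_norm (powR_ge0 _ _)).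
apply: (@le_lt_trans _ _ (l * u `^ alpha)).
  by rewrite ler_pM2l// ge0_ler_powR// ?nnegrE ?(ltW a0) ?(ltW s0) ?(ltW u0).
rewrite -powRrM mulVf ?gt_eqF// powRr1 ?divr_ge0 ?mulr_ge0 ?(ltW e0) ?(ltW l0)//.
have -> : l * (e / (2 * l)) = e / 2 by field; rewrite gt_eqF.
by lra.
Unshelve. all: by end_near. Qed.

(** The power kernel restricted to the times in [s, t]: [ppow 1] is the indicator
    of the positive half-line. *)
Definition ml_tail (s t x : R) := ppow alpha (t - x) * ppow 1 (x - s).

Lemma integral_ml_tail (s t : R) : s < t ->
  mu.-integrable setT (fun x => (ml_tail s t x)%:E) /\
  (\int[mu]_x (ml_tail s t x)%:E =
    (Gamma alpha * Gamma 1 / Gamma (alpha + 1) * (t - s) `^ alpha)%:E)%E.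
Proof.
move=> st.
have mt : measurable_fun setT (fun x : R => (ml_tail s t x)%:E).
  apply/measurable_EFinP; apply: measurable_funM.
    apply: measurableT_comp; first exact: measurable_ppow.
    exact: measurable_funB.
  apply: measurableT_comp; first exact: measurable_ppow.
  exact: measurable_funB.
have t0 x : (0 <= (ml_tail s t x)%:E)%E by rewrite lee_fin mulr_ge0// ppow_ge0.
have E : (\int[mu]_x (ml_tail s t x)%:E =
    (Gamma alpha * Gamma 1 / Gamma (alpha + 1) * (t - s) `^ alpha)%:E)%E.
  rewrite (ge0_integral_affine s (oner_neq0 _) mt t0) normr1 mul1e.
  transitivity (ppow_conv alpha 1 (t - s)).
    apply: eq_integral => x _; rewrite /ml_tail mul1r addrK.
    by rewrite opprD [- x - s]addrC addrA.
  by rewrite ppow_convE ?subr_gt0// ppowE ?subr_gt0// addrK.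
split => //; apply/integrableP; split => //.
by under eq_integral do rewrite gee0_abs//; rewrite E ltry.
Qed.

Section jump.
Variables l s t : R.
Hypotheses (s0 : 0 < s) (st : s < t).
Hypothesis G0 : forall x, 0 < x -> x < t -> 0 < ml_kernel 0 l x.
Hypothesis Gs : forall x, s <= x -> x <= t -> ml_kernel 0 l x <= ml_kernel 0 l s.

Let r : R := ppow alpha t / ppow alpha s.

Let r0 : 0 < r.
Proof. by rewrite divr_gt0// ppowE ?powR_gt0// (lt_trans s0). Qed.

Let G0' x : x < t -> 0 <= ml_kernel 0 l x.
Proof.
move=> xt; have [x0|x0] := leP x 0; first by rewrite ml_kernel0.
exact: ltW (G0 x0 xt).
Qed.

Let Gs0 : 0 <= ml_kernel 0 l s. Proof. exact: G0'. Qed.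

Let lhs_ge0 x : 0 <= ppow alpha (t - x) * ml_kernel 0 l x.
Proof.
have [xt|xt] := ltP x t.
  by apply: mulr_ge0; [exact: ppow_ge0|exact: G0'].
by rewrite ppow0 ?subr_le0// mul0r.
Qed.

Let rhs1_ge0 x : 0 <= r * (ppow alpha (s - x) * ml_kernel 0 l x).
Proof.
apply: mulr_ge0; first exact: ltW.
have [xs|xs] := ltP x s.
  by apply: mulr_ge0; [exact: ppow_ge0|apply: G0'; exact: lt_trans st].
by rewrite ppow0 ?subr_le0// mul0r.
Qed.

Let rhs2_ge0 x : 0 <= ml_kernel 0 l s * ml_tail s t x.
Proof. by apply: mulr_ge0 => //; apply: mulr_ge0; exact: ppow_ge0. Qed.

Let lhs_le x : x <> s -> ppow alpha (t - x) * ml_kernel 0 l x <=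
  r * (ppow alpha (s - x) * ml_kernel 0 l x) + ml_kernel 0 l s * ml_tail s t x.
Proof.
move=> xs; have [x0|x0] := leP x 0.
  by rewrite {1}ml_kernel0// mulr0 addr_ge0.
have [xs'|sx] := ltP x s.
  rewrite -[leLHS]addr0; apply: lerD => //.
  rewrite [leRHS]mulrA; apply: ler_wpM2r; first by apply: G0'; exact: lt_trans st.
  apply: ppow_delay => //; exact: ltW.
have {xs}sx : s < x by rewrite lt_neqAle sx andbT; apply/eqP => /esym.
rewrite -[leLHS]add0r; apply: lerD => //.
rewrite /ml_tail [ppow 1 _]ppowE ?subr_gt0// subrr powRr0 mulr1 [leRHS]mulrC.
have [xt|tx] := leP x t; last first.
  by rewrite ppow0; [rewrite !mul0r|rewrite subr_le0 ltW].
by apply: ler_wpM2l; [exact: ppow_ge0|exact: Gs (ltW sx) xt].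
Qed.

(** The history is split at [s]: before [s] the power kernels are compared by
    ppow_delay, and after [s] the kernel is at most its value at [s]. *)
Lemma ml_conv_split : ml_conv alpha l t <= r * ml_conv alpha l s + ml_kernel 0 l s *
  (Gamma alpha * Gamma 1 / Gamma (alpha + 1) * (t - s) `^ alpha).
Proof.
have [i1 _] := ml_kernel_conv a01 l t a0 (lexx 0).
have [i2 _] := ml_kernel_conv a01 l s a0 (lexx 0).
have [i3 E3] := integral_ml_tail st.
rewrite -lee_fin EFinD (EFinM r) (EFinM (ml_kernel 0 l s)) -E3.
rewrite -(EFin_ml_conv l t a0) -(EFin_ml_conv l s a0).
have j2 := integrableZl measurableT r i2.
have j3 := integrableZl measurableT (ml_kernel 0 l s) i3.
rewrite -(integralZl measurableT i2) -(integralZl measurableT i3).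
rewrite -(integralD measurableT j2 j3).
apply: ae_ge0_le_integral.
- exact: measurableT.
- by move=> x _; rewrite lee_fin lhs_ge0.
- exact: measurable_int i1.
- by move=> x _; rewrite -!EFinM -EFinD lee_fin addr_ge0.
- by apply: emeasurable_funD; [exact: measurable_int j2|exact: measurable_int j3].
- exists [set s]; split; [exact: measurable_set1|exact: lebesgue_measure_set1|].
  move=> x /=; apply: contra_notP => xs _.
  by rewrite -!EFinM -EFinD lee_fin lhs_le.
Qed.

(** The forcing term of the Volterra equation and the bound of the memory before
    [s] scale by the same factor [r] from [s] to [t]; subtracting the two
    equations leaves [r] times the value at [s] on one side and the memory of
    [s, t], a small multiple of that value, on the other. *)
Lemma ml_kernel_jump : 0 < l -> ml_kernel 0 l t <= 0 ->
  s / t <= l * Gamma 1 / Gamma (alpha + 1) * (t - s) `^ alpha.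
Proof.
move=> l0 Gt; have t0 := lt_trans s0 st.
have Ga := Gamma_gt0 a0.
have ps : 0 < ppow alpha s by rewrite ppowE// powR_gt0.
have Gs0' : 0 < ml_kernel 0 l s by exact: G0.
have := ml_conv_split.
set K := Gamma alpha * Gamma 1 / Gamma (alpha + 1) * (t - s) `^ alpha => H.
have V1 := ml_volterra l t; have V2 := ml_volterra l s.
have : r * ml_kernel 0 l s <= l / Gamma alpha * (ml_kernel 0 l s * K).
  have E : r * (ppow alpha s / Gamma alpha) = ppow alpha t / Gamma alpha.
    by rewrite mulrA divfK// gt_eqF.
  have lG : 0 < l / Gamma alpha by rewrite divr_gt0.
  have := ler_wpM2l (ltW lG) H.
  have : r * (ml_kernel 0 l s + l / Gamma alpha * ml_conv alpha l s) =
      ml_kernel 0 l t + l / Gamma alpha * ml_conv alpha l t by rewrite V1 V2.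
  rewrite !mulrDr (mulrCA (l / Gamma alpha) r) (mulrCA r (l / Gamma alpha)) => e1 e2.
  exact: balance_le e1 Gt e2.
rewrite [leRHS]mulrCA [r * _]mulrC (ler_pM2l Gs0') => rK.
apply: (@le_trans _ _ r); last first.
  apply: le_trans rK _; rewrite le_eqVlt; apply/orP; left; apply/eqP.
  rewrite /K -[Gamma alpha * _ / _]mulrA -!mulrA; congr (_ * _).
  by rewrite mulKf// gt_eqF.
rewrite /r !ppowE// !powRB ?(gt_eqF t0) ?(gt_eqF s0) ?implybT// !powRr1 ?(ltW t0) ?(ltW s0)//.
have sa : 0 < s `^ alpha by rewrite powR_gt0.
rewrite ler_pdivlMr ?divr_gt0// [_ / s]mulrC mulrA [s / t * _]mulrAC divff ?gt_eqF//.
rewrite mul1r mulrC ler_pM2r ?invr_gt0//.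
by rewrite ge0_ler_powR// ?nnegrE ltW.
Qed.

End jump.

(** A first nonpositive time [i] of the kernel is impossible: ml_kernel_jump
    applies to [i] and to the maximum of the kernel over a short interval that
    ends at [i], and its conclusion fails as the interval shrinks. *)
Lemma ml_kernel_ge0 l t : 0 < l -> 0 <= ml_kernel 0 l t.
Proof.
move=> l0; have [t0|t0] := leP t 0; first by rewrite ml_kernel0.
rewrite leNgt; apply/negP => Gt.
have [t1 t10 Gt1] := ml_kernel_gt0_near0 l0.
pose S := [set s : R | 0 < s <= t /\ ml_kernel 0 l s <= 0].
have St : S t by split; [rewrite t0 lexx|exact: ltW].
have lbS : lbound S t1.
  move=> s [/andP[s0 st] Gs]; rewrite leNgt; apply/negP => st1.
  by have := Gt1 _ s0 (ltW st1); rewrite ltNge Gs.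
have hS : has_inf S by split; [exists t|exists t1].
set i := inf S.
have i0 : 0 < i by apply: lt_le_trans t10 _; apply: lb_le_inf => //; exists t.
have it : i <= t by apply: inf_lbound => //; exists t1.
have Gi : ml_kernel 0 l i <= 0.
  rewrite leNgt; apply/negP => Gi.
  have Gc : {for i, continuous (ml_kernel 0 l)} by exact: continuous_ml_kernel.
  have :=  Gc.
  move=> /(_ [set y | 0 < y] (lt_nbhsr Gi)).
  move=> /nbhs_ballP[e /= e0 He].
  have [s Ss si] := inf_adherent e0 hS.
  have is_ : i <= s by apply: inf_lbound => //; exists t1.
  have := He s; rewrite /ball/= => /(_ _).
  have [_] := Ss; rewrite leNgt => /negP Gs H; apply: Gs; apply: H.
  by rewrite distrC ger0_norm ?subr_ge0// ltrBlDl.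
have Gpos x : 0 < x -> x < i -> 0 < ml_kernel 0 l x.
  move=> x0 xi; rewrite ltNge; apply/negP => Gx.
  have : S x by split => //; rewrite x0 (le_trans (ltW xi)).
  move=> /(inf_lbound hS.2); rewrite leNgt; exact/negP/negPn.
pose c := l * Gamma 1 / Gamma (alpha + 1).
have c0 : 0 < c by rewrite divr_gt0 ?mulr_gt0// Gamma_gt0// addr_gt0.
(* The width [de] makes the right-hand side of ml_kernel_jump equal to 1/4,
   whereas the left-hand side is at least 1/2 on the chosen interval. *)
pose de := (4 * c)^-1 `^ alpha^-1.
have de0 : 0 < de by rewrite powR_gt0// invr_gt0 mulr_gt0.
have dec : c * de `^ alpha = 4^-1.
  rewrite -powRrM mulVf ?gt_eqF// powRr1; last by rewrite invr_ge0 ltW// mulr_gt0.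
  by rewrite invfM mulrCA divff ?gt_eqF// mulr1.
pose s1 := Num.max (i / 2) (i - de).
have s1i : s1 < i.
  by rewrite gt_max gtrBl de0 andbT ltr_pdivrMr// ltr_pMr// ltr1n.
have s10 : 0 < s1 by rewrite lt_max divr_gt0.
have [|m] := @EVT_max R (ml_kernel 0 l) s1 i (ltW s1i).
  apply: continuous_in_subspaceT => x; rewrite inE/= in_itv/= => /andP[sx _].
  by apply: continuous_ml_kernel => //; exact: lt_le_trans sx.
rewrite in_itv/= => /andP[s1m mi] Hm.
have Gm : 0 < ml_kernel 0 l m.
  apply: (lt_le_trans (Gpos _ s10 s1i)); apply: Hm.
  by rewrite in_itv/= lexx ltW.
have {}mi : m < i.
  rewrite lt_neqAle mi andbT; apply/eqP => mi'.
  by move: Gm; rewrite mi' ltNge Gi.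
have m0 : 0 < m by exact: lt_le_trans s1m.
have H := @ml_kernel_jump l m i m0 mi Gpos _ l0 Gi; have {H} : m / i <= c * (i - m) `^ alpha.
  apply: H => x mx xi; apply: Hm.
  by rewrite in_itv/= xi (le_trans s1m).
rewrite leNgt => /negP; apply.
apply: (@le_lt_trans _ _ (c * de `^ alpha)).
  rewrite ler_pM2l// ge0_ler_powR// ?nnegrE ?(ltW a0) ?(ltW de0)//.
    by rewrite subr_ge0 ltW.
  by move: s1m; rewrite ge_max => /andP[_]; rewrite lerBlDr -lerBlDl.
rewrite dec ltr_pdivlMr//.
move: s1m; rewrite ge_max => /andP[+ _]; apply: lt_le_trans.
by rewrite mulrC ltr_pM2l// ltf_pV2 ?posrE// ltr_nat.
Qed.
End mittag_leffler_positivity.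

(** * The mass of the relaxation kernel *)

Section kernel_mass.
Variables (R : realType) (alpha : R).
Hypothesis a01 : 0 < alpha < 1.
Local Notation mu := (@lebesgue_measure R).
Local Notation ml_kernel := (ml_kernel alpha).
Local Notation ml_conv := (ml_conv alpha).

Let a0 : 0 < alpha. Proof. by case/andP: a01. Qed.
Let a1 : alpha < 1. Proof. by case/andP: a01. Qed.

(** The integral of the kernel over [0, t], which is its fractional integral of
    order 1. *)
Definition ml_mass l t : R := Gamma 1 * ml_kernel 1 l t.

Lemma ppow1E (x : R) : 0 < x -> ppow 1 x = 1.
Proof. by move=> x0; rewrite ppowE// subrr powRr0. Qed.

Lemma ml_massE l t : (\int[mu]_x (ppow 1 (t - x) * ml_kernel 0 l x)%:E =
  (ml_mass l t)%:E)%E.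
Proof. by rewrite EFin_ml_conv// ml_convE. Qed.

(** The power kernel of order [alpha] decreases, so on [0, t] it is at least its
    value at [t]: the memory term is at least that value times the mass.  The
    Volterra equation bounds the memory term by the forcing term. *)
Lemma ml_mass_le l t : 0 < l -> 0 < t -> l * ml_mass l t <= 1.
Proof.
move=> l0 t0; have Ga := Gamma_gt0 a0.
have pt : 0 < ppow alpha t by rewrite ppowE// powR_gt0.
have H : ppow alpha t * ml_mass l t <= ml_conv alpha l t.
  have [i1 _] := ml_kernel_conv a01 l t ltr01 (lexx 0).
  have [i2 _] := ml_kernel_conv a01 l t a0 (lexx 0).
  rewrite -lee_fin EFinM -ml_massE -(EFin_ml_conv a01 l t a0).
  rewrite -(integralZl measurableT i1); apply: le_integral.
  - exact: measurableT.
  - exact: integrableZl.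
  - exact: i2.
  - move=> x _; rewrite -EFinM lee_fin mulrA.
    have [x0|x0] := leP x 0; first by rewrite ml_kernel0// !mulr0.
    apply: ler_wpM2r; first exact: ml_kernel_ge0.
    have [xt|tx] := ltP x t; last first.
      by rewrite [ppow 1 _]ppow0; [rewrite mulr0 ppow_ge0|rewrite subr_le0].
    rewrite ppow1E ?subr_gt0// mulr1; apply: ppow_anti; rewrite ?subr_gt0//.
      exact: ltW.
    by rewrite gerBl ltW.
have GN : Gamma alpha != 0 by rewrite gt_eqF.
have V : ml_kernel 0 l t * Gamma alpha + l * ml_conv alpha l t = ppow alpha t.
  have := ml_volterra a01 l t => /(congr1 ( *%R^~ (Gamma alpha))).
  by rewrite divfK// mulrDl => <-; congr (_ + _); rewrite mulrAC divfK.
rewrite -(ler_pM2l pt) mulr1 mulrCA -[leRHS]V -[leLHS]add0r; apply: lerD.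
  by apply: mulr_ge0; [exact: ml_kernel_ge0|exact: ltW].
by apply: ler_wpM2l; [exact: ltW|].
Qed.

(** In the Volterra equation integrated over [0, t] the memory term is the
    fractional integral of order [1 + alpha], whose kernel is at most
    [t `^ alpha]: it is at most a multiple of the mass, so that the mass cannot
    be small compared with the integral of the forcing term. *)
Lemma ml_mass_lb l t : 0 < l -> 0 < t ->
  Gamma 1 * t `^ alpha <=
  ml_mass l t * (Gamma (1 + alpha) + Gamma 1 * l * t `^ alpha).
Proof.
move=> l0 t0; have Ga : 0 < Gamma (1 + alpha) by rewrite Gamma_gt0// addr_gt0.
have H : ml_conv (1 + alpha) l t <= t `^ alpha * ml_mass l t.
  have b0 : 0 < 1 + alpha by rewrite addr_gt0.
  have [i1 _] := ml_kernel_conv a01 l t ltr01 (lexx 0).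
  have [i2 _] := ml_kernel_conv a01 l t b0 (lexx 0).
  rewrite -lee_fin EFinM -ml_massE -(EFin_ml_conv a01 l t b0).
  rewrite -(integralZl measurableT i1); apply: le_integral.
  - exact: measurableT.
  - exact: i2.
  - exact: integrableZl.
  - move=> x _; rewrite -EFinM lee_fin [leRHS]mulrA.
    have [x0|x0] := leP x 0; first by rewrite ml_kernel0// !mulr0.
    apply: ler_wpM2r; first exact: ml_kernel_ge0.
    have [xt|tx] := ltP x t; last first.
      by rewrite ppow0; [rewrite mulr_ge0 ?powR_ge0 ?ppow_ge0|rewrite subr_le0].
    rewrite ppow1E ?subr_gt0// mulr1 ppowE ?subr_gt0//.
    rewrite [1 + alpha]addrC addrK ge0_ler_powR ?nnegrE ?(ltW a0) ?(ltW t0)//.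
      by rewrite subr_ge0 ltW.
    by rewrite gerBl ltW.
have := ml_kernel_rec a01 l t ler01; rewrite (ppowE _ t0).
rewrite ml_convE ?addr_gt0// in H.
have GN : Gamma (1 + alpha) != 0 by rewrite gt_eqF.
move=> /(congr1 (fun x => Gamma 1 * (x * Gamma (1 + alpha)))).
rewrite divfK// [in t `^ _]addrAC subrr add0r => <-.
have G1 := @Gamma_gt0 R 1 ltr01.
have := ler_wpM2l (ltW (mulr_gt0 l0 G1)) H.
rewrite /ml_mass; move: (ml_kernel _ l t) (ml_kernel _ l t) (Gamma _) (Gamma 1) (t `^ alpha) => u v G G' p.
have -> : G' * ((u + l * v) * G) = G' * u * G + l * G' * (G * v) by ring.
have -> : G' * u * (G + G' * l * p) = G' * u * G + l * G' * (p * (G' * u)) by ring.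
by rewrite lerD2l.
Qed.

(** The function [x / (G + x)] increases, so ml_mass_lb at [l] yields the bound at
    every smaller [l0]: this makes it uniform over the spectrum. *)
Lemma ml_mass_ge l0 l t : 0 < l0 -> l0 <= l -> 0 < t ->
  Gamma 1 * l0 * t `^ alpha / (Gamma (1 + alpha) + Gamma 1 * l0 * t `^ alpha) <=
  l * ml_mass l t.
Proof.
move=> l00 ll t0; have lp : 0 < l by exact: lt_le_trans ll.
have G1 : 0 < @Gamma R 1 := Gamma_gt0 ltr01.
have Ga : 0 < Gamma (1 + alpha) by rewrite Gamma_gt0// addr_gt0.
have p0 : 0 < t `^ alpha by rewrite powR_gt0.
have := ml_mass_lb lp t0.
move: (ml_mass l t) (Gamma _) (Gamma 1) (t `^ alpha) G1 Ga p0 => m G G1 p G10 Ga p0 H.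
have x0 : 0 < G1 * l0 * p by rewrite !mulr_gt0.
have y0 : 0 < G1 * l * p by rewrite !mulr_gt0.
apply: (@le_trans _ _ (G1 * l * p / (G + G1 * l * p))).
  rewrite ler_pdivrMr ?addr_gt0// [leRHS]mulrAC ler_pdivlMr ?addr_gt0//.
  rewrite !mulrDr; apply: lerD; last by rewrite mulrC.
  by rewrite ler_pM2r// ler_pM2r// ler_pM2l.
rewrite ler_pdivrMr ?addr_gt0// -[leRHS]mulrA [G1 * l]mulrC -[leLHS]mulrA.
by rewrite ler_pM2l// [l * G1]mulrC.
Qed.

Lemma measurable_relaxation_kernel l t :
  measurable_fun setT (relaxation_kernel alpha l t).
Proof.
have mt : measurable_fun setT (fun tau : R => t - tau) by exact: measurable_funB.
apply: measurable_funM.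
  by apply: (measurableT_comp (measurable_powR _)).
have -> : (fun tau => mittag_leffler alpha alpha (- l * (t - tau) `^ alpha)) =
   (fun z => limn (pseries (ml_coef alpha 0) z)) \o (fun tau => - l * (t - tau) `^ alpha).
  apply/funext => tau /=; rewrite /mittag_leffler /pseries; congr (limn (series _)).
  by apply/funext => k /=; rewrite /ml_coef add0r mulrC.
apply: measurableT_comp.
  by apply: continuous_measurable_fun; exact: entire_continuous (ml_coef_entire a01 (lexx 0)).
apply: measurable_funM => //.
exact: (measurableT_comp (measurable_powR _) mt).
Qed.

Lemma relaxation_kernel_ge0 l t tau : 0 < l -> tau <= t ->
  0 <= relaxation_kernel alpha l t tau.
Proof.
move=> l0; rewrite le_eqVlt => /predU1P[->|tt]; last first.
  by rewrite relaxation_kernelE// ml_kernel_ge0.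
by rewrite /relaxation_kernel subrr powR0 ?mul0r// subr_eq0 lt_eqF.
Qed.

(** relaxation_kernel and the reflected ml_kernel differ only at the end points,
    by the conventions for powers of 0. *)
Lemma integral_relaxation_kernel l t : 0 < l -> 0 < t ->
  (\int[mu]_(tau in `[0%R, t]) (relaxation_kernel alpha l t tau)%:E =
   (ml_mass l t)%:E)%E.
Proof.
move=> l0 t0.
pose F x := (ppow 1 (t - x) * ml_kernel 0 l x)%:E.
have mF : measurable_fun setT F.
  have [i1 _] := ml_kernel_conv a01 l t ltr01 (lexx 0); exact: measurable_int i1.
have F0 x : (0 <= F x)%E by rewrite lee_fin mulr_ge0 ?ppow_ge0 ?ml_kernel_ge0.
have n1 : (-1 : R) != 0 by rewrite oppr_eq0 oner_eq0.
rewrite -ml_massE -/(F _) (ge0_integral_affine t n1 mF F0).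
rewrite normrN1 mul1e integral_mkcond; apply: ae_eq_integral.
- exact: measurableT.
- apply/(measurable_restrictT _ _).1; first exact: measurable_itv.
  apply/measurable_EFinP; apply: measurable_funTS.
  exact: measurable_relaxation_kernel.
- apply: (measurableT_comp mF); exact: measurable_affine.
have := ae_neq t; have := ae_neq (0 : R); apply: (@filterS2 _ _ (ae_filter_ringOfSetsType mu)) => tau tau0 taut _.
rewrite patchE /F.
case: ifPn; rewrite ?inE ?notin_setE/= in_itv/=.
  move=> /andP[tau0' taut']; have tt : tau < t by rewrite lt_neqAle taut.
  have tau0'' : 0 < tau by rewrite lt_neqAle eq_sym tau0.
  rewrite relaxation_kernelE// mulN1r [- tau + t]addrC opprD addrA subrr add0r opprK.
  by rewrite ppow1E// mul1r.
move=> /negP; rewrite negb_and -!ltNge mulN1r => /orP[tau0'|taut'].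
  by rewrite ppow0 ?mul0r// opprD addrCA subrr addr0 opprK ltW.
by rewrite ml_kernel0 ?mulr0// addrC subr_le0 ltW.
Qed.
End kernel_mass.

(** * Square-integrable functions *)

Section square_integrable.
Context d (T : measurableType d) (R : realType).
Variable mu : {measure set T -> \bar R}.
Implicit Types f g : T -> R.

Definition sq_int f : Prop :=
  measurable_fun setT f /\ mu.-integrable setT (fun x => (f x ^+ 2)%:E).

Definition ip f g : R := \int[mu]_x (f x * g x).

Lemma sq_intP f : measurable_fun setT f ->
  (\int[mu]_x (f x ^+ 2)%:E < +oo)%E -> sq_int f.
Proof.
move=> mf H; split => //; apply/integrableP; split.
  by apply/measurable_EFinP; exact: measurable_funX.
by under eq_integral do rewrite gee0_abs ?lee_fin ?sqr_ge0//.
Qed.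

Lemma sq_int_Lfun f : f \in Lfun mu 2%:E -> sq_int f.
Proof.
move=> L; split; last exact: Lfun2_integrable_sqr.
by move: L; rewrite inE => /andP[+ _]; rewrite inE.
Qed.

Lemma Lnorm2_sqr f : ('N[mu]_2%:E[EFin \o f] ^+ 2 = \int[mu]_x (f x ^+ 2)%:E)%E.
Proof.
have -> : ('N[mu]_2%:E[EFin \o f] ^+ 2 = 'N[mu]_2%:E[EFin \o f] `^ 2)%E.
  have := Lnorm_ge0 mu 2%:E (EFin \o f).
  case: ('N[mu]_2%:E[EFin \o f])%E => [r|_|//].
    by rewrite lee_fin => r0; rewrite poweR_EFin powR_mulrn.
  by rewrite expe2 mulyy poweRyr.
rewrite powR_Lnorm//; apply: eq_integral => x _.
by rewrite abse_EFin poweR_EFin powR_mulrn// real_normK ?num_real.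
Qed.

Lemma sq_int0 : sq_int (cst 0).
Proof.
split; first exact: measurable_cst.
by under eq_fun do rewrite /= expr0n/=; exact: integrable0.
Qed.

Lemma integrable_mul f g : sq_int f -> sq_int g ->
  mu.-integrable setT (fun x => (f x * g x)%:E).
Proof.
move=> [mf f2] [mg g2]; have i := integrableD measurableT f2 g2.
apply: (le_integrable measurableT _ _ i).
  by apply/measurable_EFinP; exact: measurable_funM.
move=> x _; rewrite -EFinD !abse_EFin lee_fin [leRHS]ger0_norm ?addr_ge0 ?sqr_ge0//.
rewrite normrM -[f x ^+ 2]real_normK ?num_real// -[g x ^+ 2]real_normK ?num_real//.
have := sqr_ge0 (`|f x| - `|g x|); nra.
Qed.

Lemma sq_intD f g : sq_int f -> sq_int g -> sq_int (fun x => f x + g x).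
Proof.
move=> [mf f2] [mg g2]; split; first exact: measurable_funD.
have i := integrableZl measurableT 2 (integrableD measurableT f2 g2).
apply: (le_integrable measurableT _ _ i).
  by apply/measurable_EFinP; apply: measurable_funX; exact: measurable_funD.
move=> x _; rewrite -EFinD -EFinM !abse_EFin lee_fin !ger0_norm ?sqr_ge0//; last first.
  by rewrite mulr_ge0// addr_ge0// sqr_ge0.
have := sqr_ge0 (f x - g x); nra.
Qed.

Lemma sq_intZ a f : sq_int f -> sq_int (fun x => a * f x).
Proof.
move=> [mf f2]; split; first exact: measurable_funM.
under eq_fun do rewrite exprMn EFinM.
exact: integrableZl.
Qed.

Lemma sq_intB f g : sq_int f -> sq_int g -> sq_int (fun x => f x - g x).
Proof.
move=> sf sg; have := sq_intD sf (sq_intZ (-1) sg).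
by under eq_fun do rewrite mulN1r.
Qed.

Lemma sq_int_sum (I : Type) (s : seq I) (F : I -> T -> R) :
  (forall i, sq_int (F i)) -> sq_int (fun x => \sum_(i <- s) F i x).
Proof.
move=> sF; elim: s => [|i s IH].
  by under eq_fun do rewrite big_nil; exact: sq_int0.
by under eq_fun do rewrite big_cons; exact: sq_intD.
Qed.

Lemma ipC f g : ip f g = ip g f.
Proof. by rewrite /ip; apply: eq_Rintegral => x _; rewrite mulrC. Qed.

Lemma ipDl f g k : sq_int f -> sq_int g -> sq_int k ->
  ip (fun x => f x + g x) k = ip f k + ip g k.
Proof.
move=> sf sg sk; rewrite /ip; under eq_Rintegral do rewrite mulrDl.
by rewrite RintegralD//; exact: integrable_mul.
Qed.

Lemma ipZl a f k : sq_int f -> sq_int k -> ip (fun x => a * f x) k = a * ip f k.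
Proof.
move=> sf sk; rewrite /ip; under eq_Rintegral do rewrite -mulrA.
by rewrite RintegralZl//; exact: integrable_mul.
Qed.

Lemma ipBl f g k : sq_int f -> sq_int g -> sq_int k ->
  ip (fun x => f x - g x) k = ip f k - ip g k.
Proof.
move=> sf sg sk; rewrite /ip; under eq_Rintegral do rewrite mulrBl.
by rewrite RintegralB//; exact: integrable_mul.
Qed.

Lemma ip0l k : ip (cst 0) k = 0.
Proof.
rewrite /ip; under eq_Rintegral do rewrite mul0r.
by rewrite /Rintegral integral0.
Qed.

Lemma ip_suml (I : Type) (s : seq I) (F : I -> T -> R) k :
  (forall i, sq_int (F i)) -> sq_int k ->
  ip (fun x => \sum_(i <- s) F i x) k = \sum_(i <- s) ip (F i) k.
Proof.
move=> sF sk; elim: s => [|i s IH].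
  by under [X in ip X]eq_fun do rewrite big_nil; rewrite big_nil ip0l.
under [X in ip X]eq_fun do rewrite big_cons.
by rewrite big_cons ipDl// ?IH//; exact: sq_int_sum.
Qed.

Lemma ip_ge0 f : 0 <= ip f f.
Proof. by apply: Rintegral_ge0 => x _; rewrite -expr2 sqr_ge0. Qed.

Lemma EFin_ip f : sq_int f -> (\int[mu]_x (f x ^+ 2)%:E = (ip f f)%:E)%E.
Proof.
move=> [mf f2]; rewrite /ip /Rintegral fineK; last exact: integrable_fin_num.
by apply: eq_integral => x _; rewrite expr2.
Qed.

Lemma ip_expand f g : sq_int f -> sq_int g -> forall a, 
  ip (fun x => f x - a * g x) (fun x => f x - a * g x) =
  ip f f - 2 * a * ip f g + a ^+ 2 * ip g g.
Proof.
move=> sf sg a; have sZ := sq_intZ a sg.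
have sD := sq_intB sf sZ.
rewrite (ipBl sf sZ sD) (ipC f) (ipC (fun x => a * g x)) (ipBl sf sZ sf) (ipBl sf sZ sZ).
rewrite (ipC f (fun x => a * g x)) !ipZl// (ipC g (fun x => a * g x)) ipZl// (ipC g f).
by ring.
Qed.

Lemma cauchy_schwarz f g : sq_int f -> sq_int g -> ip f g ^+ 2 <= ip f f * ip g g.
Proof.
move=> sf sg.
have H a : 0 <= ip f f - 2 * a * ip f g + a ^+ 2 * ip g g.
  by rewrite -ip_expand// ip_ge0.
have := ip_ge0 g; rewrite le_eqVlt => /predU1P[g0|g0].
  rewrite -g0 mulr0; have [->|fg] := eqVneq (ip f g) 0; first by rewrite expr0n.
  have := H ((ip f f + 1) / (2 * ip f g)); rewrite -g0 mulr0 addr0.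
  rewrite (_ : 2 * _ * _ = ip f f + 1); last by field.
  by rewrite opprD addrA subrr add0r oppr_ge0 ler10.
have := H (ip f g / ip g g).
rewrite (_ : _ + _ = ip f f - ip f g ^+ 2 / ip g g); last by field; rewrite gt_eqF.
by rewrite subr_ge0 ler_pdivrMr.
Qed.

Lemma ipD_le f g : sq_int f -> sq_int g ->
  ip (fun x => f x + g x) (fun x => f x + g x) <= 2 * ip f f + 2 * ip g g.
Proof.
move=> sf sg.
have := ip_ge0 (fun x => f x - 1 * g x); rewrite ip_expand//.
have -> : (fun x => f x + g x) = (fun x => f x - (-1) * g x).
  by apply/funext => x; rewrite mulN1r opprK.
by rewrite ip_expand//; lra.
Qed.

(** Pythagoras: the residual of an orthonormal expansion is orthogonal to it. *)
Lemma ip_residual (phi : nat -> T -> R) f N : (forall k, sq_int (phi k)) ->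
  (forall j k, ip (phi j) (phi k) = (j == k)%:R) -> sq_int f ->
  ip (fun x => f x - \sum_(k < N) ip f (phi k) * phi k x)
     (fun x => f x - \sum_(k < N) ip f (phi k) * phi k x) =
  ip f f - \sum_(k < N) ip f (phi k) ^+ 2.
Proof.
move=> sp op sf; pose p x := \sum_(k < N) ip f (phi k) * phi k x.
have sP : sq_int p by apply: sq_int_sum => k; exact: sq_intZ.
have fp : ip f p = \sum_(k < N) ip f (phi k) ^+ 2.
  rewrite ipC ip_suml//; last by move=> k; exact: sq_intZ.
  by apply: eq_bigr => k _; rewrite ipZl// (ipC _ f) expr2.
have pp : ip p p = \sum_(k < N) ip f (phi k) ^+ 2.
  rewrite {1}/p ip_suml//; last by move=> k; exact: sq_intZ.
  apply: eq_bigr => k _; rewrite ipZl// (ipC (phi k)) /p ip_suml//; last by move=> j; exact: sq_intZ.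
  rewrite (bigD1 k)//= ipZl// op eqxx mulr1 big1 ?addr0 ?expr2// => j jk.
  by rewrite ipZl// op (_ : (j == k :> nat) = false) ?mulr0//; exact/negbTE.
have := ip_expand sf sP 1; under eq_fun do rewrite mul1r.
by rewrite fp pp => ->; ring.
Qed.

Lemma bessel (phi : nat -> T -> R) f N : (forall k, sq_int (phi k)) ->
  (forall j k, ip (phi j) (phi k) = (j == k)%:R) -> sq_int f ->
  \sum_(k < N) ip f (phi k) ^+ 2 <= ip f f.
Proof. by move=> sp op sf; rewrite -subr_ge0 -(ip_residual N sp op sf) ip_ge0. Qed.
End square_integrable.

Section expectation_constants.
Context (R : realType) (d : measure_display) (Omega : measurableType d).
Variable P : probability Omega R.

Lemma expectation_cst (x : R) : (\int[P]_w x%:E = x%:E)%E.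
Proof.
transitivity (x%:E * P setT)%E; first exact: integral_cst.
by rewrite probability_setT mule1.
Qed.

Lemma sq_int_cst (x : R) : sq_int P (cst x).
Proof.
apply: sq_intP; first exact: measurable_cst.
by apply: (@le_lt_trans _ _ (x ^+ 2)%:E); [rewrite -[leRHS]expectation_cst|exact: ltry].
Qed.

Lemma ip_cst1 f : ip P f (cst 1) = \int[P]_w f w.
Proof. by apply: eq_Rintegral => w _; rewrite mulr1. Qed.

Lemma ip_cst11 : ip P (cst 1) (cst 1) = 1.
Proof. by rewrite ip_cst1 /Rintegral expectation_cst. Qed.

End expectation_constants.

(** * Moments of Gaussian variables *)

Section gaussian_moments.
Variable R : realType.
Local Notation mu := (@lebesgue_measure R).

Lemma expR_sqr_tail (s x : R) : 0 < s -> 0 <= x ->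
  (\int[mu]_(y in `[x, +oo[) (y / s * expR (- (y ^+ 2 / (2 * s))))%:E =
   (expR (- (x ^+ 2 / (2 * s))))%:E)%E.
Proof.
move=> s0 x0.
pose F y := - expR (- (y ^+ 2 / (2 * s))) : R.
have dF (y : R) : is_derive y (1 : R) F (y / s * expR (- (y ^+ 2 / (2 * s)))).
  apply: is_derive_eq; rewrite /GRing.scale/=.
  by field; rewrite gt_eqF.
have cF (g : R -> R) : (forall y, derivable g y 1) -> continuous g.
  by move=> dg y; apply: differentiable_continuous; exact/derivable1_diffP.
rewrite (@ge0_continuous_FTC2y _ _ F x 0).
- by rewrite sub0e /F EFinN oppeK.
- move=> y xy; apply: mulr_ge0; last exact: expR_ge0.
  by apply: divr_ge0; [exact: le_trans xy|exact: ltW].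
- apply: continuous_subspaceT; apply: cF => y.
  by apply: ex_derive.
- rewrite -oppr0; apply: cvgN.
  apply: (cvg_comp (fun y => y ^+ 2 / (2 * s)) (fun z => expR (- z))); last exact: cvgr_expR.
  by apply: gt0_cvgMly; [rewrite invr_gt0 mulr_gt0|exact: cvgr_expr2].
- by move=> y _; have [] := dF y.
- by apply: cvg_at_right_filter; apply: cF => y; have [] := dF y.
- by move=> y _; rewrite derive1E; have [_ ->] := dF y.
Qed.

Definition gaussian_fun (s x : R) := expR (- (x ^+ 2 / (2 * s))).

Lemma continuous_gaussian_fun s : continuous (gaussian_fun s).
Proof.
move=> x; apply: differentiable_continuous; apply/derivable1_diffP.
by apply: ex_derive.
Qed.

(** Writing the Gaussian as the integral of its derivative and exchanging the
    order of integration relates its second moment to its mass. *)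
Lemma gaussian_second_moment s : 0 < s ->
  (\int[mu]_x (x ^+ 2 * gaussian_fun s x)%:E =
   s%:E * \int[mu]_x (gaussian_fun s x)%:E)%E.
Proof.
move=> s0.
have mg : measurable_fun setT (gaussian_fun s).
  by apply: continuous_measurable_fun; exact: continuous_gaussian_fun.
have g0 x : 0 <= gaussian_fun s x by exact: expR_ge0.
have gN x : gaussian_fun s (- x) = gaussian_fun s x by rewrite /gaussian_fun sqrrN.
rewrite (@ge0_symfun_integralT _ (fun x => x ^+ 2 * gaussian_fun s x)); first last.
- by move=> x; rewrite /= sqrrN gN.
- by move=> x; apply: cvgM; [exact: sqr_continuous|exact: continuous_gaussian_fun].
- by move=> x; rewrite mulr_ge0// sqr_ge0.
rewrite (@ge0_symfun_integralT _ (gaussian_fun s)); first last.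
- by move=> x; rewrite /= gN.
- exact: continuous_gaussian_fun.
- exact: g0.
rewrite muleCA; congr (_ * _)%E.
pose K (p : R * R) : R := if (0 <= p.1) && (p.1 <= p.2) then p.2 / s * gaussian_fun s p.2 else 0.
have mK : measurable_fun setT (EFin \o K).
  apply/measurable_EFinP; apply: measurable_fun_ifT => //.
    by apply: measurable_and; exact: measurable_fun_ler.
  apply: measurable_funM; first exact: measurable_funM.
  exact: (measurableT_comp mg).
have K0 p : (0 <= (EFin \o K) p)%E.
  rewrite /K /= lee_fin; case: ifP => // /andP[a b].
  by rewrite mulr_ge0// divr_ge0 ?(le_trans a b)// ltW.
have := @fubini_tonelli _ _ _ _ _ mu mu _ mK K0.
have mpos : measurable [set x : R | 0 <= x] by rewrite -set_itvcy.
have -> : (\int[mu]_x \int[mu]_y (EFin \o K) (x, y) =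
    \int[mu]_(x in [set x | (0 <= x)%R]) (gaussian_fun s x)%:E)%E.
  rewrite [RHS]integral_mkcond; apply: eq_integral => x _; rewrite patchE.
  case: ifPn; rewrite ?inE ?notin_setE/= => x0.
    rewrite -expR_sqr_tail// [RHS]integral_mkcond; apply: eq_integral => y _.
    rewrite patchE /K/= x0/=.
    by rewrite mem_setE in_itv/= andbT; case: ifP.
  by rewrite integral0_eq// => y _; rewrite /K/= (negbTE (introN idP x0)).
have -> : (\int[mu]_y \int[mu]_x (EFin \o K) (x, y) =
    \int[mu]_(y in [set y | (0 <= y)%R]) (s^-1%:E * (y ^+ 2 * gaussian_fun s y)%:E))%E.
  rewrite [RHS]integral_mkcond; apply: eq_integral => y _; rewrite patchE.
  case: ifPn; rewrite ?inE ?notin_setE/= => y0.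
    rewrite -EFinM (_ : s^-1 * _ = (y / s * gaussian_fun s y) * (y - 0)); last by ring.
    rewrite -integral_cst_itv// [RHS]integral_mkcond; apply: eq_integral => x _.
    rewrite patchE /K/=.
    by rewrite mem_setE in_itv/=; case: ifP.
  rewrite integral0_eq// => x _; rewrite /K/=; case: ifP => // /andP[a b].
  by case: y0; exact: le_trans b.
rewrite ge0_integralZl//; first last.
- by rewrite lee_fin invr_ge0 ltW.
- by move=> x _; rewrite lee_fin mulr_ge0// sqr_ge0.
- apply/measurable_EFinP; apply: measurable_funTS.
  by apply: measurable_funM => //; exact: measurable_funX.
by move=> ->; rewrite muleA -EFinM divff ?gt_eqF// mul1e.
Qed.

(** normal_prob is known by its values on sets; its density is recovered as its
    Radon-Nikodym derivative. *)
Lemma ge0_integral_normal_prob (sigma : R) (g : R -> \bar R) : sigma != 0 ->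
  measurable_fun setT g -> (forall x, 0 <= g x)%E ->
  (\int[normal_prob 0 sigma]_x g x = \int[mu]_x (g x * (normal_pdf 0 sigma x)%:E))%E.
Proof.
move=> s0 mg g0; have D := @normal_prob_dominates R 0 sigma.
rewrite -(@Radon_Nikodym_SigmaFinite.change_of_variables _ _ _
  (normal_prob 0 sigma) mu D g setT g0 measurableT mg).
have mf := measurable_int mu (Radon_Nikodym_SigmaFinite.f_integrable D).
have mp : measurable_fun setT (fun x => (normal_pdf 0 sigma x)%:E : \bar R).
  by apply/measurable_EFinP; exact: measurable_normal_pdf.
apply: ae_eq_integral.
- exact: measurableT.
- exact: emeasurable_funM.
- exact: emeasurable_funM.
have H : ae_eq mu setT (Radon_Nikodym_SigmaFinite.f (normal_prob 0 sigma) mu)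
    (fun x => (normal_pdf 0 sigma x)%:E).
  apply: integral_ae_eq.
  - exact: measurableT.
  - exact: Radon_Nikodym_SigmaFinite.f_integrable.
  - exact: mp.
  - by move=> E _ mE; rewrite -(Radon_Nikodym_SigmaFinite.f_integral D mE).
by move: H; apply: (@filterS _ _ (ae_filter_ringOfSetsType mu)) => x /= H xT; rewrite H.
Qed.

Section gaussian_random_variable.
Context d (Omega : measurableType d) (P : probability Omega R).
Variables (X : Omega -> measurableTypeR R) (sigma : R).
Hypotheses (mX : measurable_fun setT X) (s0 : 0 < sigma).
Hypothesis lawX : forall B : set R, measurable B ->
  P (X @^-1` B) = normal_prob 0 sigma B.

Lemma ge0_integral_gaussian (g : R -> \bar R) :
  measurable_fun setT g -> (forall x, 0 <= g x)%E ->
  (\int[P]_w g (X w) = \int[mu]_x (g x * (normal_pdf 0 sigma x)%:E))%E.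
Proof.
move=> mg g0; rewrite -ge0_integral_normal_prob ?gt_eqF//.
pose Y : {mfun Omega >-> measurableTypeR R} := mfun_Sub (mem_set mX).
rewrite -[LHS](@ge0_integral_distribution _ _ _ _ _ P Y g mg g0).
by apply: eq_measure_integral => B mB _; exact: lawX.
Qed.

Let pdfN x : normal_pdf 0 sigma (- x) = normal_pdf 0 sigma x.
Proof.
by rewrite normal_pdfE ?gt_eqF// /normal_fun !subr0 sqrrN.
Qed.

(** The positive and negative parts have the same integral by symmetry, so the
    mean vanishes even before integrability is known. *)
Lemma gaussian_mean : \int[P]_w X w = 0.
Proof.
rewrite /Rintegral integralE.
pose gp (x : R) : \bar R := maxe x%:E 0%E; pose gn (x : R) : \bar R := maxe (- x%:E)%E 0%E.
have mgp : measurable_fun setT gp.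
  by apply: measurable_maxe => //; exact/(measurable_EFinP _ id).
have mgn : measurable_fun setT gn.
  apply: measurable_maxe => //.
  by apply: measurableT_comp => //; exact/(measurable_EFinP _ id).
have gp0 x : (0 <= gp x)%E by rewrite /gp le_max lexx orbT.
have gn0 x : (0 <= gn x)%E by rewrite /gn le_max lexx orbT.
have -> : (\int[P]_w (EFin \o X)^\+ w)%E = (\int[P]_w gp (X w))%E.
  by apply: eq_integral => w _; rewrite funeposE.
have -> : (\int[P]_w (EFin \o X)^\- w)%E = (\int[P]_w gn (X w))%E.
  by apply: eq_integral => w _; rewrite funenegE.
rewrite (ge0_integral_gaussian mgp gp0) (ge0_integral_gaussian mgn gn0).
have n1 : (-1 : R) != 0 by rewrite oppr_eq0 oner_eq0.
have mf : measurable_fun setT (fun x : R => gn x * (normal_pdf 0 sigma x)%:E)%E.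
  apply: emeasurable_funM => //.
  by apply/measurable_EFinP; exact: measurable_normal_pdf.
have f0 (x : R) : (0 <= gn x * (normal_pdf 0 sigma x)%:E)%E.
  by rewrite mule_ge0// lee_fin normal_pdf_ge0.
rewrite (ge0_integral_affine 0 n1 mf f0) normrN1 mul1e.
under [X in (_ - X)%E]eq_integral do rewrite addr0 mulN1r pdfN /gn EFinN oppeK.
rewrite -/gp.
case: (integral _ _ _) => //= r; by rewrite subrr.
Qed.

Lemma gaussian_variance : (\int[P]_w ((X w) ^+ 2)%:E = (sigma ^+ 2)%:E)%E.
Proof.
have m2 : measurable_fun setT (fun x : R => (x ^+ 2)%:E).
  by apply/measurable_EFinP; exact: measurable_funX.
rewrite (@ge0_integral_gaussian (fun x => (x ^+ 2)%:E)) //; last first.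
  by move=> x; rewrite lee_fin sqr_ge0.
have E x : normal_pdf 0 sigma x = normal_peak sigma * gaussian_fun (sigma ^+ 2) x.
  rewrite normal_pdfE ?gt_eqF// /normal_fun /gaussian_fun subr0 mulNr.
  by rewrite mulr_natl.
have p0 : 0 <= normal_peak sigma by exact: normal_peak_ge0.
have mg : measurable_fun setT (gaussian_fun (sigma ^+ 2)).
  by apply: continuous_measurable_fun; exact: continuous_gaussian_fun.
under eq_integral do rewrite E -EFinM mulrCA EFinM.
rewrite ge0_integralZl//; first last.
- by move=> x _; rewrite lee_fin mulr_ge0 ?sqr_ge0// expR_ge0.
- by apply/measurable_EFinP; apply: measurable_funM => //; exact: measurable_funX.
rewrite gaussian_second_moment ?exprn_gt0// muleCA -ge0_integralZl//; first last.
- by move=> x _; rewrite lee_fin expR_ge0.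
- exact/measurable_EFinP.
under eq_integral do rewrite -EFinM -E.
by rewrite integral_normal_pdf mule1.
Qed.
End gaussian_random_variable.

End gaussian_moments.

(** * Moments of Wiener integrals *)

(** Identities pass to L^2 limits in this form: the Cauchy-Schwarz inequality
    bounds the square of the error. *)
Lemma sq_small_eq0 (R : realFieldType) (y c : R) :
  (forall e, 0 < e -> y ^+ 2 <= c * e) -> y = 0.
Proof.
move=> H; apply/eqP; rewrite -sqrf_eq0; apply/eqP/le_anti; rewrite sqr_ge0 andbT.
have [c0|c0] := leP c 0; first by have := H 1 ltr01; rewrite mulr1 => /le_trans; exact.
apply/ler_addgt0Pr => e e0; rewrite add0r.
have := H (e / c); rewrite divr_gt0// mulrC divfK ?gt_eqF//; exact.
Qed.

Lemma near_lt_cvg0 (R : realType) (u : nat -> \bar R) (e : R) :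
  u @ \oo --> 0%E -> 0 < e -> \forall j \near \oo, (u j < e%:E)%E.
Proof. by move=> cu e0; exact: (cu _ (@nbhs_open_ereal_lt R 0 (cst e) e0)). Qed.

Section lebesgue_indicator.
Variable R : realType.
Local Notation mu := (@lebesgue_measure R).

Lemma integral_indic_itv b0 b1 (s t : R) :
  (\int[mu]_x (\1_([set` Interval (BSide b0 s) (BSide b1 t)] : set R) x)%:E)%E =
   if s < t then (t - s)%:E else 0%E.
Proof.
rewrite integral_indic; [|exact: measurableT|exact: measurable_itv].
by rewrite setIT; etransitivity; first exact: lebesgue_measure_itv.
Qed.

Lemma sq_int_indic_itv b0 b1 (s t : R) :
  sq_int mu (\1_([set` Interval (BSide b0 s) (BSide b1 t)] : set R)).
Proof.
apply: sq_intP; first by apply: measurable_indic; exact: measurable_itv.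
under eq_integral => x _.
  rewrite (_ : _ ^+ 2 = \1_([set` Interval (BSide b0 s) (BSide b1 t)] : set R) x).
  over.
  by rewrite indicE; case: (_ \in _); rewrite ?expr1n ?expr0n.
by rewrite integral_indic_itv; case: ifP => // _; exact: ltry.
Qed.
End lebesgue_indicator.

Section wiener_integral.
Context (R : realType) (d : measure_display) (Omega : measurableType d).
Context (P : probability Omega R).
Variable W : R -> {RV P >-> R}.
Hypothesis hW : wiener_process W.
Local Notation mu := (@lebesgue_measure R).

Definition increment (s t : R) (w : Omega) : R := W t w - W s w.

Lemma measurable_increment s t : measurable_fun setT (increment s t).
Proof. by apply: measurable_funB; exact: measurable_funPT. Qed.

Lemma increment_sq s t : 0 <= s -> s <= t ->
  (\int[P]_w ((increment s t w) ^+ 2)%:E = (t - s)%:E)%E.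
Proof.
move=> s0; rewrite le_eqVlt => /predU1P[->|st].
  by rewrite subrr integral0_eq// => w _; rewrite /increment subrr expr0n.
have [_ _ law _] := hW.
rewrite (gaussian_variance (measurable_increment s t) _ (law _ _ s0 st)).
  by rewrite sqr_sqrtr// subr_ge0 ltW.
by rewrite sqrtr_gt0 subr_gt0.
Qed.

Lemma increment_mean s t : 0 <= s -> s <= t -> \int[P]_w increment s t w = 0.
Proof.
move=> s0; rewrite le_eqVlt => /predU1P[->|st].
  rewrite /Rintegral integral0_eq// => w _; by rewrite /increment subrr.
have [_ _ law _] := hW.
rewrite (gaussian_mean (measurable_increment s t) _ (law _ _ s0 st))//.
by rewrite sqrtr_gt0 subr_gt0.
Qed.

Lemma increment_sq_int s t : 0 <= s -> s <= t -> sq_int P (increment s t).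
Proof.
move=> s0 st; apply: sq_intP; first exact: measurable_increment.
by rewrite increment_sq// ltry.
Qed.

Lemma increment_ip s t : 0 <= s -> s <= t -> ip P (increment s t) (increment s t) = t - s.
Proof.
move=> s0 st; apply: EFin_inj; rewrite -increment_sq// EFin_ip//.
exact: increment_sq_int.
Qed.

(** Uncorrelated increments: the variances of all increments determine their
    covariances by polarization. *)
Lemma increment_cov T s t : 0 <= s -> s <= t -> t <= T ->
  ip P (increment s t) (increment 0 T) = t - s.
Proof.
move=> s0 st tT; have t0 := le_trans s0 st; have T0 := le_trans t0 tT.
have start u : 0 <= u -> u <= T -> ip P (increment 0 u) (increment 0 T) = u.
  move=> u0 uT.
  have i0u := increment_sq_int (lexx 0) u0; have i0T := increment_sq_int (lexx 0) T0.
  have := ip_expand i0T i0u 1.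
  rewrite (_ : (fun w => increment 0 T w - 1 * increment 0 u w) = increment u T); last first.
    by apply/funext => w; rewrite /increment; ring.
  rewrite !increment_ip// (ipC _ (increment 0 T)); lra.
rewrite (_ : increment s t = (fun w => increment 0 t w - increment 0 s w)); last first.
  by apply/funext => w; rewrite /increment; ring.
by rewrite ipBl ?start ?(le_trans st)//; exact: increment_sq_int.
Qed.

Lemma integral_step_fun T m (t a : nat -> R) :
  {homo t : p q / (p <= q)%N >-> p <= q} -> (forall p, 0 <= t p <= T) ->
  sq_int mu ((step_fun m t a) \_ `[0, T]) /\
  ip mu ((step_fun m t a) \_ `[0, T]) (\1_`[0, T]) = \sum_(i < m) a i * (t i.+1 - t i).
Proof.
move=> ht tT.
pose J i : R -> R := \1_(`]t i, t i.+1]).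
have E : (step_fun m t a) \_ `[0, T] = (fun x => \sum_(i < m) a i * J i x).
  apply/funext => x; rewrite patchE; case: ifPn => // xT.
  rewrite big1// => i _; rewrite /J indicE memNset ?mulr0//= in_itv/=.
  move=> /andP[tx xt]; move: xT; rewrite notin_setE/= in_itv/=; apply.
  have /andP[t0 _] := tT i; have /andP[_ tT'] := tT i.+1.
  by rewrite (le_trans t0 (ltW tx)) (le_trans xt tT').
have sJ i : sq_int mu (J i) by exact: sq_int_indic_itv.
have s1 : sq_int mu (\1_`[0, T]) by exact: sq_int_indic_itv.
rewrite E; split; first by apply: sq_int_sum => i; exact: sq_intZ.
rewrite ip_suml//; last by move=> i; exact: sq_intZ.
apply: eq_bigr => i _; rewrite ipZl//; congr (_ * _).
rewrite /ip /Rintegral.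
transitivity (fine (\int[mu]_x (J i x)%:E)).
  congr fine; apply: eq_integral => x _; congr (_%:E).
  rewrite /J !indicE !mem_setE; case: (boolP (x \in `]_, _])) => [|_]; last by rewrite mul0r.
  rewrite in_itv/= => /andP[tx xt]; rewrite in_itv/=.
  have /andP[t0 _] := tT i; have /andP[_ tT'] := tT i.+1.
  by rewrite (le_trans t0 (ltW tx)) (le_trans xt tT') mulr1.
rewrite integral_indic_itv; case: ltP => //= tt; apply/esym/eqP; rewrite subr_eq0.
by apply/eqP/le_anti; rewrite tt ht.
Qed.

(** A Wiener integral is centered, and its covariance with the total increment
    of the path is the integral of the integrand: both pass to the limit from
    step functions by the Cauchy-Schwarz inequality. *)
Lemma wiener_integral_moments T (k : R -> R) (X : {RV P >-> R}) : 0 <= T ->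
  mu.-integrable `[0, T] (EFin \o k) ->
  is_wiener_integral W T k X ->
  [/\ sq_int P X, \int[P]_w X w = 0 &
      ip P X (increment 0 T) = \int[mu]_(x in `[0, T]) k x].
Proof.
move=> T0 ik [m [t [a [ht tT ck cX]]]].
pose S j := step_integral W (m j) (t j) (a j).
have sS j : sq_int P (S j).
  apply: sq_int_sum => i; apply: sq_intZ; apply: increment_sq_int.
    by have /andP[] := tT j i.
  exact: ht.
have s1 := sq_int_cst P 1.
have mX : measurable_fun setT X by exact: measurable_funPT.
pose D j w := X w - S j w.
have [j /= j1] : exists j, (\int[P]_w ((D j w) ^+ 2)%:E < 1%:E)%E.
  by have [N _ HN] := near_lt_cvg0 cX ltr01; exists N; apply: HN => /=.
have sDlt j' (e : R) : (\int[P]_w ((D j' w) ^+ 2)%:E < e%:E)%E -> sq_int P (D j').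
  move=> H; apply: sq_intP; last by rewrite (lt_trans H)// ltry.
  by apply: measurable_funB => //; have [] := sS j'.
have sX : sq_int P X.
  rewrite (_ : (X : Omega -> R) = (fun w => D j w + S j w)).
    by apply: sq_intD => //; exact: sDlt j1.
  by apply/funext => w; rewrite /D subrK.
have iZ : sq_int P (increment 0 T) by exact: increment_sq_int.
pose kT := k \_ `[0, T]; pose fT j := (step_fun (m j) (t j) (a j)) \_ `[0, T].
pose one := (\1_`[0, T]) : R -> R.
have sone : sq_int mu one by exact: sq_int_indic_itv.
have oneE : ip mu one one = T.
  rewrite /ip /Rintegral (_ : (\int[mu]_x _)%E = T%:E)//.
  under eq_integral => x _.
    rewrite (_ : one x * one x = one x); last first.
      by rewrite /one indicE; case: (_ \in _); rewrite ?mulr1 ?mulr0.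
    over.
  rewrite integral_indic_itv; case: ltP => [_|]; first by rewrite subr0.
  by move=> T0'; congr (_%:E); apply: le_anti; rewrite T0 T0'.
have mkT : measurable_fun setT kT.
  apply/(measurable_restrictT _ _).1; first exact: measurable_itv.
  by apply/measurable_EFinP; exact: measurable_int ik.
have E2 j' : (\int[mu]_(x in `[0%R, T])
   ((k x - step_fun (m j') (t j') (a j') x) ^+ 2)%:E = \int[mu]_x ((kT x - fT j' x) ^+ 2)%:E)%E.
  rewrite integral_mkcond; apply: eq_integral => x _.
  by rewrite /kT /fT !patchE; case: ifP => // _; rewrite subrr expr0n.
have bounds e : 0 < e -> exists j', [/\ sq_int P (D j'), ip P (D j') (D j') <= e,
    sq_int mu (fun x => kT x - fT j' x) &
    ip mu (fun x => kT x - fT j' x) (fun x => kT x - fT j' x) <= e].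
  move=> e0; have [N1 _ H1] := near_lt_cvg0 cX e0; have [N2 _ H2] := near_lt_cvg0 ck e0.
  exists (maxn N1 N2).
  have {}H1 := H1 _ (leq_maxl N1 N2); have {}H2 := H2 _ (leq_maxr N1 N2).
  have s1' := sDlt _ _ H1; rewrite /= E2 in H2.
  have s2' : sq_int mu (fun x => kT x - fT (maxn N1 N2) x).
    apply: sq_intP; last by rewrite (lt_trans H2)// ltry.
    apply: measurable_funB => //.
    by have [[]] := integral_step_fun (m (maxn N1 N2)) (a (maxn N1 N2)) (ht (maxn N1 N2)) (tT (maxn N1 N2)).
  split => //; rewrite -lee_fin -EFin_ip//; exact: ltW.
split => //.
- apply: (@sq_small_eq0 _ _ 1) => e e0; have [j' [sD De _ _]] := bounds e e0.
  have S0 : ip P (S j') (cst 1) = 0.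
    rewrite ip_suml//; last first.
      move=> i; apply: sq_intZ; apply: increment_sq_int; last exact: ht.
      by have /andP[] := tT j' i.
    apply: big1 => i _; have /andP[t0 _] := tT j' i.
    rewrite ipZl//; last by apply: increment_sq_int => //; exact: ht.
    by rewrite ip_cst1 increment_mean ?mulr0//; exact: ht.
  rewrite -ip_cst1 (_ : (X : Omega -> R) = (fun w => D j' w + S j' w)); last first.
    by apply/funext => w; rewrite /D subrK.
  rewrite ipDl// S0 addr0 mul1r; apply: le_trans (cauchy_schwarz sD s1) _.
  by rewrite ip_cst11 mulr1.
- apply/eqP; rewrite -subr_eq0; apply/eqP.
  apply: (@sq_small_eq0 _ _ (4 * T)) => e e0; have [j' [sD De sK Ke]] := bounds e e0.
  have [sf fE] := integral_step_fun (m j') (a j') (ht j') (tT j').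
  have SZ : ip P (S j') (increment 0 T) = ip mu (fT j') one.
    rewrite fE ip_suml//; last first.
      move=> i; apply: sq_intZ; apply: increment_sq_int; last exact: ht.
      by have /andP[] := tT j' i.
    apply: eq_bigr => i _; have /andP[t0 _] := tT j' i; have /andP[_ tT'] := tT j' i.+1.
    rewrite ipZl//; last by apply: increment_sq_int => //; exact: ht.
    by rewrite increment_cov//; exact: ht.
  have -> : \int[mu]_(x in `[0, T]) k x = ip mu (fun x => kT x - fT j' x) one + ip mu (fT j') one.
    rewrite -ipDl// /ip Rintegral_mkcond; apply: eq_Rintegral => x _.
    rewrite subrK /kT patchE /one indicE; case: ifP => _; first by rewrite mulr1.
    by rewrite mulr0.
  rewrite (_ : (X : Omega -> R) = (fun w => D j' w + S j' w)); last first.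
    by apply/funext => w; rewrite /D subrK.
  rewrite ipDl// SZ opprD addrACA subrr addr0.
  have c1 := cauchy_schwarz sD iZ; have c2 := cauchy_schwarz sK sone.
  rewrite increment_ip// subr0 in c1; rewrite oneE in c2.
  have d1 := ler_wpM2r T0 De; have d2 := ler_wpM2r T0 Ke.
  move: c1 c2 d1 d2; set u := ip P _ _; set v := ip mu _ _.
  move: (ip P _ _ * T) (ip mu _ _ * T) => p q c1 c2 d1 d2.
  have := sqr_ge0 (u + v); rewrite (mulrC _ e) mulrCA mulrA in d1 d2 *.
  nra.
Qed.
End wiener_integral.

(** * Boxes, open sets and Lebesgue measure in Euclidean space *)

Section euclidean_space.
Variables (R : realType) (n : nat).
Local Notation mu := (lebesgue_rV R n).

Lemma measurable_coord (i : 'I_n) : measurable_fun setT (fun x : 'rV[R]_n => x ord0 i).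
Proof.
move=> _ B mB; rewrite setTI.
suff : g_sigma_preimage (fun i (x : 'rV[R]_n) => x ord0 i) ((fun x : 'rV[R]_n => x ord0 i) @^-1` B) by [].
apply: sub_sigma_algebra; rewrite (bigD1 i)//=; left; exists B => //; by rewrite setTI.
Qed.

Definition rV_box (l u : 'I_n -> R) : set 'rV[R]_n :=
  \bigcap_(i in [set: 'I_n]) [set x | l i < x ord0 i < u i].

Definition closed_rV_box (l u : 'I_n -> R) : set 'rV[R]_n :=
  [set x | forall i, l i <= x ord0 i <= u i].

Lemma measurable_rV_box l u : measurable (rV_box l u).
Proof.
apply: fin_bigcap_measurable; first exact: finite_finset.
move=> i _.
have := measurable_coord i measurableT (measurable_itv `]l i, u i[).
rewrite setTI (_ : _ @^-1` _ = [set x : 'rV[R]_n | l i < x ord0 i < u i])//.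
Qed.

(** A countable family of boxes; open sets are unions of those whose closed box
    they contain. *)
Definition rat_box (p : {ffun 'I_n -> rat * rat}) : set 'rV[R]_n :=
  rV_box (fun i => ratr (p i).1) (fun i => ratr (p i).2).

Definition closed_rat_box (p : {ffun 'I_n -> rat * rat}) : set 'rV[R]_n :=
  closed_rV_box (fun i => ratr (p i).1) (fun i => ratr (p i).2).

Lemma rat_box_closed p : rat_box p `<=` closed_rat_box p.
Proof. by move=> x px i; have /andP[/ltW -> /ltW ->] := px i I. Qed.

Lemma open_rat_box (D : set 'rV[R]_n) x : open D -> D x ->
  exists2 p, rat_box p x & closed_rat_box p `<=` D.
Proof.
move=> oD Dx; have /nbhs_ballP[e /= e0 eD] : nbhs x D by exact: open_nbhs_nbhs.
have ql (i : 'I_n) : exists q : rat, x ord0 i - e < ratr q < x ord0 i.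
  have [|q] := @rat_in_itvoo R (x ord0 i - e) (x ord0 i); first by rewrite gtrBl.
  by rewrite in_itv; exists q.
have qu (i : 'I_n) : exists q : rat, x ord0 i < ratr q < x ord0 i + e.
  have [|q] := @rat_in_itvoo R (x ord0 i) (x ord0 i + e); first by rewrite ltrDl.
  by rewrite in_itv; exists q.
exists [ffun i => (sval (cid (ql i)), sval (cid (qu i)))].
  move=> i _ /=; rewrite ffunE/=; case: cid => q1 /= /andP[_ ->].
  by case: cid => q2 /= /andP[-> _].
move=> y yp; apply: eD; split => // i j.
have := yp j; rewrite ffunE/=; case: cid => q1 /= /andP[q1l q1u].
case: cid => q2 /= /andP[q2l q2u] /andP[y1 y2].
rewrite /ball/= !ord1 ltr_distlC; apply/andP; split.
  exact: lt_le_trans y1.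
exact: le_lt_trans q2u.
Qed.

Lemma open_measurable_rV (D : set 'rV[R]_n) : open D -> measurable D.
Proof.
move=> oD; pose F p := if `[< closed_rat_box p `<=` D >] then rat_box p else set0.
rewrite (_ : D = \bigcup_p F p).
  apply: countable_bigcupT_measurable => [|p]; first exact: countableP.
  by rewrite /F; case: ifP => // _; exact: measurable_rV_box.
apply/seteqP; split => [x Dx|x [p _]]; last first.
  by rewrite /F; case: asboolP => // pD px; exact: pD (rat_box_closed px).
have [p px pD] := open_rat_box oD Dx.
by exists p => //; rewrite /F asboolT.
Qed.

Lemma continuous_measurable_rV (f : 'rV[R]_n -> R) :
  continuous f -> measurable_fun setT f.
Proof.
move=> cf; apply: (measurability _ (RGenOpens.measurableE R)).
move=> _ [_ [a [b ->] <-]]; rewrite setTI; apply: open_measurable_rV.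
by move/continuousP : cf; apply; exact: interval_open.
Qed.

Definition tuple_of_rV (x : 'rV[R]_n) : n.-tuple R := [tuple x ord0 i | i < n].

Lemma measurable_tuple_of_rV : measurable_fun setT tuple_of_rV.
Proof.
apply/measurable_fun_tnthP => i.
rewrite (_ : _ \o _ = fun x : 'rV[R]_n => x ord0 i); first exact: measurable_coord.
by apply/funext => x /=; rewrite tnth_mktuple.
Qed.

Lemma rV_of_tupleK : cancel (@rV_of_tuple R n) tuple_of_rV.
Proof.
by move=> t; apply: eq_from_tnth => i; rewrite tnth_mktuple mxE.
Qed.

Lemma sigma_finite_lebesgue_rV : sigma_finite setT (lebesgue_rV R n).
Proof.
have [F TF mF] := sigma_finiteT (lebesgue_tuple R n).
exists (fun k => tuple_of_rV @^-1` F k).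
  apply/esym; rewrite -subTset => x _.
  have [k _ Fk] : (\bigcup_k F k) (tuple_of_rV x) by rewrite -TF.
  by exists k.
move=> k; have [mFk Fk] := mF k; split.
  by rewrite -[X in measurable X]setTI; exact: measurable_tuple_of_rV.
rewrite /lebesgue_rV /pushforward (_ : _ @^-1` _ = F k)//.
by apply/seteqP; split => t /=; rewrite rV_of_tupleK.
Qed.

End euclidean_space.

HB.instance Definition _ (R : realType) n := Measure_isSigmaFinite.Build _ _ _
  (lebesgue_rV R n) (@sigma_finite_lebesgue_rV R n).

Section euclidean_bounded.
Variable R : realType.

Definition tuple_box n (M : R) : set (n.-tuple R) :=
  [set t | forall i, `|tnth t i| <= M].
Arguments tuple_box : clear implicits.

Lemma measurable_tuple_box n M : measurable (tuple_box n M).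
Proof.
rewrite (_ : tuple_box n M =
    \bigcap_(i in [set: 'I_n]) (fun t : n.-tuple R => tnth t i) @^-1` `[- M, M]).
  apply: fin_bigcap_measurable; first exact: finite_finset.
  move=> i _; rewrite -[X in measurable X]setTI.
  by apply: measurable_tnth => //; exact: measurable_itv.
apply/seteqP; split => t /=.
  by move=> H i _ /=; rewrite in_itv/= -ler_norml H.
by move=> H i; have := H i I; rewrite /= in_itv/= -ler_norml.
Qed.

(** In dimension 0 the measure is a Dirac mass; each further coordinate
    contributes a factor of finite length. *)
Lemma lebesgue_tuple_box n M : (lebesgue_tuple R n (tuple_box n M) < +oo)%E.
Proof.
elim: n => [|n IH] /=.
  by rewrite diracE; case: (_ \in _); rewrite ltry.
have fin : lebesgue_measure (`[- M, M]%classic : set R) \is a fin_num.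
  by rewrite lebesgue_measure_itv/=; case: ifP.
rewrite /lebesgue_cons /pushforward.
rewrite (_ : _ @^-1` _ = `[- M, M]%classic `*` tuple_box n M).
  rewrite product_measure1E; [|exact: measurable_itv|exact: measurable_tuple_box].
  apply: lte_mul_pinfty; [by []| |exact: IH].
  exact: fin.
apply/seteqP; split => -[x t] /=.
  move=> H; split.
    by rewrite /= in_itv/= -ler_norml; have := H ord0; rewrite /tnth/=.
  move=> i /=; have := H (lift ord0 i).
  by rewrite /tuple_cons tnthS.
move=> [] /=; rewrite in_itv/= -ler_norml => Mx Ht i.
case: (unliftP ord0 i) => [j ->|->]; first by rewrite /tuple_cons tnthS; exact: Ht.
by rewrite /tuple_cons tnth0.
Qed.

Lemma coord_le_norm n (x : 'rV[R]_n) i : `|x ord0 i| <= `|x|.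
Proof.
rewrite [leRHS]/Num.norm/= mx_normrE.
by apply: (@le_trans _ _ `|x (ord0, i).1 (ord0, i).2|) => //; apply: le_bigmax.
Qed.

Lemma bounded_lebesgue_rV n (D : set 'rV[R]_n) : measurable D -> bounded_set D ->
  (lebesgue_rV R n D < +oo)%E.
Proof.
move=> mD [M [Mr HM]].
have {}HM x : D x -> `|x| <= M + 1 by apply: HM; rewrite ltrDl.
apply: le_lt_trans (lebesgue_tuple_box n (M + 1)).
rewrite /lebesgue_rV /pushforward; apply: le_measure.
- by rewrite inE -[X in measurable X]setTI; exact: measurable_rV_of_tuple.
- by rewrite inE; exact: measurable_tuple_box.
- move=> t /= Dt i; apply: le_trans (HM _ Dt).
  by apply: le_trans (coord_le_norm _ i); rewrite mxE.
Qed.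

End euclidean_bounded.

(** * Smooth functions and test functions *)

Section smooth_functions.
Variables (R : realType) (n : nat).
Implicit Types f g : 'rV[R]_n -> R.
Local Notation e_ i := (delta_mx ord0 i : 'rV[R]_n).

(** Continuously differentiable up to order [k] and once more differentiable
    in the coordinate directions; unlike [smooth], it can be proved by
    induction. *)
Fixpoint Ck (k : nat) f : Prop :=
  [/\ continuous f, forall i x, derivable f x (e_ i) &
      if k is k'.+1 then forall i, Ck k' (partial i f) else True].

Lemma Ck_cont k f : Ck k f -> continuous f. Proof. by case: k => [|k] []. Qed.

Lemma Ck_derivable k f i x : Ck k f -> derivable f x (e_ i).
Proof. by case: k => [|k] []. Qed.

Lemma CkS k f : Ck k.+1 f -> Ck k f.
Proof.
elim: k f => [|k IH] f [cf df pf]; first by split.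
by split => // i; apply: IH; exact: pf.
Qed.

Lemma smoothP f : smooth f <-> forall k, Ck k f.
Proof.
split=> [sf k|Cf s].
  suff : forall s, Ck k (foldr (@partial R n) f s) by move/(_ [::]).
  elim: k => [|k IH] s; have [? ?] := sf s; split => // i.
  exact: (IH (i :: s)).
suff H k : Ck k (foldr (@partial R n) f s).
  by split; [exact: Ck_cont (H 0%N)|move=> i x; exact: Ck_derivable (H 0%N)].
elim: s k => [|i s IH] k; first exact: Cf.
by have [_ _] := IH k.+1; exact.
Qed.

Lemma partialD i f g : (forall x, derivable f x (e_ i)) ->
  (forall x, derivable g x (e_ i)) ->
  partial i (fun x => f x + g x) = fun x => partial i f x + partial i g x.
Proof. by move=> df dg; apply/funext => x; exact: deriveD. Qed.

Lemma partialZ i a f : (forall x, derivable f x (e_ i)) ->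
  partial i (fun x => a * f x) = fun x => a * partial i f x.
Proof. by move=> df; apply/funext => x; exact: deriveZ. Qed.

Lemma partialM i f g : (forall x, derivable f x (e_ i)) ->
  (forall x, derivable g x (e_ i)) ->
  partial i (fun x => f x * g x) =
  fun x => f x * partial i g x + g x * partial i f x.
Proof. by move=> df dg; apply/funext => x; exact: deriveM. Qed.

Lemma Ck_intro k f : continuous f -> (forall i x, derivable f x (e_ i)) ->
  (forall i, if k is k'.+1 then Ck k' (partial i f) else True) -> Ck k f.
Proof. by case: k => [|k] cf df pf; split. Qed.

Lemma Ck_partial k f i : Ck k.+1 f -> Ck k (partial i f).
Proof. by move=> [_ _]; exact. Qed.

Lemma CkD k f g : Ck k f -> Ck k g -> Ck k (fun x => f x + g x).
Proof.
elim: k f g => [|k IH] f g Cf Cg; apply: Ck_intro; try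
  (by move=> x; apply: continuousD; [exact: (Ck_cont Cf)|exact: (Ck_cont Cg)]); try
  (by move=> i x; apply: derivableD; [exact: (Ck_derivable Cf)|exact: (Ck_derivable Cg)]).
  by [].
move=> i; rewrite (partialD (fun x => Ck_derivable Cf) (fun x => Ck_derivable Cg)).
by apply: IH; exact: Ck_partial.
Qed.

Lemma CkZ k a f : Ck k f -> Ck k (fun x => a * f x).
Proof.
elim: k f => [|k IH] f Cf; apply: Ck_intro; try
  (by move=> x; apply: continuousM; [exact: cst_continuous|exact: (Ck_cont Cf)]); try
  (by move=> i x; apply: derivableZ; exact: (Ck_derivable Cf)).
  by [].
move=> i; rewrite (partialZ _ (fun x => Ck_derivable Cf)).
by apply: IH; exact: Ck_partial.
Qed.

Lemma CkM k f g : Ck k f -> Ck k g -> Ck k (fun x => f x * g x).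
Proof.
elim: k f g => [|k IH] f g Cf Cg; apply: Ck_intro; try
  (by move=> x; apply: continuousM; [exact: (Ck_cont Cf)|exact: (Ck_cont Cg)]); try
  (by move=> i x; apply: derivableM; [exact: (Ck_derivable Cf)|exact: (Ck_derivable Cg)]).
  by [].
move=> i; rewrite (partialM (fun x => Ck_derivable Cf) (fun x => Ck_derivable Cg)).
by apply: CkD; apply: IH; [exact: CkS|exact: Ck_partial|exact: CkS|exact: Ck_partial].
Qed.

Lemma smoothD f g : smooth f -> smooth g -> smooth (fun x => f x + g x).
Proof. by move=> /smoothP Cf /smoothP Cg; apply/smoothP => k; exact: CkD. Qed.

Lemma smoothZ a f : smooth f -> smooth (fun x => a * f x).
Proof. by move=> /smoothP Cf; apply/smoothP => k; exact: CkZ. Qed.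

Lemma smoothM f g : smooth f -> smooth g -> smooth (fun x => f x * g x).
Proof. by move=> /smoothP Cf /smoothP Cg; apply/smoothP => k; exact: CkM. Qed.

Lemma smooth_partial i f : smooth f -> smooth (partial i f).
Proof. by move=> /smoothP Cf; apply/smoothP => k; have [_ _] := Cf k.+1; exact. Qed.

Lemma smooth_continuous f : smooth f -> continuous f.
Proof. by move=> /(_ [::])[]. Qed.

Lemma smooth_cst (a : R) : smooth (cst a : 'rV[R]_n -> R).
Proof.
have pE i b : partial i (cst b : 'rV[R]_n -> R) = cst 0.
  by apply/funext => x; exact: derive_cst.
apply/smoothP => k; elim: k a => [|k IH] a; apply: Ck_intro; try
  (by move=> x; exact: cst_continuous); try
  (by move=> i x; exact: derivable_cst); move=> i //.
by rewrite pE; exact: IH.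
Qed.

Section test_functions.
Variable D : set 'rV[R]_n.

Lemma test_function0 : test_function D (cst 0).
Proof.
split; first exact: smooth_cst.
by exists set0; split => //; exact: compact0.
Qed.

Lemma test_functionD f g : test_function D f -> test_function D g ->
  test_function D (fun x => f x + g x).
Proof.
move=> [sf [K [cK KD fK]]] [sg [L [cL LD gL]]]; split; first exact: smoothD.
exists (K `|` L); split; first exact: compactU.
  by move=> x [/KD|/LD].
by move=> x /not_orP[xK xL]; rewrite fK// gL// addr0.
Qed.

Lemma test_functionM a f : smooth a -> test_function D f ->
  test_function D (fun x => a x * f x).
Proof.
move=> sa [sf [K [cK KD fK]]]; split; first exact: smoothM.
by exists K; split => // x xK; rewrite fK// mulr0.
Qed.

Lemma test_functionZ (a : R) f : test_function D f ->
  test_function D (fun x => a * f x).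
Proof.
move=> [sf [K [cK KD fK]]]; split; first exact: smoothZ.
by exists K; split => // x xK; rewrite fK// mulr0.
Qed.

Lemma test_function_partial i f : test_function D f -> test_function D (partial i f).
Proof.
move=> [sf [K [cK KD fK]]]; split; first exact: smooth_partial.
exists K; split => // x xK.
have oK : open (~` K).
  by apply: closed_openC; apply: compact_closed => //; exact: norm_hausdorff.
transitivity ('D_(e_ i) (cst 0 : 'rV[R]_n -> R) x); last exact: derive_cst.
apply: near_eq_derive.
have : nbhs x (~` K) by exact: open_nbhs_nbhs.
by apply: filterS => y yK; rewrite fK.
Qed.

Lemma test_function_mderive b f : test_function D f -> test_function D (mderive b f).
Proof.
move=> tf; rewrite /mderive; elim: (enum 'I_n) => [//|i s IH] /=.
by elim: (b i) => [//|k IHk] /=; exact: test_function_partial.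
Qed.

Hypotheses (Dopen : open D) (Dbounded : bounded_set D).
Local Notation mu := (lebesgue_rV R n).

Lemma test_function_restrict f : test_function D f -> f \_ D = f.
Proof.
move=> [_ [K [_ KD fK]]]; apply/funext => x; rewrite patchE; case: ifPn => //.
by rewrite notin_setE => Dx; rewrite fK// => /KD.
Qed.

Lemma continuous_bounded_on f (A : set 'rV[R]_n) : continuous f -> compact A ->
  exists2 M, 0 <= M & forall x, A x -> `|f x| <= M.
Proof.
move=> cf cA; have [A0|/set0P A0] := eqVneq A set0.
  by exists 0 => // x; rewrite A0.
have cnf : {within A, continuous (fun x => `|f x|)}.
  apply: continuous_subspaceT => x.
  exact: (continuous_comp (cf x) (@norm_continuous _ _ _)).
have [c _ Hc] := EVT_max_rV A0 cA cnf.
by exists `|f c| => // x Ax; apply: Hc; rewrite inE.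
Qed.

Lemma smooth_bounded f : smooth f -> exists2 M, 0 <= M & forall x, D x -> `|f x| <= M.
Proof.
move=> sf; have [M [Mr HM]] := Dbounded.
have {}HM x : D x -> `|x| <= M + 1 by apply: HM; rewrite ltrDl.
have [||B B0 HB] := @continuous_bounded_on f [set x | `|x| <= M + 1].
- exact: smooth_continuous.
- apply: bounded_closed_compact.
    by exists (M + 1); split; [rewrite realD// real1|move=> y My x /=; move/le_trans; apply; exact: ltW].
  apply: (@closed_comp _ _ (fun x : 'rV[R]_n => `|x|) [set y | y <= M + 1]).
    by move=> x _; exact: norm_continuous.
  exact: closed_le.
- by exists B => // x /HM; exact: HB.
Qed.

Lemma test_function_sq_int f : test_function D f -> sq_int mu (f \_ D).
Proof.
move=> tf; rewrite test_function_restrict//.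
have mD := open_measurable_rV Dopen.
have [sf [K [cK KD fK]]] := tf.
have mf : measurable_fun setT f.
  by apply: continuous_measurable_rV; exact: smooth_continuous.
have [M M0 HM] := continuous_bounded_on (smooth_continuous sf) cK.
apply: sq_intP => //.
apply: (@le_lt_trans _ _ (\int[mu]_(x in D) (cst (M ^+ 2)%:E x))%E); last first.
  rewrite integral_cst//; apply: lte_mul_pinfty; rewrite ?lee_fin ?sqr_ge0//.
  exact: bounded_lebesgue_rV.
rewrite [leRHS]integral_mkcond; apply: ge0_le_integral => //.
- by move=> x _; rewrite lee_fin sqr_ge0.
- by apply/measurable_EFinP; exact: measurable_funX.
- apply/(measurable_restrictT _ _).1 => //; exact: measurable_cst.
- move=> x _; rewrite patchE; case: ifPn => [_|].
    rewrite lee_fin -[f x ^+ 2]real_normK ?num_real// lerXn2r ?nnegrE//.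
    by have [/HM//|/fK ->] := pselect (K x); rewrite normr0.
  by rewrite notin_setE => Dx; rewrite fK ?expr0n// => /KD.
Qed.
End test_functions.
End smooth_functions.

(** * Bump functions *)

Section flat_functions.
Variable R : realType.

(** The whole family is needed because it is closed under differentiation, up to
    linear combinations (flat_derive): smoothness is then an induction. *)
Definition flat (m : nat) (t : R) : R :=
  if 0 < t then t ^- m * expR (- t^-1) else 0.

Lemma flat_ge0 m t : 0 <= flat m t.
Proof.
rewrite /flat; case: ifPn => // t0.
by rewrite mulr_ge0 ?expR_ge0// invr_ge0 exprn_ge0// ltW.
Qed.

Lemma flatS m (t : R) : 0 < t -> t * flat m.+1 t = flat m t.
Proof.
move=> t0; rewrite /flat t0 exprS invfM mulrA (mulrA t) divff ?mul1r//.
by rewrite gt_eqF.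
Qed.

(** The exponential series dominates every power of [1 / t]. *)
Lemma flat_le_linear m : exists2 C : R, 0 <= C & forall t, flat m t <= C * `|t|.
Proof.
exists (m.+1`!%:R) => // t; rewrite /flat; case: ifPn => [t0|]; last by rewrite mulr_ge0.
have ti : 0 <= t^-1 by rewrite invr_ge0 ltW.
have := expR_ge1Dxn m ti; rewrite exprVn => H.
have {}H : t ^- m.+1 <= m.+1`!%:R * expR t^-1.
  rewrite -ler_pdivrMl ?ltr0n ?fact_gt0// mulrC; apply: le_trans H; lra.
rewrite expRN ler_pdivrMr ?expR_gt0// gtr0_norm//.
have -> : t ^- m = t * t ^- m.+1.
  by rewrite exprS invfM mulrA divff ?mul1r// gt_eqF.
by rewrite (mulrC _ t) -(mulrA t) ler_pM2l.
Qed.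

(** Away from 0 this is calculus; at 0 the difference quotient of [flat m] is
    [flat m.+1], which flat_le_linear sends to 0. *)
Lemma flat_derive m (t : R) :
  is_derive t (1 : R) (flat m) (- m%:R * flat m.+1 t + flat m.+2 t).
Proof.
have [t0|t0|->] := ltgtP t 0.
- rewrite /flat !(lt_gtF t0) mulr0 addr0.
  apply: (@near_eq_is_derive _ _ _ (cst 0)).
  by near=> y; rewrite ifF//; apply/negbTE; rewrite -leNgt ltW//; near: y; apply: lt_nbhsl.
- have tn : t != 0 by rewrite gt_eqF.
  apply: (@near_eq_is_derive _ _ _ (fun t : R => t ^- m * expR (- t^-1))).
    by near=> y; rewrite /flat ifT//; near: y; apply: lt_nbhsr.
  have iE : is_derive t (1 : R) (fun t : R => expR (- t^-1)) (expR (- t^-1) * t ^- 2).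
    have iV : is_derive t (1 : R) (fun t : R => - t^-1) (- (- t ^- 2 *: (1 : R))).
      by apply: is_deriveN; exact: is_deriveV.
    have := is_derive1_comp (is_derive_expR _) iV.
    by rewrite /GRing.scale/= mulr1 opprK.
  have iX : is_derive t (1 : R) (fun t : R => t ^- m) (- m%:R * t ^- m.+1).
    have tm : (t ^+ m) != 0 by rewrite expf_neq0.
    have iid : is_derive t (1 : R) (fun t : R => t) 1 by exact: is_derive_id.
    have iP : is_derive t (1 : R) (fun t : R => t ^+ m) ((m%:R * t ^+ m.-1) *: (1 : R)).
      by have := is_deriveX m iid; rewrite (_ : id ^+ m = fun t : R => t ^+ m)//; apply/funext => y; rewrite fctE.
    have := is_deriveV (f := fun t : R => t ^+ m) tm iP.
    move=> /is_derive_eq; apply.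
    rewrite /GRing.scale/= mulr1; case: (m) => [|k]; first by rewrite mul0r mulr0 oppr0 mul0r.
    rewrite /= !exprS expr0; field; rewrite tn/= expf_neq0//.
  apply: (is_derive_eq (is_deriveM iX iE)).
  rewrite /GRing.scale/= /flat t0 !exprS expr0; field; rewrite tn/= expf_neq0//.
- rewrite /flat ltxx mulr0 addr0.
  have [C C0 HC] := flat_le_linear m.+1.
  have H : (fun h : R => h^-1 *: (flat m (h *: 1 + 0) - flat m 0)) @ 0^' --> (0 : R).
    apply/cvgrPdist_le => e e0.
    exists (e / (C + 1)); first by rewrite /= divr_gt0// ltr_wpDl.
    move=> h /=; rewrite sub0r normrN => he hn.
    rewrite scaler1 addr0 {2}/flat ltxx subr0 sub0r normrN.
    apply: (@le_trans _ _ (flat m.+1 h)).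
      case: (ltgtP h 0) hn => // h0 _.
        by rewrite /flat !(lt_gtF h0) scaler0 normr0.
      by rewrite -flatS// scalerA mulVf ?gt_eqF// scale1r ger0_norm ?flat_ge0.
    apply: le_trans (HC h) _.
    move: he; rewrite ltr_pdivlMr ?ltr_wpDl//; have := normr_ge0 h; nra.
  apply: DeriveDef.
    by apply/cvg_ex; exists 0; exact: H.
  exact/cvg_lim.
Unshelve. all: end_near. Qed.

End flat_functions.

Section bump_functions.
Variables (R : realType) (n : nat).
Local Notation e_ i := (delta_mx ord0 i : 'rV[R]_n).

(** Along a coordinate direction the function only sees a line, with speed [al]
    or 0. *)
Lemma flat_affine_derive m (al be : R) i (j : 'I_n) (x : 'rV[R]_n) :
  is_derive x (e_ j) (fun x : 'rV[R]_n => flat m (al * x ord0 i + be))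
    (al * (i == j)%:R * (- m%:R * flat m.+1 (al * x ord0 i + be) +
                         flat m.+2 (al * x ord0 i + be))).
Proof.
set t := al * x ord0 i + be; set w := al * _.
have [D1 V1] := flat_derive m t.
have df : differentiable (flat m : R -> R) t by apply/derivable1_diffP.
have D2 : derivable (flat m : R -> R) t w by exact: diff_derivable.
have V2 : 'D_w (flat m : R -> R) t = w * (- m%:R * flat m.+1 t + flat m.+2 t).
  by rewrite (deriveE w df) (diff1E df) derive1E V1.
have E : (fun h : R => h^-1 *: (flat m (al * (h *: e_ j + x) ord0 i + be) - flat m t)) =
  (fun h => h^-1 *: (((flat m : R -> R) \o shift t) (h *: w) - flat m t)).
  apply/funext => h; congr (_ *: (flat m _ - _)).
  rewrite /shift/= !mxE eqxx/= /t /w /GRing.scale/= ; ring.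
by split; rewrite -?V2 /derivable /derive /= E.
Qed.

Lemma flat_affine_Ck k m (al be : R) i :
  Ck k (fun x : 'rV[R]_n => flat m (al * x ord0 i + be)).
Proof.
elim: k m => [|k IH] m; apply: Ck_intro.
- move=> x.
  have ct : {for (al * x ord0 i + be), continuous (flat m : R -> R)}.
    by apply: differentiable_continuous; apply/derivable1_diffP; case: (flat_derive m (al * x ord0 i + be)).
  apply: (@continuous_comp _ _ _ (fun x : 'rV[R]_n => al * x ord0 i + be) (flat m : R -> R) x _ ct).
  apply: continuousD; last exact: cst_continuous.
  by apply: continuousM; [exact: cst_continuous|exact: coord_continuous].
- by move=> j x; case: (flat_affine_derive m al be i j x).
- by [].
- by apply: Ck_cont (IH m).
- by move=> j x; case: (flat_affine_derive m al be i j x).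
- move=> j; rewrite (_ : partial j _ = fun x : 'rV[R]_n => al * (i == j)%:R * (- m%:R * flat m.+1 (al * x ord0 i + be) + flat m.+2 (al * x ord0 i + be))).
    by apply/CkZ/CkD => //; exact: CkZ.
  by apply/funext => x; case: (flat_affine_derive m al be i j x).
Qed.

End bump_functions.

(** * The fundamental lemma of the calculus of variations *)

Section box_generation.
Variables (R : realType) (n : nat).

Definition rV_boxes : set (set 'rV[R]_n) :=
  [set A | exists l u : 'I_n -> R, A = rV_box l u].

Lemma rV_boxI (l u l' u' : 'I_n -> R) : rV_box l u `&` rV_box l' u' =
  rV_box (fun i => Num.max (l i) (l' i)) (fun i => Num.min (u i) (u' i)).
Proof.
apply/seteqP; split => [x [B1 B2] i _ /=|x B].
  have /= := B1 i I; have /= := B2 i I; rewrite gt_max lt_min.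
  by move=> /andP[-> ->] /andP[-> ->].
by split => i _ /=; have /= := B i I; rewrite gt_max lt_min => /andP[/andP[? ?] /andP[? ?]];
  apply/andP.
Qed.

Lemma rV_boxes_setI : setI_closed rV_boxes.
Proof.
move=> _ _ [l [u ->]] [l' [u' ->]]; rewrite rV_boxI.
by exists (fun i => Num.max (l i) (l' i)), (fun i => Num.min (u i) (u' i)).
Qed.

(** A slab bounding one coordinate is the union of boxes that are large in the
    other coordinates. *)
Lemma measurable_boxes : @measurable _ 'rV[R]_n = <<s rV_boxes >>.
Proof.
apply/seteqP; split; last first.
  apply: smallest_sub; first exact: sigma_algebra_measurable.
  by move=> _ [l [u ->]]; exact: measurable_rV_box.
have mcoord i : measurable_fun setT
    ((fun x : 'rV[R]_n => x ord0 i) : g_sigma_algebraType rV_boxes -> R).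
  apply: (measurability _ (RGenOpens.measurableE R)).
  move=> _ [_ [a [b ->] <-]]; rewrite setTI.
  rewrite (_ : _ @^-1` _ = \bigcup_k rV_box (fun j => if j == i then a else - k%:R) (fun j => if j == i then b else k%:R)).
    apply: bigcup_measurable => k _; apply: sub_sigma_algebra.
    by eexists; eexists.
  apply/seteqP; split => x /=.
    rewrite in_itv/= => abx.
    exists (Num.bound `|x|) => // j _ /=; case: eqP => [->//|_].
    rewrite -ltr_norml; apply: le_lt_trans (coord_le_norm x j) _.
    exact: archi_boundP.
  by move=> [k _ /(_ i I)/=]; rewrite eqxx in_itv.
change (<<s \big[setU/set0]_(i < n) preimage_set_system setT (fun x : 'rV[R]_n => x ord0 i) measurable >> `<=` <<s rV_boxes >>).
apply: smallest_sub; first exact: smallest_sigma_algebra.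
move=> A; rewrite -bigcup_seq.
move=> [i _ [B mB <-]].
by have := mcoord i measurableT B mB.
Qed.

End box_generation.

Section bump_box.
Variables (R : realType) (n : nat).
Local Notation mu := (lebesgue_rV R n).
Implicit Types (l u : 'I_n -> R).

(** As [j] grows the flanks steepen, and the bumps increase to the indicator of
    the open box. *)
Definition bump l u (j : nat) (x : 'rV[R]_n) : R :=
  \prod_i (flat 0 (j%:R * (x ord0 i - l i)) * flat 0 (j%:R * (u i - x ord0 i))).

Lemma smooth_prod (I : Type) (s : seq I) (F : I -> 'rV[R]_n -> R) :
  (forall i, smooth (F i)) -> smooth (fun x => \prod_(i <- s) F i x).
Proof.
move=> sF; elim: s => [|i s IH].
  rewrite (_ : (fun _ => _) = cst 1); first exact: smooth_cst.
  by apply/funext => x; rewrite big_nil.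
rewrite (_ : (fun _ => _) = fun x => F i x * \prod_(j <- s) F j x).
  exact: (@smoothM _ _ (F i) _ (sF i) IH).
by apply/funext => x; rewrite big_cons.
Qed.

Lemma smooth_bump l u j : smooth (bump l u j).
Proof.
apply: smooth_prod => i; apply: smoothM; apply/smoothP => k.
  rewrite (_ : (fun _ => _) = fun x : 'rV[R]_n => flat 0 (j%:R * x ord0 i + - (j%:R * l i))).
    exact: flat_affine_Ck.
  by apply/funext => x; rewrite mulrBr.
rewrite (_ : (fun _ => _) = fun x : 'rV[R]_n => flat 0 (- j%:R * x ord0 i + j%:R * u i)).
  exact: flat_affine_Ck.
by apply/funext => x; rewrite mulrBr addrC mulNr.
Qed.

Lemma flat_le0 m (t : R) : t <= 0 -> flat m t = 0.
Proof. by move=> t0; rewrite /flat ltNge t0. Qed.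

Lemma bump_out l u j x : ~ rV_box l u x -> bump l u j x = 0.
Proof.
move=> /existsNP[i /not_implyP[_ /= /negP]].
rewrite negb_and -!leNgt => H; rewrite /bump (bigD1 i)//=.
case/orP : H => H; [rewrite (@flat_le0 _ (_ * (x ord0 i - _)))|rewrite (@flat_le0 _ (_ * (u i - _)))].
all: by rewrite ?(mul0r,mulr0)// mulr_ge0_le0// subr_le0.
Qed.

Lemma test_function_bump (D : set 'rV[R]_n) l u j :
  closed_rV_box l u `<=` D -> test_function D (bump l u j).
Proof.
move=> KD; split; first exact: smooth_bump.
exists (closed_rV_box l u); split => //.
  have := @rV_compact R n (fun i => `[l i, u i]%classic) (fun i => @segment_compact _ (l i) (u i)).
  rewrite (_ : [set _ | _] = closed_rV_box l u)//.
move=> x H; apply: bump_out => B; apply: H => i.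
by have /andP[/ltW -> /ltW ->] := B i I.
Qed.

Lemma flat0_le1 (t : R) : flat 0 t <= 1.
Proof.
rewrite /flat; case: ifPn => // t0; rewrite expr0 invr1 mul1r -expR0 ler_expR.
by rewrite oppr_le0 invr_ge0 ltW.
Qed.

Lemma bump_itv l u j x : 0 <= bump l u j x <= 1.
Proof.
apply/andP; split; first by apply: prodr_ge0 => i _; rewrite mulr_ge0 ?flat_ge0.
by apply: prodr_ile1 => i _; rewrite mulr_ge0 ?flat_ge0//= mulr_ile1 ?flat_ge0 ?flat0_le1.
Qed.

Lemma flat0_cvg (t : R) : 0 < t -> flat 0 (j%:R * t) @[j --> \oo] --> (1 : R).
Proof.
move=> t0.
have H : expR (- (t^-1 * j.+1%:R^-1)) @[j --> \oo] --> (1 : R).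
  have H0 : - (t^-1 * j.+1%:R^-1) @[j --> \oo] --> (0 : R).
    rewrite -oppr0; apply: cvgN; rewrite -(mulr0 t^-1); apply: cvgMr.
    exact: cvg_harmonic.
  by have := cvg_comp _ _ H0 (@continuous_expR R 0); rewrite expR0; exact.
rewrite -(cvg_shiftS (fun j => flat 0 (j%:R * t)))/=.
apply: cvg_trans H; apply: near_eq_cvg; near=> j.
by rewrite /flat mulr_gt0// expr0 invr1 mul1r invfM mulrC.
Unshelve. all: end_near. Qed.

Lemma bump_cvg l u x : rV_box l u x -> bump l u j x @[j --> \oo] --> (1 : R).
Proof.
move=> B; rewrite /bump; elim: (index_enum 'I_n) => [|i s IH].
  by under eq_fun do rewrite big_nil; exact: cvg_cst.
under eq_fun do rewrite big_cons.
have /andP[xl xu] := B i I.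
have H1 : 0 < x ord0 i - l i by rewrite subr_gt0.
have H2 : 0 < u i - x ord0 i by rewrite subr_gt0.
by have := cvgM (cvgM (flat0_cvg H1) (flat0_cvg H2)) IH; rewrite !mulr1; exact.
Qed.

End bump_box.

Section fundamental_lemma.
Variables (R : realType) (n : nat) (D : set 'rV[R]_n) (v : 'rV[R]_n -> R).
Local Notation mu := (lebesgue_rV R n).
Hypothesis iv : mu.-integrable setT (EFin \o v).
Hypothesis v0 : forall f, test_function D f -> \int[mu]_x (v x * f x) = 0.

Let mv : measurable_fun setT v.
Proof. by apply/measurable_EFinP; case/integrableP : iv. Qed.

(** The bumps of the box are test functions that converge to its indicator, so
    dominated convergence applies. *)
Lemma integral_box_eq0 (l u : 'I_n -> R) : closed_rV_box l u `<=` D ->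
  (\int[mu]_(x in rV_box l u) (v x)%:E = 0)%E.
Proof.
move=> KD.
have mb j : measurable_fun setT (bump l u j).
  by apply: continuous_measurable_rV; apply: smooth_continuous; exact: smooth_bump.
pose F j (x : 'rV[R]_n) := (v x * bump l u j x)%:E.
have dom j x : (`|F j x| <= `|(v x)%:E|)%E.
  rewrite /F !abse_EFin lee_fin normrM ler_piMr//.
  by have /andP[b0 b1] := bump_itv l u j x; rewrite ger0_norm.
have mF j : measurable_fun setT (F j).
  by apply/measurable_EFinP; exact: measurable_funM.
have iF j : mu.-integrable setT (F j).
  exact: (le_integrable measurableT (mF j) (fun x _ => dom j x) iv).
have IF0 j : (\int[mu]_x F j x = 0)%E.
  rewrite -[LHS]fineK; last exact: integrable_fin_num.
  by have := v0 (test_function_bump j KD); rewrite /Rintegral => ->.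
have mR : measurable_fun setT ((EFin \o v) \_ (rV_box l u)).
  apply/(measurable_restrictT _ _).1; first exact: measurable_rV_box.
  by apply: measurable_funS (measurableT) _ _ => //; exact/measurable_EFinP.
have cF : {ae mu, forall x, setT x -> F j x @[j --> \oo] --> ((EFin \o v) \_ (rV_box l u)) x}.
  apply: aeW => x _; rewrite patchE; case: ifPn => [|].
    rewrite inE => Bx; rewrite /F /comp -[v x in X in _ --> X]mulr1.
    apply: cvg_EFin; first by near=> j.
    by apply: cvgM; [exact: cvg_cst|exact: bump_cvg].
  rewrite notin_setE => Bx; rewrite /F.
  by under eq_fun do rewrite bump_out// mulr0; exact: cvg_cst.
have [|_ _] := dominated_convergence measurableT mF mR cF (integrable_abse iv).
  by apply: aeW => x j _; exact: dom.
under eq_fun do rewrite /= IF0.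
move=> /cvg_lim H; rewrite integral_mkcond -H//.
by rewrite lim_cst.
Unshelve. all: end_near. Qed.

(** Boxes are stable under intersection and generate the measurable sets, so the
    integral of [v] vanishes over every measurable part of the box. *)
Lemma fundamental_lemma_box (l u : 'I_n -> R) : closed_rV_box l u `<=` D ->
  {ae mu, forall x, rV_box l u x -> v x = 0}.
Proof.
move=> KD; set Q := rV_box l u.
have mQ : measurable Q by exact: measurable_rV_box.
have ivQ : mu.-integrable Q (EFin \o v).
  exact: integrableS iv.
have H S : measurable S -> (\int[mu]_(x in Q `&` S) (v x)%:E = 0)%E.
  rewrite measurable_boxes.
  apply: (dynkin_induction (measurable_boxes R n) (@rV_boxes_setI R n) (P := fun S => (\int[mu]_(x in Q `&` S) (v x)%:E = 0)%E)).
  - by rewrite setIT; exact: integral_box_eq0.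
  - move=> _ [l' [u' ->]]; rewrite rV_boxI; apply: integral_box_eq0.
    move=> x xc; apply: KD => i; have /andP[] := xc i.
    by rewrite ge_max le_min => /andP[-> _] /andP[-> _].
  - move=> A mA A0.
    have := integral_box_eq0 KD; rewrite -/Q -[in X in X = _ -> _](setIT Q) -(setUv A) setIUr.
    rewrite integral_setU.
    + by rewrite A0 add0e.
    + exact: measurableI.
    + by apply: measurableI => //; exact: measurableC.
    + apply: measurable_funS (measurableT) _ _ => //; exact/measurable_EFinP.
    + by apply/disj_setPS => x [[_ ?] [_ ?]].
  - move=> F mF tF F0; rewrite setI_bigcupr integral_bigcup//.
    + by apply: eseries0 => k _ _; exact: F0.
    + exact: trivIset_setIl.
    + by move=> k; exact: measurableI.
    + apply: integrableS iv => //; apply: bigcup_measurable => k _.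
      exact: measurableI.
have : ae_eq mu Q (EFin \o v) (cst 0%E).
  apply: integral_ae_eq => //.
  move=> E EQ mE; rewrite integral0 -(H E mE); congr (integral _ _ _).
  by rewrite setIC; apply/esym/setIidl.
by apply: filterS => x /= /[apply] -[].
Qed.

Hypothesis oD : open D.

Lemma fundamental_lemma : {ae mu, forall x, D x -> v x = 0}.
Proof.
have : {ae mu, forall x, forall k (p : {ffun 'I_n -> rat * rat}),
    unpickle k = Some p -> closed_rat_box p `<=` D -> rat_box p x -> v x = 0}.
  apply: ae_foralln => k; case: (unpickle k) => [p|]; last exact: aeW.
  have [KD|KD] := pselect (closed_rat_box p `<=` D); last first.
    by apply: aeW => x q [<-] /KD.
  by have := fundamental_lemma_box KD; apply: filterS => x /= H q [<-].
apply: filterS => x H Dx; have [p px pD] := open_rat_box oD Dx.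
by apply: (H (pickle p) p) => //; rewrite pickleK.
Qed.

End fundamental_lemma.

(** * Weak derivatives and density of test functions *)

Section weak_derivatives.
Variables (R : realType) (n : nat) (D : set 'rV[R]_n).
Hypotheses (oD : open D) (bD : bounded_set D).
Local Notation mu := (lebesgue_rV R n).
Implicit Types (u v w : 'rV[R]_n -> R).

Let mD : measurable D := open_measurable_rV oD.

Lemma L2dotE u v : L2dot D u v = ip mu (u \_ D) (v \_ D).
Proof.
rewrite /L2dot Rintegral_mkcond; apply: eq_Rintegral => x _.
by rewrite !patchE; case: ifP => //; rewrite mul0r.
Qed.

Lemma L2dotC u v : L2dot D u v = L2dot D v u.
Proof. by rewrite !L2dotE ipC. Qed.

Lemma L2_sq_int u : L2 D u -> sq_int mu (u \_ D).
Proof. exact: sq_int_Lfun. Qed.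

Lemma L2norm_sqr u : L2 D u -> (L2norm D u ^+ 2 = (ip mu (u \_ D) (u \_ D))%:E)%E.
Proof. by move=> Lu; rewrite /L2norm Lnorm2_sqr EFin_ip//; exact: L2_sq_int. Qed.

Lemma restrictD u v : (fun x => u x + v x) \_ D = fun x => (u \_ D) x + (v \_ D) x.
Proof. by apply/funext => x; rewrite !patchE; case: ifP => // _; rewrite addr0. Qed.

Lemma restrictZ (a : R) u : (fun x => a * u x) \_ D = fun x => a * (u \_ D) x.
Proof. by apply/funext => x; rewrite !patchE; case: ifP => // _; rewrite mulr0. Qed.

Lemma restrictB u v : (fun x => u x - v x) \_ D = fun x => (u \_ D) x - (v \_ D) x.
Proof. by apply/funext => x; rewrite !patchE; case: ifP => // _; rewrite subr0. Qed.

Lemma restrict_sum (I : Type) (s : seq I) (F : I -> 'rV[R]_n -> R) :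
  (fun x => \sum_(i <- s) F i x) \_ D = fun x => \sum_(i <- s) (F i \_ D) x.
Proof.
apply/funext => x; rewrite patchE; case: ifPn => xD.
  by apply: eq_bigr => i _; rewrite patchE xD.
by rewrite big1// => i _; rewrite patchE (negbTE xD).
Qed.

Lemma sq_int_integrable u : sq_int mu (u \_ D) -> mu.-integrable setT (EFin \o (u \_ D)).
Proof.
move=> su.
have s1 : sq_int mu (\1_D : 'rV[R]_n -> R).
  apply: sq_intP; first exact: measurable_indic.
  rewrite (eq_integral (EFin \o \1_D)); last first.
    by move=> x _ /=; rewrite indicE; case: (_ \in _); rewrite ?expr1n ?expr0n.
  rewrite integral_indic// setIT; exact: bounded_lebesgue_rV.
have := integrable_mul su s1.
apply: eq_integrable => // x _ /=; rewrite patchE indicE.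
by case: (_ \in _); rewrite ?mulr1 ?mulr0.
Qed.

Lemma weak_deriveP k u b : sobolev k D u -> (morder b <= k)%N ->
  is_weak_derive D b u (weak_derive D b u).
Proof. by move=> [_ /(_ b)] + bk => /(_ bk); exact: xgetPex. Qed.

Lemma morder0 : morder (fun _ : 'I_n => 0%N) = 0%N.
Proof. by rewrite /morder big1. Qed.

Lemma mderive0 u : mderive (fun _ : 'I_n => 0%N) u = u.
Proof. by rewrite /mderive; elim: (enum 'I_n). Qed.

(** The weak derivative of order zero pairs with test functions like the function
    itself, hence equals it almost everywhere by the fundamental lemma. *)
Lemma weak_derive0_ip k u : sobolev k D u ->
  ip mu (weak_derive D (fun=> 0%N) u \_ D) (weak_derive D (fun=> 0%N) u \_ D) = ip mu (u \_ D) (u \_ D).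
Proof.
move=> Su; have [|Lw Hw] := @weak_deriveP _ _ (fun=> 0%N) Su; first by rewrite morder0.
set w := weak_derive _ _ _ in Lw Hw *.
have sw := L2_sq_int Lw; have su := L2_sq_int Su.1.
have sd := sq_intB su sw.
have : {ae mu, forall x, D x -> (u \_ D) x - (w \_ D) x = 0}.
  apply: fundamental_lemma => //.
    by have := @sq_int_integrable (fun x => u x - w x); rewrite restrictB; exact.
  move=> f tf; rewrite -[LHS]/(ip mu _ f).
  have sf := test_function_sq_int oD bD tf.
  rewrite -(test_function_restrict tf) (ipBl su sw sf) -!L2dotE.
  have := Hw f tf; rewrite mderive0 morder0 expr0 mul1r => ->.
  by rewrite subrr.
move=> H; rewrite /ip /Rintegral; congr fine.
have [[mu' _] [mw' _]] := (su, sw).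
apply: ae_eq_integral => //.
- by apply/measurable_EFinP; exact: measurable_funM.
- by apply/measurable_EFinP; exact: measurable_funM.
apply: filterS H => x H _; have [Dx|Dx] := pselect (D x).
  by rewrite -(subr0_eq (H Dx)).
by rewrite !patchE memNset.
Qed.

(** The squared norm is a sum over multi-indices with entries at most [k], among
    which every multi-index of order at most [k] occurs. *)
Lemma weak_derive_sobolev k b u : (morder b <= k)%N ->
  (L2norm D (weak_derive D b u) ^+ 2 <= sobolev_norm2 k D u)%E.
Proof.
move=> bk; rewrite /sobolev_norm2; case: asboolP => Su; last by rewrite leey.
pose c : {ffun 'I_n -> 'I_k.+1} := [ffun i => inord (b i)].
have cE : (fun i => c i : nat) = b.
  apply/funext => i; rewrite ffunE inordK// ltnS; apply: leq_trans bk.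
  by rewrite /morder (bigD1 i)//= leq_addr.
rewrite (bigD1 c)/=; last by rewrite cE.
rewrite cE leeDl//; apply: sume_ge0 => i _; exact: sqre_ge0.
Qed.

Lemma L2norm_sobolev k u : (L2norm D u ^+ 2 <= sobolev_norm2 k D u)%E.
Proof.
have [Su|nSu] := pselect (sobolev k D u); last first.
  by rewrite /sobolev_norm2 asboolF// leey.
have := @weak_derive_sobolev k (fun=> 0%N) u; rewrite morder0 => /(_ isT).
apply: le_trans.
rewrite (L2norm_sqr Su.1) L2norm_sqr ?(weak_derive0_ip Su)//.
by have [|] := @weak_deriveP _ _ (fun=> 0%N) Su; rewrite ?morder0.
Qed.

Lemma test_function_dense u (e : R) : sobolev10 D u -> 0 < e ->
  exists2 f, test_function D f &
    ip mu (fun x => (u \_ D) x - f x) (fun x => (u \_ D) x - f x) <= e.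
Proof.
move=> [Su [f [tf fu]]] e0.
have [m Hm] : exists m, (sobolev_norm2 1 D (fun x => u x - f m x)%R < e%:E)%E.
  by have [m _ Hm] := near_lt_cvg0 fu e0; exists m; apply: Hm => /=.
exists (f m) => //; rewrite -[f m](test_function_restrict (tf m)) -restrictB -lee_fin.
rewrite -L2norm_sqr; first exact: le_trans (L2norm_sobolev _ _) (ltW Hm).
by move: Hm; rewrite /sobolev_norm2; case: asboolP => // -[].
Qed.

End weak_derivatives.

(** * Second-order operators on H^2 and their transposes *)

Section energy_operators.
Variables (R : realType) (n : nat) (D : set 'rV[R]_n).
Hypotheses (oD : open D) (bD : bounded_set D).
Local Notation mu := (lebesgue_rV R n).
Local Notation fct := ('rV[R]_n -> R).
Implicit Types (u v w : fct) (F G : fct -> fct).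

Let mD : measurable D := open_measurable_rV oD.

(** The two properties of a second-order operator that matter here, boundedness
    from H^2 to L^2 and a transpose that preserves test functions, are both
    stable under sums and under products with smooth coefficients: the elliptic
    operator is then handled without computing its formal adjoint. *)
Definition H2_bounded F : Prop := exists2 C : R, 0 <= C &
  forall u, sobolev 2 D u -> sq_int mu (F u \_ D) /\
    ((ip mu (F u \_ D) (F u \_ D))%:E <= C%:E * sobolev_norm2 2 D u)%E.

Definition has_adjoint F : Prop := forall f, test_function D f ->
  exists2 g, test_function D g &
    forall u, sobolev 2 D u -> L2dot D (F u) f = L2dot D u g.

Lemma sobolev_norm2_ge0 k u : (0 <= sobolev_norm2 k D u)%E.
Proof.
rewrite /sobolev_norm2; case: asboolP => // _.
by apply: sume_ge0 => i _; exact: sqre_ge0.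
Qed.

Lemma L2dotDl u v w : sq_int mu (u \_ D) -> sq_int mu (v \_ D) -> sq_int mu (w \_ D) ->
  L2dot D (fun x => u x + v x) w = L2dot D u w + L2dot D v w.
Proof. by move=> su sv sw; rewrite !L2dotE restrictD ipDl. Qed.

Lemma L2dotMl (a : fct) u v : L2dot D (fun x => a x * u x) v = L2dot D u (fun x => a x * v x).
Proof. by apply: eq_Rintegral => x _; ring. Qed.

Lemma H2_bounded_weak_derive b : (morder b <= 2)%N -> H2_bounded (weak_derive D b).
Proof.
move=> b2; exists 1 => // u Su; have [Lw _] := weak_deriveP Su b2.
split; first exact: L2_sq_int.
by rewrite mul1e -L2norm_sqr//; exact: weak_derive_sobolev.
Qed.

Lemma H2_bounded_id : H2_bounded id.
Proof.
exists 1 => // u Su; split; first exact: L2_sq_int Su.1.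
by rewrite mul1e -L2norm_sqr; [exact: L2norm_sobolev|exact: Su.1].
Qed.

Lemma H2_boundedD F G : H2_bounded F -> H2_bounded G ->
  H2_bounded (fun u x => F u x + G u x).
Proof.
move=> [C C0 HF] [K K0 HG]; exists (2 * (C + K)); first by rewrite mulr_ge0// addr_ge0.
move=> u Su; have [sF lF] := HF _ Su; have [sG lG] := HG _ Su.
rewrite restrictD; split; first exact: sq_intD.
apply: (@le_trans _ _ (2%:E * ((ip mu (F u \_ D) (F u \_ D))%:E + (ip mu (G u \_ D) (G u \_ D))%:E))%E).
  by rewrite -EFinD -EFinM lee_fin mulrDr; exact: ipD_le.
rewrite EFinM -muleA; apply: lee_wpmul2l => //.
by rewrite EFinD ge0_muleDl ?lee_fin//; exact: leeD.
Qed.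

Lemma H2_boundedM a F : smooth a -> H2_bounded F -> H2_bounded (fun u x => a x * F u x).
Proof.
move=> sa [C C0 HF]; have [M M0 aM] := smooth_bounded bD sa.
have ma : measurable_fun setT a by apply: continuous_measurable_rV; exact: smooth_continuous.
exists (M ^+ 2 * C); first by rewrite mulr_ge0// sqr_ge0.
move=> u /HF[sF lF]; have sMF := sq_intZ M sF.
have pw x : (((fun x => a x * F u x) \_ D) x) ^+ 2 <= (M * (F u \_ D) x) ^+ 2.
  rewrite !patchE; case: ifPn => [|_]; last by rewrite expr0n sqr_ge0.
  rewrite inE => /aM ax; rewrite !exprMn ler_wpM2r ?sqr_ge0//.
  by rewrite -[a x ^+ 2]real_normK ?num_real// lerXn2r ?nnegrE.
have sA : sq_int mu ((fun x => a x * F u x) \_ D).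
  have mA : measurable_fun setT ((fun x => a x * F u x) \_ D).
    rewrite (_ : _ \_ D = fun x => a x * (F u \_ D) x).
      by apply: measurable_funM => //; exact: sF.1.
    by apply/funext => x; rewrite !patchE; case: ifP => // _; rewrite mulr0.
  apply: sq_intP => //; apply: (@le_lt_trans _ _ (\int[mu]_x ((M * (F u \_ D) x) ^+ 2)%:E)%E).
    apply: ge0_le_integral => //.
    - by move=> x _; rewrite lee_fin sqr_ge0.
    - by apply/measurable_EFinP; exact: measurable_funX.
    - by apply/measurable_EFinP; apply: measurable_funX; exact: sMF.1.
    - by move=> x _; rewrite lee_fin.
  by rewrite EFin_ip// ltry.
split => //; rewrite EFinM -muleA; apply: le_trans (lee_wpmul2l _ lF); last by rewrite lee_fin sqr_ge0.
rewrite -EFinM lee_fin.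
have -> : M ^+ 2 * ip mu (F u \_ D) (F u \_ D) = ip mu (fun x => M * (F u \_ D) x) (fun x => M * (F u \_ D) x).
  by rewrite ipZl// ipC ipZl// mulrA.
rewrite -lee_fin -!EFin_ip//; apply: ge0_le_integral => //.
- by move=> x _; rewrite lee_fin sqr_ge0.
- by apply/measurable_EFinP; apply: measurable_funX; exact: sA.1.
- by apply/measurable_EFinP; apply: measurable_funX; exact: sMF.1.
- by move=> x _; rewrite lee_fin.
Qed.

Lemma H2_bounded0 : H2_bounded (fun _ _ => 0).
Proof.
exists 0 => // u Su; rewrite (_ : _ \_ D = cst 0); last by apply/funext => x; rewrite patchE; case: ifP.
by split; [exact: sq_int0|rewrite ip0l mul0e].
Qed.

Lemma H2_bounded_sum (I : Type) (s : seq I) (F : I -> fct -> fct) :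
  (forall i, H2_bounded (F i)) -> H2_bounded (fun u x => \sum_(i <- s) F i u x).
Proof.
move=> bF; elim: s => [|i s IH].
  by under eq_fun do under eq_fun do rewrite big_nil; exact: H2_bounded0.
by under eq_fun do under eq_fun do rewrite big_cons; exact: H2_boundedD.
Qed.

(** This is the definition of weak derivatives; the sign squares to 1. *)
Lemma has_adjoint_weak_derive b : (morder b <= 2)%N -> has_adjoint (weak_derive D b).
Proof.
move=> b2 f tf; exists (fun x => (-1) ^+ morder b * mderive b f x).
  by apply: test_functionZ; exact: test_function_mderive.
move=> u Su; have [Lw /(_ _ tf) Hw] := weak_deriveP Su b2.
have sg := test_function_sq_int oD bD (test_function_mderive b tf).
rewrite (L2dotC D u) [RHS]L2dotE restrictZ ipZl//; last exact: L2_sq_int Su.1.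
by rewrite -L2dotE (L2dotC D _ u) Hw mulrA -exprMn mulrNN mulr1 expr1n mul1r.
Qed.

Lemma has_adjoint_id : has_adjoint id.
Proof. by move=> f tf; exists f. Qed.

Lemma has_adjoint0 : has_adjoint (fun _ _ => 0).
Proof.
move=> f tf; exists (cst 0); first exact: test_function0.
by move=> u _; apply: eq_Rintegral => x _; rewrite mul0r mulr0.
Qed.

Lemma has_adjointM a F : smooth a -> has_adjoint F -> has_adjoint (fun u x => a x * F u x).
Proof.
move=> sa aF f tf; have [g tg Hg] := aF _ (test_functionM sa tf).
by exists g => // u Su; rewrite L2dotMl Hg.
Qed.

Lemma has_adjointD F G : H2_bounded F -> H2_bounded G ->
  has_adjoint F -> has_adjoint G -> has_adjoint (fun u x => F u x + G u x).
Proof.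
move=> [? _ bF] [? _ bG] aF aG f tf.
have [g tg Hg] := aF _ tf; have [h th Hh] := aG _ tf.
exists (fun x => g x + h x); first exact: test_functionD.
move=> u Su; have [sF _] := bF _ Su; have [sG _] := bG _ Su.
rewrite L2dotDl//; last exact: test_function_sq_int.
rewrite Hg// Hh// !(L2dotC D u) L2dotDl//; first exact: test_function_sq_int.
  exact: test_function_sq_int.
exact: L2_sq_int Su.1.
Qed.

Lemma has_adjoint_sum (I : Type) (s : seq I) (F : I -> fct -> fct) :
  (forall i, H2_bounded (F i)) -> (forall i, has_adjoint (F i)) ->
  has_adjoint (fun u x => \sum_(i <- s) F i u x).
Proof.
move=> bF aF; elim: s => [|i s IH].
  rewrite (_ : (fun _ _ => _) = fun _ _ => 0); first exact: has_adjoint0.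
  by apply/funext => u; apply/funext => x; rewrite big_nil.
rewrite (_ : (fun _ _ => _) = fun u x => F i u x + \sum_(j <- s) F j u x).
  by apply: has_adjointD => //; exact: H2_bounded_sum.
by apply/funext => u; apply/funext => x; rewrite big_cons.
Qed.

Lemma morder_dirac (i : 'I_n) : morder (fun l => (l == i) : nat) = 1%N.
Proof. by rewrite /morder (bigD1 i)//= eqxx big1 ?addn0// => j /negbTE ->. Qed.

Section elliptic.
Variables (a : 'I_n -> 'I_n -> fct) (b : 'I_n -> fct) (c : fct).
Hypotheses (asmooth : forall i j, smooth (a i j)) (bsmooth : forall i, smooth (b i))
  (csmooth : smooth c).

Lemma elliptic_op_H2 : H2_bounded (elliptic_op D a b c) /\ has_adjoint (elliptic_op D a b c).
Proof.
have m2 (i j : 'I_n) : (morder (fun l => (l == i) + (l == j)) <= 2)%N.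
  by rewrite /morder big_split/= -!/(morder _) !morder_dirac.
have m1 (i : 'I_n) : (morder (fun l => (l == i) : nat) <= 2)%N by rewrite morder_dirac.
have b2 i j := H2_boundedM (asmooth i j) (H2_bounded_weak_derive (m2 i j)).
have a2 i j := has_adjointM (asmooth i j) (has_adjoint_weak_derive (m2 i j)).
have b1 i := H2_boundedM (bsmooth i) (H2_bounded_weak_derive (m1 i)).
have a1 i := has_adjointM (bsmooth i) (has_adjoint_weak_derive (m1 i)).
have b0 := H2_boundedM csmooth H2_bounded_id.
have a0 := has_adjointM csmooth has_adjoint_id.
have sb1 := H2_bounded_sum (index_enum 'I_n) b1.
have sa1 := has_adjoint_sum (index_enum 'I_n) b1 a1.
have sb2i i := H2_bounded_sum (index_enum 'I_n) (b2 i).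
have sa2i i := has_adjoint_sum (index_enum 'I_n) (b2 i) (a2 i).
have sb2 := H2_boundedM (@smooth_cst R n (-1)) (H2_bounded_sum (index_enum 'I_n) sb2i).
have sa2 := has_adjointM (@smooth_cst R n (-1)) (has_adjoint_sum (index_enum 'I_n) sb2i sa2i).
have E : elliptic_op D a b c = fun u x =>
  cst (-1) x * (\sum_i \sum_j a i j x * weak_derive D (fun l => (l == i) + (l == j))%N u x)
  + \sum_i b i x * weak_derive D (fun l => (l == i) : nat) u x + c x * id u x.
  by apply/funext => u; apply/funext => x; rewrite /= mulN1r.
rewrite E; split.
  exact: (H2_boundedD (H2_boundedD sb2 sb1) b0).
exact: (has_adjointD (H2_boundedD sb2 sb1) b0 (has_adjointD sb2 sb1 sa2 sa1) a0).
Qed.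

End elliptic.
End energy_operators.
(** The integral of a nonnegative function is the supremum over the simple
    functions below it, so it is monotone without measurability.  The squared
    H^2 norm of the solution, built from chosen weak derivatives, is not known
    to be a measurable function on the probability space. *)
Lemma ge0_le_lower_integral d (T : measurableType d) (R : realType)
    (mu : {measure set T -> \bar R}) (f g : T -> \bar R) :
  (forall x, 0 <= f x)%E -> (forall x, f x <= g x)%E ->
  (\int[mu]_x f x <= \int[mu]_x g x)%E.
Proof.
move=> f0 fg; have g0 x : (0 <= g x)%E by exact: le_trans (f0 x) (fg x).
rewrite !ge0_integralTE//; apply: le_ereal_sup => _ [h hf <-].
by exists h => // x; exact: le_trans (hf x) (fg x).
Qed.

Section weak_form.
Variables (R : realType) (n : nat) (D : set 'rV[R]_n).
Hypotheses (oD : open D) (bD : bounded_set D).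
Local Notation mu := (lebesgue_rV R n).
Local Notation fct := ('rV[R]_n -> R).
Variables (a : 'I_n -> 'I_n -> fct) (b : 'I_n -> fct) (c : fct).
Hypotheses (asmooth : forall i j, smooth (a i j)) (bsmooth : forall i, smooth (b i))
  (csmooth : smooth c).

(** The pairing with [g] is the pairing of the image of [u] with [f], to which the
    Cauchy-Schwarz inequality applies.  Outside of H^2 the right-hand side is
    infinite provided that its constant is positive: hence [k], as [f] may
    vanish. *)
Lemma elliptic_adjoint_bound : exists2 C : R, 0 < C &
  forall f, test_function D f -> exists2 g, test_function D g &
    (forall u, sobolev 2 D u -> L2dot D (elliptic_op D a b c u) f = L2dot D u g) /\
    forall u (k : R), 0 < k -> C * ip mu (f \_ D) (f \_ D) <= k ->
      ((L2dot D u g ^+ 2)%:E <= k%:E * sobolev_norm2 2 D u)%E.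
Proof.
have [[C C0 HC] ad] := elliptic_op_H2 oD bD asmooth bsmooth csmooth.
exists (C + 1); first by rewrite ltr_wpDl.
move=> f tf; have [g tg Hg] := ad _ tf; exists g => //; split => // u k k0 fk.
have [Su|Su] := pselect (sobolev 2 D u); last first.
  by rewrite /sobolev_norm2 asboolF// mulry gtr0_sg// mul1e leey.
have [se le_e] := HC _ Su; have sf := test_function_sq_int oD bD tf.
rewrite -Hg// L2dotE; have cs := cauchy_schwarz se sf.
set E := ip mu (_ \_ D) (_ \_ D) in le_e cs.
set N := ip mu (f \_ D) (f \_ D) in cs fk.
have N0 : 0 <= N by exact: ip_ge0.
apply: (@le_trans _ _ (N%:E * (C%:E * sobolev_norm2 2 D u))%E).
  apply: (@le_trans _ _ (N%:E * E%:E)%E); last by apply: lee_wpmul2l => //; rewrite lee_fin.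
  by rewrite -EFinM lee_fin mulrC.
rewrite muleA -EFinM; apply: lee_wpmul2r; first exact: sobolev_norm2_ge0.
by rewrite lee_fin mulrC; apply: le_trans fk; rewrite ler_wpM2r// lerDl.
Qed.

Lemma eigenfunction_adjoint (l : R) u f g : sobolev 2 D u -> 
  {ae mu, forall x, D x -> elliptic_op D a b c u x = l * u x} ->
  test_function D f -> test_function D g ->
  (forall u, sobolev 2 D u -> L2dot D (elliptic_op D a b c u) f = L2dot D u g) ->
  L2dot D u g = l * L2dot D u f.
Proof.
move=> Su ae_u tf tg Hg; rewrite -Hg//.
have [[C C0 HC] _] := elliptic_op_H2 oD bD asmooth bsmooth csmooth.
have [[me _] _] := HC _ Su.
have su := L2_sq_int Su.1; have sf := test_function_sq_int oD bD tf.
rewrite !L2dotE -ipZl// /ip /Rintegral; congr fine.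
have [[mu' _] [mf _]] := (su, sf).
apply: ae_eq_integral => //.
- by apply/measurable_EFinP; exact: measurable_funM.
- by apply/measurable_EFinP; apply: measurable_funM => //; exact: measurable_funM.
apply: filterS ae_u => x H _; rewrite !patchE; case: ifPn => [|_]; last by rewrite !mulr0.
by rewrite inE => /H ->.
Qed.

End weak_form.

(** * Pairing a random field with a test function *)

Section random_field.
Variables (R : realType) (n : nat) (D : set 'rV[R]_n).
Hypotheses (oD : open D) (bD : bounded_set D).
Local Notation mu := (lebesgue_rV R n).
Local Notation fct := ('rV[R]_n -> R).
Context d (Omega : measurableType d) (P : probability Omega R).
Variables (U : Omega -> fct) (g : fct).
Hypothesis mU : measurable_fun (setT `*` D) (fun p : Omega * 'rV[R]_n => U p.1 p.2).
Hypothesis tg : test_function D g.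

Let mD : measurable D := open_measurable_rV oD.

Lemma measurable_section w : measurable_fun setT (U w \_ D).
Proof.
apply/(measurable_restrictT _ _).1 => //.
have : measurable_fun D ((fun p : Omega * 'rV[R]_n => U p.1 p.2) \o (fun x => (w, x))).
  apply: (measurable_comp (F := setT `*` D)) => //.
    exact: measurableX.
    by move=> _ [x Dx <-].
  exact: measurable_funTS (@pair1_measurable _ _ _ _ w).
by [].
Qed.

Let Y w := L2dot D (U w) g.

(** Fubini for the positive and the negative part of the jointly measurable
    integrand. *)
Lemma measurable_L2dot : measurable_fun setT Y.
Proof.
pose G (p : Omega * 'rV[R]_n) : R := (((fun p => U p.1 p.2) \_ (setT `*` D)) p) * g p.2.
have mG : measurable_fun setT G.
  apply: measurable_funM; first by apply/(measurable_restrictT _ _).1 => //; exact: measurableX.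
  apply: (@measurableT_comp _ _ _ _ _ _ g _ snd) => //.
  by apply: continuous_measurable_rV; exact: smooth_continuous tg.1.
have mEG : measurable_fun setT (EFin \o G) by exact/measurable_EFinP.
have m1 : measurable_fun setT (fun w => (\int[mu]_x ((EFin \o G)^\+ (w, x)))%E).
  by apply: measurable_fun_fubini_tonelli_F => //; exact: measurable_funepos.
have m2 : measurable_fun setT (fun w => (\int[mu]_x ((EFin \o G)^\- (w, x)))%E).
  by apply: measurable_fun_fubini_tonelli_F => //; exact: measurable_funeneg.
rewrite (_ : Y = fine \o (fun w => (\int[mu]_x ((EFin \o G)^\+ (w, x))) -
   (\int[mu]_x ((EFin \o G)^\- (w, x))))%E).
  by apply: measurableT_comp => //; exact: emeasurable_funB.
apply/funext => w; rewrite /Y L2dotE /ip /Rintegral /=; congr fine.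
transitivity (\int[mu]_x (G (w, x))%:E)%E; last first.
  rewrite integralE; congr (_ - _)%E; apply: eq_integral => x _.
    by rewrite !funeposE.
  by rewrite !funenegE.
apply: eq_integral => x _; congr EFin; rewrite (test_function_restrict tg) /G; congr (_ * _).
by rewrite !patchE in_setX mem_setT.
Qed.

Lemma L2dot_sq_int (H : Omega -> \bar R) (k : R) : 0 < k ->
  (forall w, ((Y w ^+ 2)%:E <= k%:E * H w)%E) -> (\int[P]_w H w < +oo)%E ->
  sq_int P Y /\ ((ip P Y Y)%:E <= k%:E * \int[P]_w H w)%E.
Proof.
move=> k0 YH Hoo.
have mY := measurable_L2dot.
have mY2 : measurable_fun setT (fun w => (Y w ^+ 2)%:E).
  by apply/measurable_EFinP; exact: measurable_funX.
have le : (\int[P]_w (Y w ^+ 2)%:E <= k%:E * \int[P]_w H w)%E.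
  rewrite -lee_pdivrMl// -ge0_integralZl//; last by rewrite lee_fin invr_ge0 ltW.
    apply: ge0_le_lower_integral => w.
      by rewrite mule_ge0// lee_fin ?sqr_ge0// invr_ge0 ltW.
    by rewrite lee_pdivrMl.
  by move=> w _; rewrite lee_fin sqr_ge0.
have sY : sq_int P Y.
  apply: sq_intP => //; apply: le_lt_trans le _.
  by apply: lte_mul_pinfty => //; rewrite lee_fin ltW.
by rewrite -EFin_ip.
Qed.

Variables (I : nat -> Omega -> R) (phi : nat -> fct).
Hypotheses (sI : forall k, sq_int P (I k)) (sphi : forall k, sq_int mu (phi k \_ D)).
Let S N w : fct := fun x => \sum_(k < N) I k w * phi k x.
Hypothesis cU : (fun N => \int[P]_w (L2norm D (fun x => U w x - S N w x)%R ^+ 2))%E @ \oo --> 0%E.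

Lemma L2dot_partial_sum N w :
  L2dot D (S N w) g = \sum_(k < N) I k w * L2dot D (phi k) g.
Proof.
have sg := test_function_sq_int oD bD tg.
have E : S N w \_ D = fun x => \sum_(k < N) I k w * (phi k \_ D) x.
  by rewrite restrict_sum; apply/funext => x; apply: eq_bigr => k _; rewrite restrictZ.
rewrite L2dotE E ip_suml//; last by move=> k; exact: sq_intZ.
by apply: eq_bigr => k _; rewrite ipZl// L2dotE.
Qed.

(** If the residual is not square-integrable, the right-hand side is infinite, its
    constant being positive; otherwise [U w] is square-integrable too, and the
    Cauchy-Schwarz inequality applies. *)
Lemma L2dot_error N w :
  (((Y w - \sum_(k < N) I k w * L2dot D (phi k) g) ^+ 2)%:E <=
   (ip mu (g \_ D) (g \_ D) + 1)%:E * L2norm D (fun x => U w x - S N w x)%R ^+ 2)%E.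
Proof.
have sg := test_function_sq_int oD bD tg.
have sS : sq_int mu (S N w \_ D).
  rewrite restrict_sum; apply: sq_int_sum => k; rewrite restrictZ; exact: sq_intZ.
have mr : measurable_fun setT ((fun x => U w x - S N w x) \_ D).
  by rewrite restrictB; apply: measurable_funB; [exact: measurable_section|exact: sS.1].
have k1 : 0 < ip mu (g \_ D) (g \_ D) + 1 by rewrite ltr_wpDl// ip_ge0.
rewrite /L2norm Lnorm2_sqr.
have [Hoo|] := ltP (\int[mu]_x (((fun x => U w x - S N w x) \_ D) x ^+ 2)%:E)%E +oo%E; last first.
  by rewrite leye_eq => /eqP ->; rewrite mulry gtr0_sg// mul1e leey.
have sr := sq_intP mr Hoo.
have -> : Y w - \sum_(k < N) I k w * L2dot D (phi k) g = L2dot D (fun x => U w x - S N w x) g.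
  rewrite -L2dot_partial_sum /Y !L2dotE.
  have sU : sq_int mu (U w \_ D).
    rewrite (_ : U w = fun x => (U w x - S N w x) + S N w x); last by apply/funext => x; rewrite subrK.
    by rewrite restrictD; exact: sq_intD.
  by rewrite restrictB ipBl.
rewrite EFin_ip// -EFinM lee_fin L2dotE; apply: le_trans (cauchy_schwarz sr sg) _.
by rewrite mulrC ler_wpM2r ?ip_ge0// lerDl.
Qed.

(** The convergence of the series in mean square passes to its pairings by
    L2dot_error and the Cauchy-Schwarz inequality. *)
Lemma L2dot_cvg (Z : Omega -> R) : sq_int P Y -> sq_int P Z ->
  (fun N => \sum_(k < N) ip P (I k) Z * L2dot D (phi k) g) @ \oo --> ip P Y Z.
Proof.
move=> sY sZ; set K := ip mu (g \_ D) (g \_ D) + 1.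
have K0 : 0 < K by rewrite ltr_wpDl// ip_ge0.
have sYN N : sq_int P (fun w => \sum_(k < N) I k w * L2dot D (phi k) g).
  by apply: sq_int_sum => k; under eq_fun do rewrite mulrC; exact: sq_intZ.
have YNE N : \sum_(k < N) ip P (I k) Z * L2dot D (phi k) g =
    ip P (fun w => \sum_(k < N) I k w * L2dot D (phi k) g) Z.
  rewrite ip_suml//; last by move=> k; under eq_fun do rewrite mulrC; exact: sq_intZ.
  by apply: eq_bigr => k _; under [in RHS]eq_fun do rewrite mulrC; rewrite ipZl// mulrC.
have err N : ((ip P (fun w => Y w - \sum_(k < N) I k w * L2dot D (phi k) g)
    (fun w => Y w - \sum_(k < N) I k w * L2dot D (phi k) g))%:E <=
    K%:E * \int[P]_w (L2norm D (fun x => U w x - S N w x)%R ^+ 2))%E.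
  rewrite -EFin_ip; last exact: sq_intB.
  rewrite -lee_pdivrMl// -ge0_integralZl//.
  - apply: ge0_le_lower_integral => w.
      by rewrite mule_ge0// lee_fin ?sqr_ge0// invr_ge0 ltW.
    by rewrite lee_pdivrMl//; exact: L2dot_error.
  - apply/measurable_EFinP; apply: measurable_funX.
    by have [] := sq_intB sY (sYN N).
  - by move=> w _; rewrite lee_fin sqr_ge0.
  - by rewrite lee_fin invr_ge0 ltW.
apply/cvgrPdist_lt => e e0.
have zz0 : 0 <= ip P Z Z by exact: ip_ge0.
pose dl := e ^+ 2 / (K * (ip P Z Z + 1)).
have dl0 : 0 < dl by rewrite divr_gt0 ?exprn_gt0// mulr_gt0// ltr_wpDl.
have Hnear := near_lt_cvg0 cU dl0; near=> N.
have HN : (\int[P]_w (L2norm D (fun x => U w x - S N w x)%R ^+ 2) < dl%:E)%E by near: N.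
rewrite YNE -ipBl//.
have sd := sq_intB sY (sYN N).
have cs := cauchy_schwarz sd sZ.
rewrite -(ltr_pXn2r (n := 2))// ?nnegrE//; last exact: ltW.
rewrite real_normK ?num_real//; apply: le_lt_trans cs _.
have lt : ip P (fun w => Y w - \sum_(k < N) I k w * L2dot D (phi k) g)
    (fun w => Y w - \sum_(k < N) I k w * L2dot D (phi k) g) < K * dl.
  rewrite -lte_fin; apply: le_lt_trans (err N) _.
  by rewrite EFinM lte_pmul2l.
apply: (@le_lt_trans _ _ (K * dl * ip P Z Z)); first by rewrite ler_wpM2r// ltW.
have -> : K * dl * ip P Z Z = e ^+ 2 * (ip P Z Z / (ip P Z Z + 1)).
  by rewrite /dl; field; rewrite !gt_eqF// ltr_wpDl.
by rewrite gtr_pMr ?exprn_gt0// ltr_pdivrMr ?mul1r ?ltrDl// ltr_wpDl.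
Unshelve. all: end_near. Qed.

End random_field.

(** * Bounded functionals and orthonormal expansions *)

Section orthonormal_expansion.
Context d (T : measurableType d) (R : realType).
Variable mu : {measure set T -> \bar R}.
Variable phi : nat -> T -> R.
Hypothesis sphi : forall k, sq_int mu (phi k).
Hypothesis ophi : forall j k, ip mu (phi j) (phi k) = (j == k)%:R.

Lemma sq_int_expansion (v : nat -> R) N : sq_int mu (fun x => \sum_(k < N) v k * phi k x).
Proof. by apply: sq_int_sum => k; exact: sq_intZ. Qed.

Lemma ip_expansion (v w : nat -> R) M N : (M <= N)%N ->
  ip mu (fun x => \sum_(k < M) v k * phi k x) (fun x => \sum_(k < N) w k * phi k x) =
  \sum_(k < M) v k * w k.
Proof.
move=> MN; have sN := sq_int_expansion w N.
rewrite ip_suml//; last by move=> k; exact: sq_intZ.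
apply: eq_bigr => k _; rewrite ipZl//; congr (_ * _).
rewrite ipC ip_suml//; last by move=> j; exact: sq_intZ.
rewrite (bigD1 (widen_ord MN k))//= ipZl// ophi eqxx mulr1 big1 ?addr0// => j jk.
by rewrite ipZl// ophi (_ : (j == k :> nat) = false) ?mulr0//; exact/negbTE.
Qed.

End orthonormal_expansion.

Section functional.
Variables (R : realType) (n : nat) (D : set 'rV[R]_n).
Hypotheses (oD : open D) (bD : bounded_set D).
Local Notation mu := (lebesgue_rV R n).
Local Notation fct := ('rV[R]_n -> R).

Definition approximable (u : fct) : Prop := forall e : R, 0 < e ->
  exists2 f, test_function D f & ip mu (fun x => u x - f x) (fun x => u x - f x) <= e.

Lemma approximable0 : approximable (cst 0).
Proof.
move=> e e0; exists (cst 0); first exact: test_function0.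
by rewrite (_ : (fun _ => _) = cst 0) ?ip0l ?ltW//; apply/funext => x /=; rewrite subr0.
Qed.

Lemma approximableD u v : sq_int mu u -> sq_int mu v ->
  approximable u -> approximable v -> approximable (fun x => u x + v x).
Proof.
move=> su sv au av e e0.
have e4 : 0 < e / 4 by rewrite divr_gt0.
have [f tf Hf] := au _ e4; have [g tg Hg] := av _ e4.
exists (fun x => f x + g x); first exact: test_functionD.
have sf := test_function_sq_int oD bD tf; have sg := test_function_sq_int oD bD tg.
rewrite (test_function_restrict tf) in sf; rewrite (test_function_restrict tg) in sg.
rewrite (_ : (fun x => _) = fun x => (u x - f x) + (v x - g x)); last first.
  by apply/funext => x; ring.
by have := ipD_le (sq_intB su sf) (sq_intB sv sg); lra.
Qed.

Lemma approximableZ (a : R) u : sq_int mu u -> approximable u -> approximable (fun x => a * u x).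
Proof.
move=> su au e e0.
have e4 : 0 < e / (a ^+ 2 + 1) by rewrite divr_gt0// ltr_wpDl// sqr_ge0.
have [f tf Hf] := au _ e4.
exists (fun x => a * f x); first exact: test_functionZ.
have sf := test_function_sq_int oD bD tf.
rewrite (test_function_restrict tf) in sf.
have sd := sq_intB su sf.
rewrite (_ : (fun x => _) = fun x => a * (u x - f x)); last first.
  by apply/funext => x; ring.
rewrite ipZl//; last exact: sq_intZ.
rewrite ipC ipZl// mulrA -expr2.
move: Hf; rewrite ler_pdivlMr ?ltr_wpDl ?sqr_ge0//.
by have := ip_ge0 mu (fun x => u x - f x); nra.
Qed.

Lemma approximable_sum (v : nat -> R) (phi : nat -> fct) M :
  (forall k, sq_int mu (phi k)) -> (forall k, approximable (phi k)) ->
  approximable (fun x => \sum_(k < M) v k * phi k x).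
Proof.
move=> sp ap; elim: M => [|M IH].
  by rewrite (_ : (fun _ => _) = cst 0); [exact: approximable0|apply/funext => x; rewrite big_ord0].
rewrite (_ : (fun x => _) = fun x => \sum_(k < M) v k * phi k x + v M * phi M x); last first.
  by apply/funext => x; rewrite big_ord_recr.
apply: approximableD => //; [exact: sq_int_expansion|exact: sq_intZ|].
exact: approximableZ.
Qed.

Variable phi : nat -> fct.
Hypothesis sphi : forall k, sq_int mu (phi k).
Hypothesis ophi : forall j k, ip mu (phi j) (phi k) = (j == k)%:R.
Hypothesis aphi : forall k, approximable (phi k).

(** The functional [f |-> sum_k v_k <phi_k, f>] is bounded by the square root of
    [A], and testing it on [f = sum_(k < M) v_k phi_k] gives [s ^+ 2 <= A * s]
    for the partial sum [s] of the squares.  That [f] is only a limit of test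
    functions; the bound [K] controls the error, at the cost of a factor 4. *)
Lemma functional_bound (v : nat -> R) (K A : R) : 0 <= A ->
  (forall N, \sum_(k < N) v k ^+ 2 <= K) ->
  (forall f e, test_function D f -> 0 < e -> exists2 L : R,
     (fun N => \sum_(k < N) v k * ip mu (phi k) f) @ \oo --> L & L ^+ 2 <= A * (ip mu f f + e)) ->
  forall M, \sum_(k < M) v k ^+ 2 <= 4 * A.
Proof.
move=> A0 vK H M; set s := \sum_(k < M) _.
pose p N x := \sum_(k < N) v k * phi k x.
have K0 : 0 <= K by apply: le_trans (vK 0%N); rewrite big_ord0.
have s0 : 0 <= s by apply: sumr_ge0 => k _; exact: sqr_ge0.
suff Hd e : 0 < e -> s ^+ 2 <= 4 * A * s + (6 * A + 2 * K) * e.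
  have : s ^+ 2 <= 4 * A * s.
    apply/ler_addgt0Pr => e e0.
    have c0 : 0 < 6 * A + 2 * K + 1 by rewrite ltr_wpDl// addr_ge0// mulr_ge0.
    have := Hd _ (divr_gt0 e0 c0); move/le_trans; apply.
    rewrite lerD2l mulrCA ger_pMr// ler_pdivrMr// mul1r; lra.
  by nra.
move=> e0.
have [f tf Hf] := approximable_sum v M sphi aphi e0.
have [L cL HL] := H f e tf e0.
have sf := test_function_sq_int oD bD tf; rewrite (test_function_restrict tf) in sf.
have sp N : sq_int mu (p N) by exact: sq_int_expansion.
have sr := sq_intB (sp M) sf.
have ff : ip mu f f <= 2 * s + 2 * e.
  have -> : f = fun x => p M x + (-1) * (p M x - f x) by apply/funext => x; ring.
  apply: le_trans (ipD_le (sp M) (sq_intZ (-1) sr)) _.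
  rewrite ip_expansion// (eq_bigr (fun k : 'I_M => v k ^+ 2)); last by move=> k _; rewrite expr2.
  rewrite lerD2l ler_pM2l// ipZl//; last exact: sq_intZ.
  by rewrite ipC ipZl// mulrA mulrNN !mul1r.
have Ls : (L - s) ^+ 2 <= K * e.
  have cLs : (fun N => (\sum_(k < N) v k * ip mu (phi k) f - s) ^+ 2) @ \oo --> (L - s) ^+ 2.
    have c1 : (fun N => \sum_(k < N) v k * ip mu (phi k) f - s) @ \oo --> L - s.
      by apply: cvgB => //; exact: cvg_cst.
    by rewrite expr2; under eq_fun do rewrite expr2; exact: cvgM.
  apply: (cvgr_to_le cLs); near=> N.
  have MN : (M <= N)%N by near: N; exact: nbhs_infty_ge.
  have -> : \sum_(k < N) v k * ip mu (phi k) f = ip mu (p N) f.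
    rewrite /p ip_suml//; last by move=> k; exact: sq_intZ.
    by apply: eq_bigr => k _; rewrite ipZl.
  have -> : s = ip mu (p N) (p M).
    by rewrite ipC ip_expansion//; apply: eq_bigr => k _; rewrite expr2.
  rewrite -(ipC mu f) -(ipC mu (p M)) -ipBl// -sqrrN -mulN1r -ipZl//; last exact: sq_intB.
  rewrite (_ : (fun x => -1 * _) = fun x => p M x - f x); last by apply/funext => x; ring.
  apply: le_trans (cauchy_schwarz sr (sp N)) _; rewrite mulrC; apply: ler_pM => //; try exact: ip_ge0.
  rewrite ip_expansion//; apply: le_trans (vK N); apply: ler_sum => k _; by rewrite expr2.
have := sqr_ge0 (L + (L - s)); nra.
Unshelve. all: end_near. Qed.

End functional.

(** * Bounds for the drift *)

Section drift.
Variables (R : realType) (alpha : R).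
Hypothesis a01 : 0 < alpha < 1.
Local Notation mu := (@lebesgue_measure R).

Lemma essentially_bounded (h : R -> R) (A : set R) : h \_ A \in Lfun mu +oo%E ->
  measurable_fun setT (h \_ A) /\
  exists2 H : R, 0 <= H & {ae mu, forall x, A x -> h x <= H}.
Proof.
rewrite inE => /andP[]; rewrite !inE /= => mh; rewrite /finite_norm.
rewrite unlock /=.
have -> : (0 < mu setT)%E by rewrite -set_itvNyy lebesgue_measure_itv ltry.
move=> Hoo; split => //.
have := ess_sup_inf.ess_sup_ge mu (abse \o (EFin \o (h \_ A))).
move: Hoo; case: (ess_sup_inf.ess_sup _ _) => [r _|//|_] H.
  exists (Num.max r 0); first by rewrite le_max lexx orbT.
  apply: filterS H => x /=; rewrite lee_fin patchE => + Ax; rewrite mem_set// => hr.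
  by rewrite le_max; apply/orP; left; exact: le_trans (ler_norm _) hr.
exists 0 => //; apply: filterS H => x; by rewrite leeNy_eq.
Qed.

Lemma integrable_relaxation_kernel l t : 0 < l -> 0 < t ->
  mu.-integrable `[0, t] (EFin \o relaxation_kernel alpha l t).
Proof.
move=> l0 t0; apply/integrableP; split.
  by apply/measurable_EFinP; apply: measurable_funTS; exact: measurable_relaxation_kernel.
have E : (\int[mu]_(x in `[0%R, t]) `|(EFin \o relaxation_kernel alpha l t) x| =
    (ml_mass alpha l t)%:E)%E.
  rewrite -integral_relaxation_kernel//; apply: eq_integral => x.
  rewrite inE/= in_itv/= => /andP[_ xt].
  by rewrite ger0_norm//; exact: relaxation_kernel_ge0.
by apply: le_lt_trans (ltry (ml_mass alpha l t)); rewrite -E.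
Qed.

(** As the kernel is nonnegative, bounds of [h] become bounds of the integral. *)
Lemma drift_bounds T (h : R -> R) (c H : R) : 0 < T -> 0 < c ->
  measurable_fun setT (h \_ `]0, T[) ->
  {ae mu, forall t : R, 0 < t < T -> c <= h t} ->
  {ae mu, forall t : R, `]0, T[%classic t -> h t <= H} ->
  forall l, 0 < l ->
  c * ml_mass alpha l T <=
    \int[mu]_(tau in `[0, T]) (relaxation_kernel alpha l T tau * h tau) <=
  Num.max c H * ml_mass alpha l T.
Proof.
move=> T0 c0 mh hc hH l l0; set M := Num.max c H.
pose k := relaxation_kernel alpha l T.
(* The values of [h] on a null set are unconstrained: [h1] has the bounds
   everywhere and agrees with [h] almost everywhere on the open interval. *)
pose h1 (x : R) := Num.min (Num.max c (h x)) M.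
have cM : c <= M by rewrite le_max lexx.
have mI : measurable (`]0, T[%classic : set (measurableTypeR R)) by exact: measurable_itv.
have mk := measurable_relaxation_kernel a01 l T.
have mhI : measurable_fun `]0, T[ h by exact: (measurable_restrictT h mI).2 mh.
have mh1 : measurable_fun `]0, T[ h1.
  by apply: measurable_minr => //; apply: measurable_maxr.
have mkI : measurable_fun `]0, T[ k by exact: measurable_funTS.
have k0 x : `]0, T[%classic x -> 0 <= k x.
  rewrite /= in_itv/= => /andP[_ xT]; apply: relaxation_kernel_ge0 => //; exact: ltW.
have Ik : (\int[mu]_(x in `]0%R, T[) (k x)%:E = (ml_mass alpha l T)%:E)%E.
  rewrite -integral_relaxation_kernel// [RHS]integral_itv_bndoo//.
  exact/measurable_EFinP.
have E : (\int[mu]_(x in `[0%R, T]) (k x * h x)%:E = \int[mu]_(x in `]0%R, T[) (k x * h1 x)%:E)%E.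
  rewrite integral_itv_bndoo; last by apply/measurable_EFinP; exact: measurable_funM.
  apply: ae_eq_integral => //.
  - by apply/measurable_EFinP; exact: measurable_funM.
  - by apply/measurable_EFinP; exact: measurable_funM.
  apply: (@filterS2 _ _ (ae_filter_ringOfSetsType mu) _ _ _ _ hc hH) => x cx Hx Ix.
  congr (_ * _)%:E; rewrite /h1; move: (Ix); rewrite /= in_itv/= => /cx chx.
  rewrite (max_idPr chx); apply/esym/min_idPl.
  by rewrite le_max (Hx Ix) orbT.
have h1c x : c <= h1 x by rewrite le_min cM le_max lexx.
have h1M x : h1 x <= M by rewrite ge_min lexx orbT.
have h10 x : 0 <= h1 x by apply: le_trans (h1c x); exact: ltW.
have lb : ((c * ml_mass alpha l T)%:E <= \int[mu]_(x in `]0%R, T[) (k x * h1 x)%:E)%E.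
  rewrite EFinM -Ik -ge0_integralZl//; last by rewrite lee_fin ltW.
    apply: ge0_le_integral => //.
    - by move=> x Ix; rewrite -EFinM lee_fin mulr_ge0 ?(ltW c0)// k0.
    - by apply/measurable_EFinP; exact: measurable_funM.
    - by apply/measurable_EFinP; exact: measurable_funM.
    - by move=> x Ix; rewrite -EFinM lee_fin mulrC ler_wpM2l// k0.
  exact/measurable_EFinP.
have ub : (\int[mu]_(x in `]0%R, T[) (k x * h1 x)%:E <= (M * ml_mass alpha l T)%:E)%E.
  rewrite EFinM -Ik -ge0_integralZl//; last by rewrite lee_fin (le_trans (ltW c0)).
    apply: ge0_le_integral => //.
    - by move=> x Ix; rewrite lee_fin mulr_ge0 ?k0.
    - by apply/measurable_EFinP; exact: measurable_funM.
    - by apply/measurable_EFinP; exact: measurable_funM.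
    - by move=> x Ix; rewrite -EFinM lee_fin mulrC ler_wpM2r// k0.
  exact/measurable_EFinP.
rewrite /Rintegral -/k E -!lee_fin.
rewrite fineK ?lb ?ub// fin_numElt; apply/andP; split.
  by apply: lt_le_trans lb; rewrite ltNyr.
by apply: le_lt_trans ub _; rewrite ltry.
Qed.

End drift.

(** * Moments of the coefficients and the sources *)

Section spectral_bounds.
Variables (R : realType) (n : nat) (D : set 'rV[R]_n).
Hypotheses (oD : open D) (bD : bounded_set D).
Local Notation mu := (lebesgue_rV R n).
Local Notation fct := ('rV[R]_n -> R).
Variables (a : 'I_n -> 'I_n -> fct) (b : 'I_n -> fct) (c : fct).
Hypotheses (asmooth : forall i j, smooth (a i j)) (bsmooth : forall i, smooth (b i))
  (csmooth : smooth c).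
Variables (lambda : nat -> R) (phi : nat -> fct).
Hypothesis eigen : dirichlet_eigensystem D a b c lambda phi.

Lemma eigen_sq_int k : sq_int mu (phi k \_ D).
Proof. by case: eigen => _ _ /(_ k)[[[Lp _] _] _] _ _; exact: L2_sq_int. Qed.

Lemma eigen_orthonormal j k : ip mu (phi j \_ D) (phi k \_ D) = (j == k)%:R.
Proof. by case: eigen => _ _ _ /(_ j k) + _; rewrite L2dotE. Qed.

Lemma eigen_bessel f N : L2 D f ->
  \sum_(k < N) L2dot D f (phi k) ^+ 2 <= ip mu (f \_ D) (f \_ D).
Proof.
move=> Lf; under eq_bigr do rewrite L2dotE.
exact: (bessel N eigen_sq_int eigen_orthonormal (L2_sq_int Lf)).
Qed.

(** The squared norm of the residual is the squared norm of [f] minus the partial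
    sum of squares, and it tends to 0 by completeness of the eigenfunctions. *)
Lemma eigen_parseval f (s : R) : L2 D f ->
  (forall N, \sum_(k < N) L2dot D f (phi k) ^+ 2 <= s) ->
  (L2norm D f ^+ 2 <= s%:E)%E.
Proof.
move=> Lf fs; rewrite L2norm_sqr// lee_fin; apply/ler_addgt0Pr => e e0.
case: eigen => _ _ _ _ /(_ f Lf) cf.
have m0 : 0 < Num.min e 1 by rewrite lt_min e0 ltr01.
have [N _ /(_ N (leqnn N))/=] := near_lt_cvg0 cf m0.
have := ip_residual N eigen_sq_int eigen_orthonormal (L2_sq_int Lf).
set r := (fun x => (f \_ D) x - _); set S := \sum_(k < N) _ => rE.
have {}rE : ip mu r r = ip mu (f \_ D) (f \_ D) - S by [].
have rD : (fun x => f x - \sum_(k < N) L2dot D f (phi k) * phi k x) \_ D = r.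
  rewrite restrictB restrict_sum /r; apply/funext => x; congr (_ - _).
  by apply: eq_bigr => k _; rewrite restrictZ L2dotE.
have sr : sq_int mu r.
  apply: sq_intB; first exact: L2_sq_int.
  by apply: sq_int_sum => k; apply: sq_intZ; exact: eigen_sq_int.
have SE : S <= s.
  by apply: le_trans (fs N); apply: ler_sum => k _; rewrite L2dotE.
rewrite /L2norm rD; have := Lnorm2_sqr mu r; rewrite EFin_ip//.
have := Lnorm_ge0 mu 2%:E (EFin \o r).
case: ('N[mu]_2%:E[EFin \o r])%E => [z|//|//]; rewrite lee_fin => z0.
rewrite -EFin_expe => -[zE]; rewrite lte_fin lt_min => /andP[ze z1].
have : z ^+ 2 <= e by apply: le_trans (ltW ze); rewrite expr2 ler_piMl// ltW.
by rewrite zE rE; lra.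
Qed.

Section solution.
Context d (Omega : measurableType d) (P : probability Omega R).
Variables (U : Omega -> fct) (I : nat -> Omega -> R).
Hypothesis mU : measurable_fun (setT `*` D) (fun p : Omega * 'rV[R]_n => U p.1 p.2).
Hypothesis sI : forall k, sq_int P (I k).
Hypothesis cU : (fun N => \int[P]_w (L2norm D (fun x => U w x -
  \sum_(k < N) I k w * phi k x)%R ^+ 2))%E @ \oo --> 0%E.
Variables (C B : R).
Hypothesis C0 : 0 < C.
Hypothesis HC : forall f, test_function D f -> exists2 g, test_function D g &
    (forall u, sobolev 2 D u -> L2dot D (elliptic_op D a b c u) f = L2dot D u g) /\
    forall u (k : R), 0 < k -> C * ip mu (f \_ D) (f \_ D) <= k ->
      ((L2dot D u g ^+ 2)%:E <= k%:E * sobolev_norm2 2 D u)%E.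
Hypothesis HB : (\int[P]_w sobolev_norm2 2 D (U w) = B%:E)%E.

(** By the Cauchy-Schwarz inequality, [f |-> E (Z <U, g>)] is bounded for the L^2
    norm of [f], where [g] is the image of [f] under the transpose; its
    coefficients on the eigenfunctions are [lambda k * ip P (I k) Z], because
    the transpose multiplies the pairing with [phi k] by [lambda k]. *)
Lemma moment_bound (Z : Omega -> R) (K : R) : sq_int P Z ->
  (forall N, \sum_(k < N) (lambda k * ip P (I k) Z) ^+ 2 <= K) ->
  forall M, \sum_(k < M) (lambda k * ip P (I k) Z) ^+ 2 <= 4 * (C * B * ip P Z Z).
Proof.
move=> sZ vK.
have B0 : 0 <= B.
  by rewrite -lee_fin -HB integral_ge0// => w _; exact: sobolev_norm2_ge0.
have zz0 := ip_ge0 P Z.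
apply: (@functional_bound R n D oD bD (fun k => phi k \_ D)
  eigen_sq_int eigen_orthonormal _ (fun k => lambda k * ip P (I k) Z) K) => //.
- move=> k e e0; case: eigen => _ _ /(_ k)[[_ Hk] _] _ _.
  exact: test_function_dense.
- by rewrite !mulr_ge0// ltW.
move=> f e tf e0; have [g tg [Hg bg]] := HC tf.
have N0 := ip_ge0 mu (f \_ D).
have k0 : 0 < C * (ip mu f f + e).
  by rewrite mulr_gt0// ltr_wpDl//; exact: ip_ge0.
have [||sY YY] := @L2dot_sq_int _ _ _ oD _ _ P U g mU tg _ _ k0 (fun w => bg (U w) _ k0 _).
- by rewrite (test_function_restrict tf) ler_pM2l// lerDl ltW.
- by rewrite HB ltry.
exists (ip P (fun w => L2dot D (U w) g) Z).
  rewrite (_ : (fun N => _) = fun N => \sum_(k < N) ip P (I k) Z * L2dot D (phi k) g).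
    exact: (L2dot_cvg oD bD mU tg sI eigen_sq_int cU sY sZ).
  apply/funext => N; apply: eq_bigr => k _.
  case: eigen => _ _ /(_ k)[[Sk _] ek] _ _.
  rewrite (eigenfunction_adjoint oD bD asmooth bsmooth csmooth Sk ek tf tg Hg).
  by rewrite L2dotE (test_function_restrict tf) mulrA (mulrC (lambda k)).
apply: le_trans (cauchy_schwarz sY sZ) _.
have {}YY : ip P (fun w => L2dot D (U w) g) (fun w => L2dot D (U w) g) <= C * (ip mu f f + e) * B.
  by rewrite -lee_fin EFinM -HB.
have := ler_wpM2r zz0 YY; move/le_trans; apply.
by rewrite le_eqVlt; apply/orP; left; apply/eqP; ring.
Qed.

End solution.
End spectral_bounds.

Section mode_moments.
Context (R : realType) (d : measure_display) (Omega : measurableType d).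
Variables (P : probability Omega R) (W : R -> {RV P >-> R}).
Hypothesis hW : wiener_process W.
Variables (T : R) (k : R -> R) (X : {RV P >-> R}) (p q : R).
Hypothesis T0 : 0 <= T.
Hypothesis ik : (@lebesgue_measure R).-integrable `[0, T] (EFin \o k).
Hypothesis WX : is_wiener_integral W T k X.

Lemma mode_sq_int : sq_int P (fun w => p + q * X w).
Proof.
have [sX _ _] := wiener_integral_moments hW T0 ik WX.
exact: (sq_intD (sq_int_cst P p) (sq_intZ q sX)).
Qed.

Lemma mode_ip (Z : Omega -> R) : sq_int P Z ->
  ip P (fun w => p + q * X w) Z = p * ip P (cst 1) Z + q * ip P X Z.
Proof.
move=> sZ; have [sX _ _] := wiener_integral_moments hW T0 ik WX.
rewrite (ipDl (sq_int_cst P p) (sq_intZ q sX) sZ) ipZl//; congr (_ + _).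
rewrite -(ipZl p (sq_int_cst P 1) sZ); apply: eq_Rintegral => w _ /=.
by rewrite mulr1.
Qed.

Lemma mode_mean : ip P (fun w => p + q * X w) (cst 1) = p.
Proof.
have [_ mX _] := wiener_integral_moments hW T0 ik WX.
by rewrite mode_ip ?ip_cst11 ?ip_cst1 ?mX ?mulr0 ?addr0 ?mulr1//; exact: sq_int_cst.
Qed.

Lemma mode_covariance : ip P (fun w => p + q * X w) (increment W 0 T) =
  q * \int[@lebesgue_measure R]_(x in `[0, T]) k x.
Proof.
have [_ _ cX] := wiener_integral_moments hW T0 ik WX.
rewrite mode_ip; last exact: increment_sq_int.
by rewrite cX ipC ip_cst1 (increment_mean hW (lexx 0) T0) mulr0 add0r.
Qed.

End mode_moments.

(** * The stability estimate *)

Theorem theorem4p2 (R : realType) (alpha T : R)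
  (halpha : 2^-1 < alpha < 1) (hT : 0 < T)
  (n : nat) (hn : (0 < n)%N)
  (D : set 'rV[R]_n) (Dopen : open D) (Dbounded : bounded_set D)
  (a : 'I_n -> 'I_n -> 'rV[R]_n -> R) (b : 'I_n -> 'rV[R]_n -> R)
  (c : 'rV[R]_n -> R)
  (asmooth : forall i j, smooth (a i j)) (bsmooth : forall i, smooth (b i))
  (csmooth : smooth c)
  (Asym : symmetric_op D a b c) (Aell : uniformly_elliptic D a)
  (Apos : positive_definite_op D a b c)
  (lambda : nat -> R) (phi : nat -> 'rV[R]_n -> R)
  (eigen : dirichlet_eigensystem D a b c lambda phi)
  (d : measure_display) (Omega : measurableType d) (P : probability Omega R)
  (W : R -> {RV P >-> R}) (hW : wiener_process W)
  (h : R -> R) (hbounded : h \_ `]0, T[ \in Lfun lebesgue_measure +oo%E)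
  (c_h : R) (c_h_gt0 : 0 < c_h)
  (h_ge : {ae lebesgue_measure, forall t : R, 0 < t < T -> c_h <= h t}) :
  exists2 C : R, 0 < C &
    forall f g : 'rV[R]_n -> R,
      L2 D f -> L2 D g -> L2norm D g != 0%E -> sobolev 2 D g ->
      forall u : R -> Omega -> 'rV[R]_n -> R,
        mild_solution D lambda phi W alpha T h f g u ->
        (L2norm D f ^+ 2 + L2norm D g ^+ 2 <=
           C%:E * \int[P]_w sobolev_norm2 2 D (u T w))%E.
Proof.
have a01 : 0 < alpha < 1.
  by case/andP: halpha => a1 ->; rewrite andbT (lt_trans _ a1).
have [C C0 HC] := elliptic_adjoint_bound Dopen Dbounded asmooth bsmooth csmooth.
have [mh [H H0 hH]] := essentially_bounded hbounded.
have l0 : 0 < lambda 0%N by case: eigen.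
have ll k : lambda 0%N <= lambda k by case: eigen => _ + _ _ _; apply.
have lk k : 0 < lambda k by exact: lt_le_trans (ll k).
pose q k := ml_mass alpha (lambda k) T.
have [c0 c00 qlb] : exists2 c0 : R, 0 < c0 & forall k, c0 <= lambda k * q k.
  exists (Gamma 1 * lambda 0%N * T `^ alpha / (Gamma (1 + alpha) + Gamma 1 * lambda 0%N * T `^ alpha)).
    have G1 : 0 < Gamma (1 : R) by exact: Gamma_gt0.
    have Ga : 0 < Gamma (1 + alpha) by apply: Gamma_gt0; case/andP: a01 => ? _; rewrite addr_gt0.
    have Ta : 0 < T `^ alpha by rewrite powR_gt0.
    have GT := mulr_gt0 (mulr_gt0 G1 l0) Ta.
    by apply: divr_gt0 => //; exact: addr_gt0.
  by move=> k; exact: ml_mass_ge.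
have qub k : lambda k * q k <= 1 by exact: ml_mass_le.
set M := Num.max c_h H.
have M0 : 0 < M by rewrite lt_max c_h_gt0.
have drift k := drift_bounds a01 hT c_h_gt0 mh h_ge hH (lk k).
(* [4 * C] comes from moment_bound, the squares from the lower bounds of the two
   families of moments, and [T] is the variance of the increment over [0, T]. *)
pose A := 4 * C / (c_h * c0) ^+ 2; pose A' := 4 * C * T / c0 ^+ 2.
have A0 : 0 < A by rewrite divr_gt0 ?mulr_gt0// exprn_gt0// mulr_gt0.
have A'0 : 0 < A' by rewrite divr_gt0 ?mulr_gt0// exprn_gt0.
exists (A + A'); first exact: addr_gt0.
move=> f g Lf Lg _ _ u /(_ T); rewrite lexx ltW// => /(_ isT)[mu_ [J [WJ cJ]]].
have : (0 <= \int[P]_w sobolev_norm2 2 D (u T w))%E.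
  by apply: integral_ge0 => w _; exact: sobolev_norm2_ge0.
case EB : (\int[P]_w sobolev_norm2 2 D (u T w))%E => [B| |]// B0; last first.
  by rewrite mulry gtr0_sg ?addr_gt0// mul1e leey.
have Ik k : (\int[lebesgue_measure]_(tau in `[0%R, T])
    (relaxation_kernel alpha (lambda k) T tau)%:E = (q k)%:E)%E.
  exact: integral_relaxation_kernel.
have ik k : (@lebesgue_measure R).-integrable `[0, T]
    (EFin \o relaxation_kernel alpha (lambda k) T).
  exact: integrable_relaxation_kernel.
pose I k w := mild_drift D lambda phi alpha h f k T + L2dot D g (phi k) * J k w.
have sI k : sq_int P (I k).
  exact: (mode_sq_int hW (mild_drift D lambda phi alpha h f k T)
    (L2dot D g (phi k)) (ltW hT) (ik k) (WJ k)).
have mb := moment_bound Dopen Dbounded asmooth bsmooth csmooth eigen mu_ sI cJ C0 HC EB.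
(* Common to both sources: Parseval and Bessel turn the comparability of the
   coefficients with the moments into a bound of the norm. *)
have moments_control v (s e : R) (Z : Omega -> R) : L2 D v -> 0 < e -> sq_int P Z ->
    (forall k, (e * L2dot D v (phi k)) ^+ 2 <= (lambda k * ip P (I k) Z) ^+ 2
       <= (s * L2dot D v (phi k)) ^+ 2) ->
    (L2norm D v ^+ 2 <= (4 * C / e ^+ 2 * ip P Z Z * B)%:E)%E.
  move=> Lv e0 sZ vZ; apply: (eigen_parseval eigen) => // N.
  have e20 : 0 < e ^+ 2 by rewrite exprn_gt0.
  have : \sum_(k < N) (e * L2dot D v (phi k)) ^+ 2 <= 4 * (C * B * ip P Z Z).
    apply: le_trans (mb Z (s ^+ 2 * ip (lebesgue_rV R n) (v \_ D) (v \_ D)) sZ _ N).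
      by apply: ler_sum => k _; case/andP: (vZ k).
    move=> M'; apply: le_trans (ler_wpM2l (sqr_ge0 s) (eigen_bessel eigen M' Lv)).
    by rewrite mulr_sumr; apply: ler_sum => k _; rewrite -exprMn; case/andP: (vZ k).
  under eq_bigr do rewrite exprMn; rewrite -mulr_sumr mulrC -ler_pdivlMr//.
  by move/le_trans; apply; rewrite le_eqVlt; apply/orP; left; apply/eqP; field; rewrite gt_eqF.
have Ef : (L2norm D f ^+ 2 <= (A * B)%:E)%E.
  have := moments_control f M (c_h * c0) (cst 1) Lf (mulr_gt0 c_h_gt0 c00) (sq_int_cst _ _).
  rewrite ip_cst11 mulr1; apply => k.
  rewrite (mode_mean hW _ _ (ltW hT) (ik k) (WJ k)).
  rewrite mulrCA !(mulrC _ (L2dot D f (phi k))) !(exprMn _ (L2dot D f (phi k))).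
  set w := lambda k * _; have w1 : c_h * c0 <= w.
    have [+ _] := andP (drift k); rewrite -/(q k) => /(ler_wpM2l (ltW (lk k))).
    by apply: le_trans; rewrite mulrCA ler_pM2l.
  have w2 : w <= M.
    have [_] := andP (drift k); rewrite -/(q k) => /(ler_wpM2l (ltW (lk k))).
    by move/le_trans; apply; rewrite mulrCA -/M ger_pMr.
  have cc0 : 0 <= c_h * c0 by rewrite ltW// mulr_gt0.
  have w0 : 0 <= w by exact: le_trans w1.
  by rewrite !ler_wpM2l ?sqr_ge0// ler_pXn2r// nnegrE// ltW.
have Eg : (L2norm D g ^+ 2 <= (A' * B)%:E)%E.
  have sZ := increment_sq_int hW (lexx 0) (ltW hT).
  have := moments_control g 1 c0 _ Lg c00 sZ.
  rewrite (increment_ip hW (lexx 0) (ltW hT)) subr0.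
  have -> : 4 * C / c0 ^+ 2 * T = A' by rewrite /A' mulrAC.
  apply => k; rewrite (mode_covariance hW _ _ (ltW hT) (ik k) (WJ k)).
  rewrite /Rintegral Ik/= mulrCA !(mulrC _ (L2dot D g (phi k))) !(exprMn _ (L2dot D g (phi k))).
  have w0 : 0 <= lambda k * q k by apply: le_trans (qlb k); exact: ltW.
  by rewrite !ler_wpM2l ?sqr_ge0// ler_pXn2r// nnegrE ltW.
by rewrite -EFinM mulrDl EFinD; exact: leeD.
Qed.
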